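(* The complex lines $\mathbb{P}(\mathbb{C}^2)$ and $\mathbb{P}(\mathbb{C}\oplus\mathbb{C}^\sigma)$, with their natural $C_2$-actions, are not equivariantly cobordant (as complex $C_2$-manifolds).
   Context: $C_2$ is the group of order two, $\mathbb{C}$ is its trivial complex representation and $\mathbb{C}^\sigma$ its complex sign representation. For a complex representation $V$, $\mathbb{P}(V)$ is the projective space of complex lines in $V$ with the induced $C_2$-action; so $\mathbb{P}(\mathbb{C}^2)$ has trivial action. Both are complex $C_2$-manifolds (closed $C_2$-manifolds whose tangent bundle has a given $C_2$-equivariant complex structure). Equivariant cobordism is cobordism of (stably almost) complex $C_2$-manifolds: $M$ and $N$ are cobordant if there is a compact $C_2$-manifold $W$ with $\partial W\cong M\sqcup N$, with a $C_2$-equivariant complex structure on $\tau_W\oplus\mathbb{R}^k$ for some trivial summand $\mathbb{R}^k$, restricting on the boundary (up to the usual stabilization) to the given structure on $M$ and the opposite of the given structure on $N$. *)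

(* Defs.v *)
From HB Require Import structures.
From mathcomp Require Import all_boot all_order all_algebra.
From mathcomp Require Import complex.
From mathcomp Require Import all_classical all_reals all_analysis.
From mathcomp Require Import ring lra.

Set Implicit Arguments.
Unset Strict Implicit.
Unset Printing Implicit Defensive.

Import Order.TTheory GRing.Theory Num.Theory.
Import numFieldNormedType.Exports.

Local Open Scope classical_set_scope.
Local Open Scope ring_scope.
Local Open Scope quotient_scope.

(* [Ck k U f]: for U open, f is of class C^k on U. *)
Fixpoint Ck (R : realType) (n k : nat) (U : set 'rV[R]_n) (f : 'rV[R]_n -> R) :
    Prop :=
  if k is k'.+1 then
    (forall x, U x -> differentiable f x) /\
    (forall v, Ck k' U (fun x => 'D_v f x))
  else forall x, U x -> {for x, continuous f}.

Definition smooth_on (R : realType) (n m p : nat) (U : set 'rV[R]_n)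
    (f : 'rV[R]_n -> 'M[R]_(m, p)) : Prop :=
  forall i j k, Ck k U (fun x => f x i j).

(* As usual at boundary points of a half-space, smoothness at x of a function
   given on A means that it extends to a smooth function g on a neighbourhood
   of x in the whole vector space. *)
Definition smooth_extension (R : realType) (n m p : nat) (A : set 'rV[R]_n)
    (f : 'rV[R]_n -> 'M[R]_(m, p)) (x : 'rV[R]_n)
    (g : 'rV[R]_n -> 'M[R]_(m, p)) : Prop :=
  exists U : set 'rV[R]_n, [/\ open U, U x, smooth_on U g &
    forall y, U y -> A y -> f y = g y].

Definition smooth_at (R : realType) (n m p : nat) (A : set 'rV[R]_n)
    (f : 'rV[R]_n -> 'M[R]_(m, p)) (x : 'rV[R]_n) : Prop :=
  exists g, smooth_extension A f x g.

(* D is unique when A is R^n or a closed half-space.  Vectors are rows: the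
   differential is v |-> v *m D. *)
Definition has_jacobian (R : realType) (n m : nat) (A : set 'rV[R]_n)
    (f : 'rV[R]_n -> 'rV[R]_m) (x : 'rV[R]_n) (D : 'M[R]_(n, m)) : Prop :=
  exists2 g, smooth_extension A f x g & D = jacobian g x.

Definition halfspace (R : realType) (n : nat) : set 'rV[R]_n.+1 :=
  [set p | 0 <= p ord0 ord0].
Arguments halfspace R n : clear implicits.

Record chart (R : realType) (n : nat) (X : topologicalType) := Chart {
  dom : set X;
  cod : set 'rV[R]_n;
  fwd : X -> 'rV[R]_n;
  bwd : 'rV[R]_n -> X }.

(* c is a homeomorphism from an open subset of X onto a relatively open subset
   of the model H; [fwd c] and [bwd c] are irrelevant off [dom c], [cod c]. *)
Definition is_chart (R : realType) (n : nat) (H : set 'rV[R]_n)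
    (X : topologicalType) (c : chart R n X) : Prop :=
  [/\ open (dom c) /\ (exists2 O, open O & cod c = O `&` H),
      forall x, dom c x -> cod c (fwd c x) /\ bwd c (fwd c x) = x,
      forall p, cod c p -> dom c (bwd c p) /\ fwd c (bwd c p) = p,
      {within dom c, continuous (fwd c)} &
      {within cod c, continuous (bwd c)}].

(* The model H is R^n for closed manifolds and a closed half-space for manifolds
   with boundary.  Second countability follows from compactness. *)
Record manifold (R : realType) (n : nat) (H : set 'rV[R]_n) := Manifold {
  carrier :> topologicalType;
  atlas : set (chart R n carrier);
  manifold_hausdorff : hausdorff_space carrier;
  manifold_compact : compact [set: carrier];
  atlas_chart : forall c, atlas c -> is_chart H c;
  atlas_cover : forall x, exists2 c, atlas c & dom c x;
  atlas_smooth : forall c d x, atlas c -> atlas d -> dom c x -> dom d x ->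
    smooth_at H (fwd d \o bwd c) (fwd c x) }.

Definition boundary (R : realType) (n : nat) (W : manifold (halfspace R n)) :
    set W :=
  [set y | exists c, [/\ atlas c, dom c y & fwd c y ord0 ord0 = 0]].

(* D is the matrix of the differential T_x X -> T_(f x) Y in the charts c, d. *)
Definition tangent_map (R : realType) (n m : nat) (H : set 'rV[R]_n)
    (K : set 'rV[R]_m) (X : manifold H) (Y : manifold K) (f : X -> Y)
    (c : chart R n X) (d : chart R m Y) (x : X) (D : 'M[R]_(n, m)) : Prop :=
  [/\ atlas c, atlas d, dom c x, dom d (f x) &
      has_jacobian H (fwd d \o f \o bwd c) (fwd c x) D].

Definition smooth_map (R : realType) (n m : nat) (H : set 'rV[R]_n)
    (K : set 'rV[R]_m) (X : manifold H) (Y : manifold K) (f : X -> Y) : Prop :=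
  continuous f /\
  forall c d x, atlas c -> atlas d -> dom c x -> dom d (f x) ->
    smooth_at H (fwd d \o f \o bwd c) (fwd c x).

Definition immersion (R : realType) (n m : nat) (H : set 'rV[R]_n)
    (K : set 'rV[R]_m) (X : manifold H) (Y : manifold K) (f : X -> Y) : Prop :=
  smooth_map f /\ forall c d x D, tangent_map f c d x D -> row_free D.

Definition stab (R : realType) (k n m : nat) (D : 'M[R]_(n, m)) :
    'M[R]_(n + k, m + k) :=
  block_mx D 0 0 1%:M.

(* Multiplication by i on C^a = R^2a, with real basis e_1, i e_1, e_2, i e_2... *)
Definition std_J (R : realType) (m : nat) : 'M[R]_m :=
  \matrix_(i, j) (if odd i then - (i == j.+1 :> nat)%:R
                  else (j == i.+1 :> nat)%:R).
Arguments std_J R m : clear implicits.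

(* The bundle tau_X (for E = id), resp. tau_X + R^k (for E = stab k), has fibre
   R^m in each chart, and a map f with differential D acts on fibres by E D.  An
   endomorphism J of it is given by its matrix J c x at x in the chart c. *)
Definition compatible (R : realType) (n m : nat) (H : set 'rV[R]_n)
    (X : manifold H) (E : 'M[R]_n -> 'M[R]_m) (J : chart R n X -> X -> 'M[R]_m)
    (f : X -> X) : Prop :=
  forall c d x D, tangent_map f c d x D -> J c x *m E D = E D *m J d (f x).

Definition complex_structure (R : realType) (n m : nat) (H : set 'rV[R]_n)
    (X : manifold H) (E : 'M[R]_n -> 'M[R]_m) (J : chart R n X -> X -> 'M[R]_m) :
    Prop :=
  [/\ forall c x, atlas c -> dom c x -> J c x *m J c x = - 1%:M,
      forall c x, atlas c -> dom c x -> smooth_at H (J c \o bwd c) (fwd c x) &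
      compatible E J idfun].

(* An action of the group of order two is given by the involution by which its
   generator acts. *)
Record C2_manifold (R : realType) (n : nat) (H : set 'rV[R]_n) := C2Manifold {
  C2_base :> manifold H;
  act : C2_base -> C2_base;
  act_smooth : smooth_map act;
  act_involutive : involutive act }.

Record complex_C2_manifold (R : realType) (n : nat) := ComplexC2Manifold {
  complex_base :> C2_manifold [set: 'rV[R]_n];
  tangent_J : chart R n complex_base -> complex_base -> 'M[R]_n;
  tangent_J_complex : complex_structure id tangent_J;
  tangent_J_equivariant : compatible id tangent_J (@act _ _ _ complex_base) }.

Section Cobordism.
Variables (R : realType) (n : nat).

(* The restriction of J along the inclusion f of a part of the boundary of W is
   the structure of M, stabilised: under an isomorphism
     tau_M + R + R^k = f^* tau_W + R^k,  (v, s, w) |-> (df v + s nu, w),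
   J is the sum of the structure of M and of the standard one on R^(1 + k).  Here
   nu is a field of vectors pointing out of W for eps = -1 and into W for eps = 1:
   in the charts of W a vector points inwards if its first coordinate is positive.
   The equation forces nu = - J e for the first basis vector e of R^k, so nu is
   automatically smooth, equivariant and independent of the charts. *)
Definition restricts_to (W : C2_manifold (halfspace R n)) (k : nat)
    (J : chart R n.+1 W -> W -> 'M[R]_(n.+1 + k)) (M : complex_C2_manifold R n)
    (f : M -> W) (eps : R) : Prop :=
  forall c d x D, tangent_map f c d x D ->
    exists nu : 'rV[R]_n.+1,
      let B : 'M[R]_(n + (1 + k), n.+1 + k) :=
        col_mx (row_mx D 0) (block_mx nu 0 0 1%:M) in
      0 < eps * nu ord0 ord0 /\
      B *m J d (f x) =
        block_mx (tangent_J c x) 0 0 (std_J R (1 + k)) *m B.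

Definition equivariant_immersion (W : C2_manifold (halfspace R n))
    (M : complex_C2_manifold R n) (f : M -> W) : Prop :=
  immersion f /\ forall x, f (act x) = act (f x).

(* The maps f and g together form an equivariant diffeomorphism from the disjoint
   union of M and N to the boundary of W.  As the cylinder M x [0, 1] shows,
   taking the outward normal on M and the inward one on N amounts to putting the
   given structure on M and the opposite one on N. *)
Definition cobordant (M N : complex_C2_manifold R n) : Prop :=
  exists (W : C2_manifold (halfspace R n)) (k : nat)
         (J : chart R n.+1 W -> W -> 'M[R]_(n.+1 + k))
         (f : M -> W) (g : N -> W),
    [/\ complex_structure (@stab R k n.+1 n.+1) J /\
        compatible (@stab R k n.+1 n.+1) J (@act _ _ _ W),
        equivariant_immersion f /\ equivariant_immersion g,
        injective f /\ injective g,
        range f `&` range g = set0 /\ (range f `|` range g = @boundary R n W) &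
        restricts_to J f (-1) /\ restricts_to J g 1].

End Cobordism.

Section SmoothCalculus.
Variables (R : realType) (n : nat) (U : set 'rV[R]_n).
Hypothesis openU : open U.
Implicit Types f g : 'rV[R]_n -> R.

Lemma near_open x (P : 'rV[R]_n -> Prop) :
  U x -> (forall y, U y -> P y) -> \forall y \near x, P y.
Proof.
move=> Ux UP; have : nbhs x U by apply: open_nbhs_nbhs.
by apply: filterS.
Qed.

Lemma near_eq_differentiable (V W : normedModType R) (f g : V -> W) x :
  {near x, f =1 g} -> differentiable f x -> differentiable g x.
Proof.
move=> fg fd; have fgx : f x = g x := nbhs_singleton fg.
have df : g \o shift x = cst (g x) + 'd f x +o_ 0 id.
  have := diff_locally fd; rewrite fgx => /eqaddoP H.
  apply/eqaddoP => e e0; have {}H := H e e0.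
  have nb : \forall h \near 0, f (h + x) = g (h + x).
    have := fg; rewrite (near_shift 0) /= .
    by apply: filterS => h; rewrite /= subr0.
  near=> h; have -> : (g \o shift x - (cst (g x) + 'd f x)) h =
     (f \o shift x - (cst (g x) + 'd f x)) h.
    by rewrite !fctE /=; congr (_ - _); apply/esym; near: h.
  by near: h.
have cd : continuous ('d f x) by apply: diff_continuous.
have E := diff_unique cd df.
by apply/diff_locallyP; rewrite E.
Unshelve. all: by end_near. Qed.

Lemma Ck_ext k f g : (forall x, U x -> f x = g x) -> Ck k U f -> Ck k U g.
Proof.
elim: k f g => [|k IH] f g fg /=.
  move=> fc x Ux; rewrite /prop_for /continuous_at -fg //.
  have Hn : \forall y \near x, f y = g y by apply: (near_open Ux) => y /fg.
  by apply: cvg_trans (fc x Ux); exact: (near_eq_cvg Hn).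
move=> [fd fv]; split=> [x Ux|v].
  by apply: near_eq_differentiable (fd x Ux); apply: (near_open Ux) => y /fg.
apply: IH (fv v) => x Ux; apply: near_eq_derive.
by apply: (near_open Ux) => y /fg.
Qed.

Lemma Ck_pred k f : Ck k.+1 U f -> Ck k U f.
Proof.
elim: k f => [|k IH] f /= [fd fv].
  by move=> x Ux; exact: (differentiable_continuous (fd x Ux)).
by split=> // v; apply: IH; exact: fv.
Qed.

Lemma Ck_cst k (a : R) : Ck k U (fun=> a).
Proof.
elim: k a => [|k IH] a /=; first by move=> x _; exact: (@cst_continuous _ _ a x).
split=> [x _|v]; first exact: differentiable_cst.
by apply: Ck_ext (IH 0) => x _; rewrite derive_cst.
Qed.

Lemma Ck_coord k (j : 'I_n) : Ck k U (fun x : 'rV[R]_n => x ord0 j).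
Proof.
case: k => [|k] /=; first by move=> x _; exact: coord_continuous.
have dc x : differentiable (fun y : 'rV[R]_n => y ord0 j : R) x.
  exact: differentiable_coord.
split=> [x _|v]; first exact: dc.
apply: Ck_ext (Ck_cst k (v ord0 j)) => x _.
have Hd : derivable (@id 'rV[R]_n) x v by exact: derivable_id.
have := derive_mx Hd; rewrite derive_id => /matrixP /(_ ord0 j).
by rewrite mxE.
Qed.

Lemma CkD k f g : Ck k U f -> Ck k U g -> Ck k U (fun x => f x + g x).
Proof.
elim: k f g => [|k IH] f g /=.
  by move=> fc gc x Ux; apply: continuousD; [exact: fc | exact: gc].
move=> [fd fv] [gd gv]; split=> [x Ux|v].
  by apply: (@differentiableD _ _ _ f g); [exact: fd | exact: gd].
apply: Ck_ext (IH _ _ (fv v) (gv v)) => x Ux.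
by rewrite (@deriveD _ _ _ f g) //; apply: diff_derivable; [exact: fd|exact: gd].
Qed.

Lemma CkM k f g : Ck k U f -> Ck k U g -> Ck k U (fun x => f x * g x).
Proof.
elim: k f g => [|k IH] f g.
  by move=> fc gc x Ux; apply: continuousM; [exact: fc | exact: gc].
move=> Hf Hg; have Hf' := Ck_pred Hf; have Hg' := Ck_pred Hg.
case: Hf Hg => [fd fv] [gd gv]; split=> [x Ux|v].
  by apply: (@differentiableM _ _ f g); [exact: fd | exact: gd].
apply: Ck_ext (CkD (IH _ _ Hf' (gv v)) (IH _ _ Hg' (fv v))) => x Ux.
by rewrite (@deriveM _ _ f g) //; apply: diff_derivable; [exact: fd|exact: gd].
Qed.

Lemma CkN k f : Ck k U f -> Ck k U (fun x => - f x).
Proof.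
move=> Hf; apply: Ck_ext (CkM (Ck_cst k (-1)) Hf) => x _ /=.
by rewrite mulN1r.
Qed.

Lemma CkV k f : (forall x, U x -> f x != 0) -> Ck k U f ->
  Ck k U (fun x => (f x)^-1).
Proof.
move=> f0; elim: k => [|k IH].
  move=> fc x Ux; apply: (@continuousV _ _ f x); [exact: f0 | exact: fc].
move=> Hf; have Hf' := Ck_pred Hf; case: Hf => [fd fv]; split=> [x Ux|v].
  by apply: (@differentiableV _ _ f); [exact: fd | exact: f0].
apply: Ck_ext (CkN (CkM (CkM (IH Hf') (IH Hf')) (fv v))) => x Ux.
rewrite (@deriveV _ _ f) ?f0 //; last by apply: diff_derivable; exact: fd.
by rewrite scaleNr /GRing.scale /= -expr2 exprVn.
Qed.

Lemma derive_addE f g x v : derivable f x v -> derivable g x v ->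
  'D_v (fun y => f y + g y) x = 'D_v f x + 'D_v g x.
Proof. exact: deriveD. Qed.

Lemma derive_oppE f x v : derivable f x v ->
  'D_v (fun y => - f y) x = - 'D_v f x.
Proof. exact: deriveN. Qed.

Lemma derivable_mulE f g x v : derivable f x v -> derivable g x v ->
  derivable (fun y => f y * g y) x v.
Proof. exact: derivableM. Qed.

Lemma derive_mulE f g x v : derivable f x v -> derivable g x v ->
  'D_v (fun y => f y * g y) x = f x * 'D_v g x + g x * 'D_v f x.
Proof. exact: deriveM. Qed.

Lemma derivable_invE f x v : f x != 0 -> derivable f x v ->
  derivable (fun y => (f y)^-1) x v.
Proof. by move=> f0 df; exact: derivableV. Qed.

Lemma derive_invE f x v : f x != 0 -> derivable f x v ->
  'D_v (fun y => (f y)^-1) x = - (f x) ^- 2 * 'D_v f x.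
Proof. by move=> f0 df; rewrite -/(GRing.scale _ _) -deriveV. Qed.

Lemma derive_mul_add f g (h k : 'rV[R]_n -> R) x v : derivable f x v -> derivable g x v ->
  derivable h x v -> derivable k x v ->
  'D_v (fun y => f y * g y + h y * k y) x =
  f x * 'D_v g x + g x * 'D_v f x + (h x * 'D_v k x + k x * 'D_v h x).
Proof.
move=> df dg dh dk.
rewrite (derive_addE (derivable_mulE df dg) (derivable_mulE dh dk)).
by rewrite (derive_mulE df dg) (derive_mulE dh dk).
Qed.

Lemma derive_mul_sub f g (h k : 'rV[R]_n -> R) x v : derivable f x v -> derivable g x v ->
  derivable h x v -> derivable k x v ->
  'D_v (fun y => f y * g y + - (h y * k y)) x =
  f x * 'D_v g x + g x * 'D_v f x - (h x * 'D_v k x + k x * 'D_v h x).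
Proof.
move=> df dg dh dk; have dhk := derivable_mulE dh dk.
rewrite (derive_addE (derivable_mulE df dg) (derivableN dhk)).
by rewrite (derive_oppE dhk) (derive_mulE df dg) (derive_mulE dh dk).
Qed.

Lemma derive_mul_inv f g x v : g x != 0 -> derivable f x v -> derivable g x v ->
  'D_v (fun y => f y * (g y)^-1) x =
  f x * (- (g x) ^- 2 * 'D_v g x) + (g x)^-1 * 'D_v f x.
Proof.
move=> g0 df dg.
by rewrite (derive_mulE df (derivable_invE g0 dg)) (derive_invE g0 dg).
Qed.

End SmoothCalculus.

Lemma differentiable_row (R : realType) (n m : nat) (F : 'rV[R]_n -> 'rV[R]_m) x :
  (forall j, differentiable (fun y => F y ord0 j) x) -> differentiable F x.
Proof.
move=> dF.
have -> : F = \sum_(j < m) (fun y => F y ord0 j *: delta_mx ord0 j).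
  by apply/funext => y; rewrite fct_sumE -row_sum_delta.
by apply: differentiable_sum => j; apply: differentiableZl; exact: dF.
Qed.

Lemma has_jacobian_derive (R : realType) (n m : nat) (U : set 'rV[R]_n)
    (f F : 'rV[R]_n -> 'rV[R]_m) x D v :
  open U -> U x -> (forall y, U y -> f y = F y) ->
  has_jacobian [set: 'rV[R]_n] f x D -> 'D_v F x = v *m D.
Proof.
move=> oU Ux fF [g [V [oV Vx sg fg]] ->].
rewrite -deriveEjacobian; last first.
  by apply: differentiable_row => j; have [+ _] := sg ord0 j 1%N; apply.
apply: near_eq_derive; apply: (@near_open _ _ (U `&` V)); first exact: openI.
  by [].
by move=> y [Uy Vy]; rewrite -fF // fg.
Qed.

Lemma ord2P (j : 'I_2) : j = ord0 \/ j = ord_max.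
Proof. by case: j => -[|[|//]] ?; [left|right]; exact/val_inj. Qed.

Section Holomorphic.
Variables (R : realType) (U : set 'rV[R]_2).
Hypothesis openU : open U.
Local Notation J := (std_J R 2).
Implicit Types h : 'rV[R]_2 -> R[i].

Definition ReIm (z : R[i]) : 'rV[R]_2 :=
  \row_j (if j == ord0 then complex.Re z else complex.Im z).
Definition toC (p : 'rV[R]_2) : R[i] :=
  Complex (p ord0 ord0) (p ord0 ord_max).

Definition holomorphic h := [/\ forall k, Ck k U (fun x => complex.Re (h x)),
  forall k, Ck k U (fun x => complex.Im (h x)) &
  forall x v, U x ->
    'D_(v *m J) (fun x => complex.Re (h x)) x =
       - 'D_v (fun x => complex.Im (h x)) x /\
    'D_(v *m J) (fun x => complex.Im (h x)) x =
       'D_v (fun x => complex.Re (h x)) x].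

Lemma holomorphic_cst a : holomorphic (fun=> a).
Proof.
by split=> [k|k|x v Ux]; [exact: Ck_cst.. | rewrite !derive_cst oppr0].
Qed.

Lemma derive_coord (n : nat) (j : 'I_n) (x v : 'rV[R]_n) :
  'D_v (fun y : 'rV[R]_n => y ord0 j) x = v ord0 j.
Proof.
have Hd : derivable (@id 'rV[R]_n) x v by exact: derivable_id.
by have := derive_mx Hd; rewrite derive_id => /matrixP /(_ ord0 j); rewrite mxE.
Qed.

Lemma mul_std_J2 (v : 'rV[R]_2) :
  v *m J = \row_j (if j == ord0 then - v ord0 ord_max else v ord0 ord0).
Proof.
apply/rowP => j; rewrite !mxE big_ord_recl big_ord1 !mxE /=.
have -> : lift ord0 ord0 = ord_max :> 'I_2 by exact/val_inj.
by have [->|->] := ord2P j; rewrite /= ?eqxx /=; ring.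
Qed.

Lemma holomorphic_toC : holomorphic toC.
Proof.
split=> [k|k|x v Ux]; [exact: Ck_coord.. | rewrite /toC /= !derive_coord].
by rewrite mul_std_J2 !mxE.
Qed.

Lemma holomorphicP h x (v : 'rV[R]_2) : holomorphic h -> U x ->
  derivable (fun x => complex.Re (h x)) x v /\
  derivable (fun x => complex.Im (h x)) x v.
Proof.
move=> [hR hI _] Ux; split; apply: diff_derivable.
- by have [+ _] := hR 1%N; apply.
- by have [+ _] := hI 1%N; apply.
Qed.

Lemma holomorphicD h1 h2 : holomorphic h1 -> holomorphic h2 ->
  holomorphic (fun x => h1 x + h2 x).
Proof.
move=> H1 H2; have P1 x v := @holomorphicP _ x v H1; have P2 x v := @holomorphicP _ x v H2.
have ReE x : complex.Re (h1 x + h2 x) = complex.Re (h1 x) + complex.Re (h2 x).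
  by case: (h1 x) (h2 x) => [? ?] [].
have ImE x : complex.Im (h1 x + h2 x) = complex.Im (h1 x) + complex.Im (h2 x).
  by case: (h1 x) (h2 x) => [? ?] [].
rewrite /holomorphic (funext ReE) (funext ImE).
case: H1 H2 => [R1 I1 C1] [R2 I2 C2].
split=> [k|k|x v Ux]; [exact: CkD.. | ].
have [a1 b1] := P1 _ v Ux; have [a2 b2] := P2 _ v Ux.
have [a3 b3] := P1 _ (v *m J) Ux; have [a4 b4] := P2 _ (v *m J) Ux.
have [e1 e2] := C1 _ v Ux; have [e3 e4] := C2 _ v Ux.
rewrite !deriveD //.
by rewrite e1 e2 e3 e4 opprD.
Qed.

Lemma holomorphicM h1 h2 : holomorphic h1 -> holomorphic h2 ->
  holomorphic (fun x => h1 x * h2 x).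
Proof.
move=> H1 H2; have P1 x v := @holomorphicP _ x v H1; have P2 x v := @holomorphicP _ x v H2.
have ReE x : complex.Re (h1 x * h2 x) =
    complex.Re (h1 x) * complex.Re (h2 x) + - (complex.Im (h1 x) * complex.Im (h2 x)).
  by case: (h1 x) (h2 x) => [? ?] [].
have ImE x : complex.Im (h1 x * h2 x) =
    complex.Re (h1 x) * complex.Im (h2 x) + complex.Im (h1 x) * complex.Re (h2 x).
  by case: (h1 x) (h2 x) => [? ?] [].
rewrite /holomorphic (funext ReE) (funext ImE).
case: H1 H2 => [R1 I1 C1] [R2 I2 C2].
split=> [k|k|x v Ux].
- by apply: CkD => //; [exact: CkM | apply: CkN => //; exact: CkM].
- by apply: CkD => //; exact: CkM.
have [a1 b1] := P1 _ v Ux; have [a2 b2] := P2 _ v Ux.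
have [a3 b3] := P1 _ (v *m J) Ux; have [a4 b4] := P2 _ (v *m J) Ux.
have [e1 e2] := C1 _ v Ux; have [e3 e4] := C2 _ v Ux.
rewrite (derive_mul_sub a3 a4 b3 b4) (derive_mul_add a3 b4 b3 a4).
rewrite (derive_mul_sub a1 a2 b1 b2) (derive_mul_add a1 b2 b1 a2).
by rewrite e1 e2 e3 e4; split; ring.
Qed.

Lemma holomorphicV h : (forall x, U x -> h x != 0) -> holomorphic h ->
  holomorphic (fun x => (h x)^-1).
Proof.
move=> h0 H; have P x v := @holomorphicP _ x v H.
pose N x := complex.Re (h x) * complex.Re (h x) + complex.Im (h x) * complex.Im (h x).
have ReE x : complex.Re (h x)^-1 = complex.Re (h x) * (N x)^-1.
  by rewrite /N; case: (h x).
have ImE x : complex.Im (h x)^-1 = - (complex.Im (h x) * (N x)^-1).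
  by rewrite /N; case: (h x).
have N0 x : U x -> N x != 0.
  move=> Ux; have := h0 x Ux; apply: contra; rewrite /N -!expr2.
  case: (h x) => a b /=; rewrite paddr_eq0 ?sqr_ge0 // !sqrf_eq0.
  by move=> /andP[/eqP -> /eqP ->].
rewrite /holomorphic (funext ReE) (funext ImE).
case: H => [HR HI HC].
have CN k : Ck k U N by apply: CkD => //; exact: CkM.
have CNV k : Ck k U (fun x => (N x)^-1) by exact: CkV.
split=> [k|k|x v Ux].
- exact: CkM.
- by apply: CkN => //; exact: CkM.
have dN w : derivable N x w.
  by apply: diff_derivable; have [+ _] := CN 1%N; apply.
have [a1 b1] := P _ v Ux; have [a3 b3] := P _ (v *m J) Ux.
have [e1 e2] := HC _ v Ux.
have Nx := N0 _ Ux.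
have DN w : derivable (fun x => complex.Re (h x)) x w ->
    derivable (fun x => complex.Im (h x)) x w ->
    'D_w N x = complex.Re (h x) * 'D_w (fun x => complex.Re (h x)) x *+ 2 +
               complex.Im (h x) * 'D_w (fun x => complex.Im (h x)) x *+ 2.
  by move=> df dg; rewrite /N (derive_mul_add df df dg dg) !mulr2n.
have NE : N x = complex.Re (h x) ^+ 2 + complex.Im (h x) ^+ 2 by rewrite !expr2.
clearbody N.
have dV w (f : 'rV[R]_2 -> R) : derivable f x w -> derivable (fun y => f y * (N y)^-1) x w.
  by move=> df; exact: derivable_mulE df (derivable_invE Nx (dN w)).
rewrite (derive_mul_inv Nx a3 (dN _)) (derive_oppE (dV _ _ b1)).
rewrite (derive_oppE (dV _ _ b3)) (derive_mul_inv Nx b1 (dN _)).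
rewrite (derive_mul_inv Nx b3 (dN _)) (derive_mul_inv Nx a1 (dN _)).
rewrite (DN _ a1 b1) (DN _ a3 b3) e1 e2.
move: Nx; rewrite NE => Nx.
by split; field; rewrite ?Nx.
Qed.

(* In the coordinates of R^2 = C, a holomorphic map is smooth and its differential
   is C-linear. *)
Lemma holomorphic_smooth_at h f x : holomorphic h -> U x ->
  (forall y, U y -> f y = ReIm (h y)) -> smooth_at [set: 'rV[R]_2] f x.
Proof.
move=> [HR HI _] Ux fE; exists (fun y => ReIm (h y)), U; split=> //.
  move=> i j k; rewrite /ReIm.
  have [j0|j0] := eqVneq j ord0.
    by apply: Ck_ext (HR k) => // y _; rewrite mxE j0.
  by apply: Ck_ext (HI k) => // y _; rewrite mxE (negbTE j0).
by move=> y Uy _; exact: fE.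
Qed.

Lemma holomorphic_jacobian h f x D : holomorphic h -> U x ->
  (forall y, U y -> f y = ReIm (h y)) ->
  has_jacobian [set: 'rV[R]_2] f x D -> J *m D = D *m J.
Proof.
move=> H Ux fE fD; have [HR HI HC] := H.
have dE v : 'D_v (fun y => ReIm (h y)) x = ReIm
    (Complex ('D_v (fun y => complex.Re (h y)) x) ('D_v (fun y => complex.Im (h y)) x)).
  have [dr di] := holomorphicP v H Ux.
  rewrite derive_mx; last first.
    apply/derivable_mxP => i j.
    have [j0|j0] := eqVneq j ord0.
      by rewrite (_ : (fun _ => _) = (fun y => complex.Re (h y))) //;
        apply/funext => y; rewrite mxE j0.
    by rewrite (_ : (fun _ => _) = (fun y => complex.Im (h y))) //;
      apply/funext => y; rewrite mxE (negbTE j0).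
  apply/rowP => j; rewrite !mxE.
  case: ifPn => j0; congr ('D_v _ x); apply/funext => y; rewrite mxE ?j0 //.
  by rewrite (negbTE j0).
have DE v : v *m D = ReIm
    (Complex ('D_v (fun y => complex.Re (h y)) x) ('D_v (fun y => complex.Im (h y)) x)).
  by rewrite -dE; apply/esym/(has_jacobian_derive (U := U) _ openU Ux fE fD).
apply/row_matrixP => i; rewrite !rowE !mulmxA !DE [RHS]mul_std_J2.
have [-> ->] := HC _ (delta_mx ord0 i) Ux.
by apply/rowP => j; have [->|->] := ord2P j; rewrite !mxE.
Qed.
End Holomorphic.

Section ComplexTopology.
Variable R : realType.
Local Notation C := (R[i]^o).
Local Notation V := 'rV[C]_2.

Lemma normc_ge_Im (z : R[i]) : `|complex.Im z|%:C%C <= `|z|.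
Proof.
have -> : complex.Im z = complex.Re (z * (- 'i)%C) by case: z => a b /=; ring.
rewrite (le_trans (normc_ge_Re _)) // normrM normrN (_ : `|'i%C| = 1) ?mulr1 //.
by rewrite normc_def /= expr0n /= add0r expr1n sqrtr1.
Qed.

Lemma continuous_Re : continuous (fun z : C => complex.Re z : R).
Proof.
move=> z; have F : Filter (nbhs (z : C)) by exact: nbhs_filter.
apply: (iffRL (@cvgrPdist_lt R R C (nbhs z) F _ _)) => e e0.
exists e%:C%C => /=; first by rewrite ltcR.
move=> w; rewrite /ball /= => zw; rewrite -ltcR; apply: le_lt_trans zw.
suff -> : complex.Re z - complex.Re w = complex.Re (z - w) by exact: normc_ge_Re.
by clear F; case: z w => [? ?] [].
Qed.

Lemma continuous_Im : continuous (fun z : C => complex.Im z : R).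
Proof.
move=> z; have F : Filter (nbhs (z : C)) by exact: nbhs_filter.
apply: (iffRL (@cvgrPdist_lt R R C (nbhs z) F _ _)) => e e0.
exists e%:C%C => /=; first by rewrite ltcR.
move=> w; rewrite /ball /= => zw; rewrite -ltcR; apply: le_lt_trans zw.
suff -> : complex.Im z - complex.Im w = complex.Im (z - w) by exact: normc_ge_Im.
by clear F; case: z w => [? ?] [].
Qed.

Lemma continuous_real_complex : continuous (fun x : R => x%:C%C : C).
Proof.
move=> x; apply/cvgrPdist_lt => e e0.
have ee : e = (complex.Re e)%:C%C by case: e e0 => a b; rewrite ltcE /= => /andP[/eqP->].
exists (complex.Re e) => /=; first by rewrite -ltcR -ee.
move=> y; rewrite /ball /= => xy; rewrite ee -rmorphB /= normc_def /= expr0n addr0.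
by rewrite sqrtr_sqr ltcR.
Qed.

Lemma continuous_div (T : topologicalType) (f g : T -> C) x :
  {for x, continuous f} -> {for x, continuous g} -> g x != 0 ->
  {for x, continuous (fun y => f y / g y : C)}.
Proof.
move=> fc gc g0.
have iv := @cvgV R[i] T (nbhs x) (nbhs_filter x) g (g x) g0 gc.
exact: (@cvgM R[i] T (nbhs x) (nbhs_filter x) f _ (f x) _ fc iv).
Qed.

Lemma continuous_ReIm : continuous (@ReIm R : C -> _).
Proof.
have -> : @ReIm R = (fun z => complex.Re z *: delta_mx ord0 ord0 +
                              complex.Im z *: delta_mx ord0 ord_max).
  apply/funext => z; apply/rowP => j; have [->|->] := ord2P j; rewrite !mxE /=; ring.
move=> z; apply: (@cvgD R 'rV[R]_2 C (nbhs z) (nbhs_filter z)).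
- exact: (@cvgZr_tmp R 'rV[R]_2 C (nbhs z) (nbhs_filter z) _ _ _ (@continuous_Re z)).
- exact: (@cvgZr_tmp R 'rV[R]_2 C (nbhs z) (nbhs_filter z) _ _ _ (@continuous_Im z)).
Qed.

Lemma continuous_toC : continuous (@toC R : _ -> C).
Proof.
have -> : @toC R = (fun p => (p ord0 ord0)%:C%C + (p ord0 ord_max)%:C%C * 'i%C).
  by apply/funext => p; rewrite /toC; simpc.
move=> p; apply: (@cvgD R[i] C _ (nbhs p) (nbhs_filter p)).
  apply: (@continuous_comp _ _ _ (fun p : 'rV[R]_2 => p ord0 ord0) (fun x : R => x%:C%C : C)).
    exact: coord_continuous.
  exact: continuous_real_complex.
apply: (@cvgMr_tmp R[i] _ (nbhs p) (nbhs_filter p)).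
apply: (@continuous_comp _ _ _ (fun p : 'rV[R]_2 => p ord0 ord_max) (fun x : R => x%:C%C : C)).
  exact: coord_continuous.
exact: continuous_real_complex.
Qed.

Lemma continuous_row (T : topologicalType) (f : T -> V) x :
  (forall j, {for x, continuous (fun y => f y ord0 j : C)}) -> {for x, continuous f}.
Proof.
move=> fc.
have -> : f = fun y => f y ord0 ord0 *: delta_mx ord0 ord0 +
                       f y ord0 ord_max *: delta_mx ord0 ord_max.
  apply/funext => z; apply/rowP => j; have [->|->] := ord2P j; rewrite !mxE /=; ring.
have fZ j := @cvgZr_tmp R[i] V T (nbhs x) (nbhs_filter x) _ _
  (delta_mx ord0 j) (fc j).
exact: (@cvgD R[i] V T (nbhs x) (nbhs_filter x) _ _ _ _ (fZ _) (fZ _)).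
Qed.

Lemma continuous_entry j : continuous (fun v : V => v ord0 j : C).
Proof. exact: (@coord_continuous R[i] 1 2 ord0 j). Qed.

End ComplexTopology.

(* [R[i]^o] is the field R[i] of complex numbers with its norm topology. *)
Definition nonzero_vector (R : realType) : set 'rV[R[i]^o]_2 :=
  [set v | v != 0].
Arguments nonzero_vector R : clear implicits.

Section ProjectiveLine.
Variable R : realType.
Local Notation C := (R[i]^o).
Local Notation V := 'rV[C]_2.

Definition same_line (v w : nonzero_vector R) : bool :=
  `[< exists2 a : R[i], a != 0 & \val w = a *: \val v >].

Lemma same_line_equiv : equiv_class_of same_line.
Proof.
apply: EquivClass.
- by move=> v; apply/asboolP; exists 1; rewrite ?oner_neq0 ?scale1r.
- suff H v w : same_line v w -> same_line w v by move=> v w; apply/idP/idP; exact: H.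
  move=> /asboolP[a a0 E]; apply/asboolP; exists a^-1; rewrite ?invr_neq0 // E.
  by rewrite scalerA mulVf // scale1r.
- move=> w v u /asboolP[a a0 E] /asboolP[b b0 F].
  by apply/asboolP; exists (b * a); rewrite ?mulf_neq0 // F E scalerA.
Qed.

Canonical same_line_equivRel := EquivRelPack same_line_equiv.

Definition proj_line : Type :=
  quotient_topology {eq_quot same_line_equivRel}.
HB.instance Definition _ := Topological.on proj_line.
HB.instance Definition _ := Quotient.on proj_line.

Definition line_of (v : nonzero_vector R) : proj_line := \pi_proj_line v.
Definition line_repr (x : proj_line) : V := \val (repr x : nonzero_vector R).

Lemma nonzero_vectorP (v : nonzero_vector R) : \val v != 0 :> V.
Proof. exact: (set_mem (valP v)). Qed.

Lemma line_reprK x : line_of (repr x) = x.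
Proof. exact: reprK. Qed.

Lemma line_ofP v w :
  line_of v = line_of w <-> exists2 a : R[i], a != 0 & \val w = a *: \val v :> V.
Proof.
split=> [/eqmodP/asboolP //|E]; apply/eqmodP/asboolP; exact: E.
Qed.

Lemma line_repr_of v :
  exists2 a : R[i], a != 0 & line_repr (line_of v) = a *: \val v :> V.
Proof. by apply/line_ofP; rewrite line_reprK. Qed.

Definition affine_vector (i : 'I_2) (p : 'rV[R]_2) : V :=
  \row_j (if j == i then 1 else toC p).

Lemma affine_vector_neq0 i p : nonzero_vector R (affine_vector i p).
Proof.
apply/eqP => /rowP /(_ i); rewrite !mxE eqxx => /eqP.
by rewrite oner_eq0.
Qed.

Definition affine_point i p : nonzero_vector R :=
  exist _ (affine_vector i p) (mem_set (affine_vector_neq0 i p)).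

Definition ratio (i : 'I_2) (v : V) : R[i] := v ord0 (rev_ord i) / v ord0 i.

(* The chart [z_0 : z_1] |-> z_(1 - i) / z_i, with values in C = R^2. *)
Definition affine_chart (i : 'I_2) : chart R 2 proj_line := {|
  dom := [set x | line_repr x ord0 i != 0];
  cod := [set: 'rV[R]_2];
  fwd := fun x => ReIm (ratio i (line_repr x));
  bwd := fun p => line_of (affine_point i p) |}.

Lemma toCK : cancel (@toC R) (@ReIm R).
Proof. by move=> p; apply/rowP => j; have [->|->] := ord2P j; rewrite mxE. Qed.

Lemma ReImK : cancel (@ReIm R) (@toC R).
Proof. by case=> a b; rewrite /toC !mxE. Qed.

Lemma ratioZ i a v : a != 0 -> ratio i (a *: v) = ratio i v.
Proof. by move=> a0; rewrite /ratio !mxE invfM mulrACA divff // mul1r. Qed.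

Lemma dom_line_of i v : dom (affine_chart i) (line_of v) <-> \val v ord0 i != 0.
Proof.
have [a a0 E] := line_repr_of v.
by rewrite /= E mxE mulf_eq0 negb_or a0.
Qed.

Lemma fwd_line_of i v : fwd (affine_chart i) (line_of v) = ReIm (ratio i (\val v)).
Proof. by have [a a0 E] := line_repr_of v; rewrite /= E ratioZ. Qed.

Lemma rev_ord2_neq (i j : 'I_2) : j != i -> j = rev_ord i.
Proof.
by have [->|->] := ord2P i; have [->|->] := ord2P j => // _; apply/val_inj.
Qed.

Lemma affine_vector_ratio i (v : V) : v ord0 i != 0 ->
  affine_vector i (ReIm (ratio i v)) = (v ord0 i)^-1 *: v.
Proof.
move=> vi; apply/rowP => j; rewrite !mxE ReImK /ratio.
have [->|/rev_ord2_neq ->] := eqVneq j i; first by rewrite mulVf.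
by rewrite mulrC.
Qed.

Lemma ratio_affine_vector i p : ratio i (affine_vector i p) = toC p.
Proof.
rewrite /ratio !mxE eqxx divr1 ifN //.
by have [->|->] := ord2P i.
Qed.

Lemma affine_chartK i x : dom (affine_chart i) x ->
  bwd (affine_chart i) (fwd (affine_chart i) x) = x.
Proof.
move=> xi /=; rewrite -[RHS]line_reprK; apply/line_ofP => /=.
exists (line_repr x ord0 i) => //.
by rewrite affine_vector_ratio // scalerA mulfV // scale1r.
Qed.

Lemma affine_chartVK i p : dom (affine_chart i) (bwd (affine_chart i) p) /\
  fwd (affine_chart i) (bwd (affine_chart i) p) = p.
Proof.
split; first by apply/dom_line_of; rewrite /= mxE eqxx oner_neq0.
by rewrite fwd_line_of /= ratio_affine_vector toCK.
Qed.

Lemma val_continuous : continuous (fun v : nonzero_vector R => \val v : V).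
Proof. exact: (@initial_continuous _ _ (set_val : nonzero_vector R -> V)). Qed.

Lemma coordinate_continuous j :
  continuous (fun v : nonzero_vector R => \val v ord0 j : C).
Proof.
move=> v; apply: (@continuous_comp _ _ _ (fun v : nonzero_vector R => \val v : V)
  (fun v : V => v ord0 j : C)); first exact: val_continuous.
exact: continuous_entry.
Qed.

Lemma open_nonzero (T : topologicalType) (f : T -> C) :
  continuous f -> open [set x | f x != 0].
Proof.
move=> fc; have -> : [set x | f x != 0] = f @^-1` (~` [set 0]).
  by apply/seteqP; split=> x /= /eqP.
apply: open_comp; first by move=> x _; exact: fc.
by rewrite openC; exact: (accessible_closed_set1 (hausdorff_accessible (@norm_hausdorff R[i] C))).
Qed.

Lemma open_dom i : open (dom (affine_chart i)).
Proof.
change (open (@line_of @^-1` dom (affine_chart i))).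
have -> : line_of @^-1` dom (affine_chart i) =
    [set v : nonzero_vector R | \val v ord0 i != 0].
  by apply/seteqP; split=> v /dom_line_of.
exact/open_nonzero/coordinate_continuous.
Qed.

Lemma line_of_continuous : continuous line_of.
Proof. exact: pi_continuous. Qed.

Lemma fwd_continuous i x : dom (affine_chart i) x ->
  {for x, continuous (fwd (affine_chart i))}.
Proof.
move=> xi B; rewrite nbhsE => -[G [oG Gx] GB].
have -> : nbhs x = nbhs (x : proj_line) by [].
rewrite nbhsE; exists (dom (affine_chart i) `&` fwd (affine_chart i) @^-1` G); last first.
  by move=> y [_ /GB].
split=> //; change (open (@line_of @^-1` (dom (affine_chart i) `&` fwd (affine_chart i) @^-1` G))).
rewrite openE => v [/dom_line_of vi Gv].
have {}Gv : G (ReIm (ratio i (\val v))) by rewrite -fwd_line_of.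
have rc : {for v, continuous (fun w : nonzero_vector R => ReIm (ratio i (\val w)))}.
  apply: (@continuous_comp _ C _ (fun w : nonzero_vector R => ratio i (\val w) : C) (@ReIm R)).
    by apply: continuous_div => //; exact: coordinate_continuous.
  exact: continuous_ReIm.
have H1 : \forall w \near v, G (ReIm (ratio i (\val w))).
  by apply: rc; apply: open_nbhs_nbhs.
have H2 : \forall w \near v, dom (affine_chart i) (line_of w).
  have oD : nbhs (line_of v) (dom (affine_chart i)).
    by apply: open_nbhs_nbhs; split; [exact: open_dom | exact/dom_line_of].
  exact: (line_of_continuous oD).
near=> w; split; first by near: w.
suff : G (fwd (affine_chart i) (line_of w)) by [].
by rewrite fwd_line_of; near: w.
Unshelve. all: by end_near. Qed.

Lemma continuous_to_nonzero (T : topologicalType) (f : T -> nonzero_vector R) :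
  (forall x j, {for x, continuous (fun y => \val (f y) ord0 j : C)}) -> continuous f.
Proof.
move=> fc.
apply: (@continuous_comp_initial _ _ _ (set_val : nonzero_vector R -> V) f) => x.
exact: (@continuous_row R T (fun y => \val (f y)) x (fc x)).
Qed.

Lemma bwd_continuous i : continuous (bwd (affine_chart i)).
Proof.
move=> p; apply: (@continuous_comp _ _ _ (affine_point i) line_of); last first.
  exact: line_of_continuous.
apply: continuous_to_nonzero => q j /=.
have [->|ji] := eqVneq j i.
  rewrite (_ : (fun _ => _) = fun=> 1); first exact: cst_continuous.
  by apply/funext => y; rewrite mxE eqxx.
rewrite (_ : (fun _ => _) = @toC R); first exact: continuous_toC.
by apply/funext => y; rewrite mxE (negbTE ji).
Qed.

Lemma affine_chart_is_chart i : is_chart [set: 'rV[R]_2] (affine_chart i).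
Proof.
split.
- by split; [exact: open_dom | exists setT; [exact: openT | rewrite setIT]].
- by move=> x xi; split=> //; exact: affine_chartK.
- by move=> p _; exact: affine_chartVK.
- rewrite continuous_open_subspace; last exact: open_dom.
  by move=> x; rewrite inE => xi; exact: fwd_continuous.
- by apply: continuous_subspaceT; exact: bwd_continuous.
Qed.

End ProjectiveLine.

Section ProjectiveLineTopology.
Variable R : realType.
Local Notation C := (R[i]^o).
Local Notation V := 'rV[C]_2.
Local Notation P := (proj_line R).
Local Notation aff := (@affine_chart R).

Lemma affine_chart_cover (x : P) : exists i, dom (aff i) x.
Proof.
apply: contrapT => H; have /negP := nonzero_vectorP (repr x); apply.
apply/eqP/rowP => i; rewrite mxE.
by apply: contrapT => /eqP xi; apply: H; exists i.
Qed.

Lemma open_fwd i (G : set 'rV[R]_2) :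
  open G -> open (dom (aff i) `&` fwd (aff i) @^-1` G).
Proof.
move=> oG; rewrite openE => x [xi Gx].
have H1 : nbhs x (dom (aff i)) by apply: open_nbhs_nbhs; split=> //; exact: open_dom.
have H2 : nbhs x (fwd (aff i) @^-1` G).
  by apply: (fwd_continuous xi); exact: open_nbhs_nbhs.
exact: filterI H1 H2.
Qed.

Lemma ratio_rev i (v : V) : ratio (rev_ord i) v = (ratio i v)^-1.
Proof. by rewrite /ratio rev_ordK invf_div. Qed.

Lemma proj_line_hausdorff : hausdorff_space P.
Proof.
rewrite open_hausdorff => x y xy.
have [[i [xi yi]]|nij] := pselect (exists i, dom (aff i) x /\ dom (aff i) y).
  have fxy : fwd (aff i) x != fwd (aff i) y.
    by apply: contraNN xy => /eqP E; rewrite -(affine_chartK xi) E affine_chartK.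
  have hR : hausdorff_space 'rV[R]_2 by exact: norm_hausdorff.
  move: hR; rewrite open_hausdorff => /(_ _ _ fxy)[[A B] /= [+ +] [oA oB /eqP AB]].
  rewrite !inE => Ax By.
  exists (dom (aff i) `&` fwd (aff i) @^-1` A, dom (aff i) `&` fwd (aff i) @^-1` B).
    by rewrite !inE.
  split=> /=; [exact: open_fwd..|apply/eqP].
  rewrite -subset0 => z [[_ Az] [_ Bz]].
  suff : (A `&` B) (fwd (aff i) z) by rewrite AB.
  by [].
have [i xi] := affine_chart_cover x.
have yi : ~ dom (aff i) y by move=> yi; apply: nij; exists i.
have yr : dom (aff (rev_ord i)) y.
  have [j yj] := affine_chart_cover y.
  by have [ji|/rev_ord2_neq <- //] := eqVneq j i; rewrite ji in yj.
have xr : ~ dom (aff (rev_ord i)) x by move=> xr; apply: nij; exists (rev_ord i).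
pose G : set 'rV[R]_2 := @toC R @^-1` ball (0 : C) 1.
have oG : open G.
  apply: (@open_comp _ C) => [p _|]; first exact: (@continuous_toC R p).
  exact: (@ball_open R[i] C 0 1).
have GE (z : R[i]) : G (ReIm z) <-> `|z| < 1.
  by rewrite /G /preimage /= ReImK /ball /= sub0r normrN.
exists (dom (aff i) `&` fwd (aff i) @^-1` G,
        dom (aff (rev_ord i)) `&` fwd (aff (rev_ord i)) @^-1` G).
  rewrite !inE; split; split=> //; apply/GE; rewrite /ratio ?rev_ordK.
    by move: xr => /= /negP; rewrite negbK => /eqP ->; rewrite mul0r normr0 ltr01.
  by move: yi => /= /negP; rewrite negbK => /eqP ->; rewrite mul0r normr0 ltr01.
split; [exact: open_fwd..|apply/eqP].
rewrite -subset0 => z [[zi /GE Gz] [zr /GE]]; rewrite ratio_rev normrV ?unitfE; last first.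
  by rewrite mulf_neq0 ?invr_neq0.
rewrite invf_lt1 ?normr_gt0 ?mulf_neq0 ?invr_neq0 // => G2.
by have := lt_trans Gz G2; rewrite ltxx.
Qed.

Lemma proj_line_compact : compact [set: P].
Proof.
pose K : set 'rV[R]_2 := [set p | forall j, `[-1, 1]%classic (p ord0 j)].
have cK : compact K.
  exact: (@rV_compact R 2 (fun=> `[-1, 1]%classic)
    (fun=> @segment_compact R (-1) 1)).
have -> : [set: P] = bwd (aff ord0) @` K `|` bwd (aff ord_max) @` K.
  apply/seteqP; split=> // x _.
  suff [i [xi xK]] : exists i, dom (aff i) x /\ K (fwd (aff i) x).
    by have [i0|i0] := ord2P i; rewrite i0 in xi xK; [left|right];
      eexists; [exact: xK|exact: affine_chartK | exact: xK|exact: affine_chartK].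
  suff [i [xi xK]] : exists i, dom (aff i) x /\ `|ratio i (line_repr x)| <= 1.
    exists i; split=> // j; rewrite /= in_itv /= -ler_norml -lecR.
    have L1 := le_trans (normc_ge_Re _) xK; have L2 := le_trans (normc_ge_Im _) xK.
    by rewrite mxE; case: ifP.
  have [i xi] := affine_chart_cover x.
  have [r1|r1] := real_leP (normr_real (ratio i (line_repr x))) (real1 _).
    by exists i.
  have r0 : ratio i (line_repr x) != 0 by rewrite -normr_gt0 (lt_trans ltr01).
  exists (rev_ord i); split.
    by apply: contraNN r0 => /eqP E; rewrite /ratio E mul0r.
  by rewrite ratio_rev normrV ?unitfE // invf_le1 ?normr_gt0 // ltW.
apply: compactU; apply: continuous_compact => //;
  exact/continuous_subspaceT/bwd_continuous.
Qed.

End ProjectiveLineTopology.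

(* A complex representation of C_2 on C^n, given by the matrix by which the
   generator acts on row vectors. *)
Record C2_rep (R : realType) (n : nat) := C2Rep {
  rep_mx :> 'M[R[i]]_n;
  rep_mxK : rep_mx *m rep_mx = 1%:M }.

Program Definition trivial_rep (R : realType) : C2_rep R 1 := @C2Rep R 1 1%:M _.
Next Obligation. by move=> R; rewrite mulmx1. Qed.

Program Definition sign_rep (R : realType) : C2_rep R 1 := @C2Rep R 1 (- 1%:M) _.
Next Obligation. by move=> R; rewrite mulmxN mulmx1 opprK. Qed.

Program Definition dsum_rep (R : realType) (m n : nat) (V : C2_rep R m)
  (W : C2_rep R n) : C2_rep R (m + n) := @C2Rep R (m + n) (block_mx V 0 0 W) _.
Next Obligation.
move=> R m n V W; rewrite mulmx_block !mul0mx !mulmx0 !addr0 !add0r !rep_mxK.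
by rewrite -scalar_mx_block.
Qed.

Section ProjectiveAction.
Variable R : realType.
Local Notation C := (R[i]^o).
Local Notation V := 'rV[C]_2.
Local Notation P := (proj_line R).
Local Notation aff := (@affine_chart R).
Variable rho : C2_rep R 2.

Lemma rep_mul_neq0 (v : nonzero_vector R) :
  nonzero_vector R ((\val v : 'rV[R[i]]_2) *m rho).
Proof.
apply/negP => /eqP E; have /negP := nonzero_vectorP v; apply; apply/eqP.
by have := congr1 (mulmx^~ (rho : 'M[R[i]]_2)) E; rewrite /= -mulmxA rep_mxK mulmx1 mul0mx.
Qed.

Definition rep_mul (v : nonzero_vector R) : nonzero_vector R :=
  exist _ ((\val v : 'rV[R[i]]_2) *m rho : V) (mem_set (rep_mul_neq0 v)).

Definition proj_act (x : P) : P := line_of (rep_mul (repr x)).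

Lemma proj_act_line_of v : proj_act (line_of v) = line_of (rep_mul v).
Proof.
have [a a0 E] := line_repr_of v; apply/esym/line_ofP; exists a => //.
by rewrite /= -[\val (repr _)]/(line_repr _) E -scalemxAl.
Qed.

Lemma proj_actK : involutive proj_act.
Proof.
move=> x; rewrite /proj_act -[repr (line_of _)]/(repr (proj_act x)).
rewrite -/(proj_act (proj_act x)) {2}/proj_act proj_act_line_of -[RHS]line_reprK.
apply/line_ofP; exists 1; first exact: oner_neq0.
by rewrite /= scale1r -mulmxA rep_mxK mulmx1.
Qed.

Lemma proj_act_continuous : continuous proj_act.
Proof.
apply: (iffRL (quotient_continuous proj_act)) => v.
have -> : proj_act \o \pi_(proj_line R) = @line_of R \o rep_mul.
  by apply/funext => w; exact: proj_act_line_of.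
apply: (@continuous_comp _ _ _ rep_mul (@line_of R)); last exact: line_of_continuous.
apply: continuous_to_nonzero => w j /=.
rewrite (_ : (fun _ => _) = (fun y : nonzero_vector R =>
   \val y ord0 ord0 * rho ord0 j + \val y ord0 ord_max * rho ord_max j)).
  apply: (@cvgD R[i] C _ (nbhs w) (nbhs_filter w)).
    exact: (@cvgMr_tmp R[i] _ (nbhs w) (nbhs_filter w) _ _ _ (@coordinate_continuous R ord0 w)).
  exact: (@cvgMr_tmp R[i] _ (nbhs w) (nbhs_filter w) _ _ _ (@coordinate_continuous R ord_max w)).
apply/funext => y; rewrite mxE big_ord_recl big_ord1.
by rewrite (_ : lift ord0 ord0 = ord_max :> 'I_2) //; exact/val_inj.
Qed.

Section InCharts.
Variables i j : 'I_2.

Let w k (p : 'rV[R]_2) : R[i] := ((affine_vector i p : 'rV[R[i]]_2) *m rho) ord0 k.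
Let U : set 'rV[R]_2 := [set p | w j p != 0].

Lemma act_coordE k p : w k p = rho i k + toC p * rho (rev_ord i) k.
Proof.
rewrite /w mxE (bigD1 i) //= (bigD1 (rev_ord i)) /=; last by have [->|->] := ord2P i.
rewrite big1 ?addr0 => [|l /andP[li /negP lr]]; last first.
  by case: lr; apply/eqP/rev_ord2_neq.
by rewrite !mxE eqxx mul1r ifN //; have [->|->] := ord2P i.
Qed.

Lemma act_coord_holomorphic (A : set 'rV[R]_2) k : open A -> holomorphic A (w k).
Proof.
move=> oA; rewrite (funext (act_coordE k)).
apply: holomorphicD => //; first exact: holomorphic_cst.
by apply: holomorphicM => //; [exact: holomorphic_toC | exact: holomorphic_cst].
Qed.

Lemma open_act_coord : open U.
Proof.
have [HR HI _] := act_coord_holomorphic j (@openT 'rV[R]_2).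
have cR : continuous (fun p => complex.Re (w j p)) by move=> p; exact: (HR 0%N).
have cI : continuous (fun p => complex.Im (w j p)) by move=> p; exact: (HI 0%N).
have -> : U = (fun p => complex.Re (w j p)) @^-1` (~` [set 0]) `|`
              (fun p => complex.Im (w j p)) @^-1` (~` [set 0]).
  apply/seteqP; split=> p; rewrite /U /=.
    case: (w j p) => a b /= ab; apply: contrapT => /not_orP[/contrapT a0 /contrapT b0].
    by move/eqP: ab; apply; rewrite a0 b0.
  by case: (w j p) => a b /= [] H; apply/eqP => -[] //.
have oC : open (~` [set (0 : R)]) by rewrite openC; exact: closed_eq.
by apply: openU; apply: open_comp.
Qed.

Definition act_ratio p : R[i] := w (rev_ord j) p / w j p.

Lemma act_ratio_holomorphic : holomorphic U act_ratio.
Proof.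
have oU := open_act_coord.
apply: holomorphicM => //; first exact: act_coord_holomorphic.
by apply: holomorphicV => //; exact: act_coord_holomorphic.
Qed.

Lemma act_ratioE p : (fwd (aff j) \o proj_act \o bwd (aff i)) p = ReIm (act_ratio p).
Proof. by rewrite /comp [bwd _ _]/= proj_act_line_of fwd_line_of. Qed.

Lemma act_coord_dom x : dom (aff i) x -> dom (aff j) (proj_act x) ->
  U (fwd (aff i) x).
Proof.
move=> xi; rewrite -{1}(affine_chartK xi) [bwd _ _]/= proj_act_line_of.
by move=> /dom_line_of.
Qed.

Lemma proj_act_smooth_at x : dom (aff i) x -> dom (aff j) (proj_act x) ->
  smooth_at [set: 'rV[R]_2] (fwd (aff j) \o proj_act \o bwd (aff i)) (fwd (aff i) x).
Proof.
move=> xi xj; apply: (holomorphic_smooth_at open_act_coord act_ratio_holomorphic).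
  exact: act_coord_dom.
by move=> y _; exact: act_ratioE.
Qed.

Lemma proj_act_jacobian x D : dom (aff i) x -> dom (aff j) (proj_act x) ->
  has_jacobian [set: 'rV[R]_2] (fwd (aff j) \o proj_act \o bwd (aff i)) (fwd (aff i) x) D ->
  std_J R 2 *m D = D *m std_J R 2.
Proof.
move=> xi xj; apply: (holomorphic_jacobian open_act_coord act_ratio_holomorphic).
  exact: act_coord_dom.
by move=> y _; exact: act_ratioE.
Qed.

End InCharts.
End ProjectiveAction.

Section ProjectiveManifold.
Variable R : realType.
Local Notation P := (proj_line R).
Local Notation aff := (@affine_chart R).

Definition affine_atlas : set (chart R 2 P) := range aff.

Lemma affine_atlas_cover x : exists2 c, affine_atlas c & dom c x.
Proof. by have [i xi] := affine_chart_cover x; exists (aff i) => //; exists i. Qed.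

Lemma affine_atlas_chart c : affine_atlas c -> is_chart [set: 'rV[R]_2] c.
Proof. by case=> i _ <-; exact: affine_chart_is_chart. Qed.

Definition trivial_rep2 : C2_rep R 2 := dsum_rep (trivial_rep R) (trivial_rep R).

Lemma proj_act1 : proj_act trivial_rep2 = id.
Proof.
apply/funext => x; rewrite -[RHS]line_reprK; apply/line_ofP; exists 1.
  exact: oner_neq0.
by rewrite /= -scalar_mx_block scale1r mulmx1.
Qed.

Lemma affine_atlas_smooth c d x : affine_atlas c -> affine_atlas d ->
  dom c x -> dom d x ->
  smooth_at [set: 'rV[R]_2] (fwd d \o bwd c) (fwd c x).
Proof.
move=> [i _ <-] [j _ <-] xi xj.
have := @proj_act_smooth_at R trivial_rep2 i j x xi; rewrite proj_act1; exact.
Qed.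

Definition proj_line_manifold : manifold [set: 'rV[R]_2] :=
  Manifold (@proj_line_hausdorff R) (@proj_line_compact R)
    affine_atlas_chart affine_atlas_cover affine_atlas_smooth.

Variable rho : C2_rep R 2.

Lemma proj_act_smooth : @smooth_map R 2 2 _ _ proj_line_manifold proj_line_manifold
  (proj_act rho).
Proof.
split; first exact: proj_act_continuous.
by move=> _ _ x [i _ <-] [j _ <-]; exact: proj_act_smooth_at.
Qed.

Definition proj_line_C2 : C2_manifold [set: 'rV[R]_2] :=
  C2Manifold proj_act_smooth (proj_actK rho).

(* In the affine charts, which are holomorphic, the complex structure of the
   tangent bundle is multiplication by i on C = R^2. *)
Definition proj_line_J (c : chart R 2 proj_line_C2) (x : proj_line_C2) : 'M[R]_2 :=
  std_J R 2.

Lemma std_J2_sqr : std_J R 2 *m std_J R 2 = - 1%:M.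
Proof.
apply/matrixP => i k; rewrite mxE big_ord_recl big_ord1 !mxE.
by have [->|->] := ord2P i; have [->|->] := ord2P k; rewrite /= ?eqxx /=; ring.
Qed.

Lemma proj_line_J_complex : complex_structure id proj_line_J.
Proof.
split=> [c x _ _|c x _ _|].
- exact: std_J2_sqr.
- exists (fun=> std_J R 2), setT; split=> //; first exact: openT.
  by move=> i j k; exact: (Ck_cst (@openT _)).
- move=> _ _ x D [[i _ <-] [j _ <-] xi xj].
  have := @proj_act_jacobian R trivial_rep2 i j x D xi; rewrite proj_act1; exact.
Qed.

Lemma proj_line_J_equivariant : compatible id proj_line_J (@act _ _ _ proj_line_C2).
Proof.
move=> _ _ x D [[i _ <-] [j _ <-] xi xj]; exact: proj_act_jacobian.
Qed.

Definition projective_line : complex_C2_manifold R 2 :=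
  ComplexC2Manifold proj_line_J_complex proj_line_J_equivariant.

End ProjectiveManifold.

(* Main.v *)
Require Import Defs.
From mathcomp Require Import all_boot all_order all_algebra.
From mathcomp Require Import complex.
From mathcomp Require Import all_classical all_reals all_analysis.
From mathcomp Require Import ring lra.

Set Implicit Arguments.
Unset Strict Implicit.
Unset Printing Implicit Defensive.

Import Order.TTheory GRing.Theory Num.Theory.
Import numFieldNormedType.Exports.

Local Open Scope classical_set_scope.
Local Open Scope ring_scope.

(** Let [W] be a cobordism, with involution [tau], from a manifold [M] with trivial
   action to a manifold [N] with an isolated fixed point [p].  The stable complex
   structure [J] on [T W + R^k] commutes with the involution.  Consider the fixed
   points of [tau] at which the fixed space of the differential is a line, the axis.
   They form a compact curve, and [J] orients it: the sum of the axis and of [R^k] is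
   a complex space, hence oriented, and [R^k] has its standard orientation.  The
   curve meets no point of [M], where the fixed space contains the tangent space of
   [M], and at a boundary point of [W] in [N] the inward normal spans the axis and is
   positive, since [J] restricts there to the standard structure on the normal and
   [R^k].  So the curve is a compact oriented one-manifold with a boundary point,
   [p], and from all its boundary points the orientation points inwards.  But such a
   curve has as many sources as sinks.  For the projective line of the sum of the
   trivial and the sign representation, [p] is the line [1 : 0].

   The count of sources and sinks is made on a finite set of points of the curve that
   contains [p] and the ends of finitely many arcs that cover the curve: passing to
   the next point along the orientation is an injection of this set into itself that
   misses [p] ([no_source]).  The orientation is well defined because a real matrix
   that commutes with a complex structure has nonnegative determinant
   ([det_commutant_ge0]), and it varies continuously because nearby complex structures
   [K] and [K'] are intertwined by [1 - K K'] ([oriented_near]).  That the fixed points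
   form a curve near a point [x] ([fixed_curve_exists]) follows from a contraction
   argument inside the half-space, in the affine lines parallel to the [-1]
   eigenspace of the differential: at a boundary point this eigenspace is tangent to
   the boundary ([reversed_tangent]), so these lines do not leave the half-space.
   Differentials are handled through strict derivatives, which bound the differences
   between any two nearby points. *)

(** * Matrices commuting with a complex structure *)

Section Commutant.
Variable R : realType.

(** Over the complex numbers the space splits into the eigenspaces of [K] for
   [i] and [- i], which [H] preserves and conjugation exchanges; so the
   determinant of [H] is that of a block [Y] times that of its conjugate. *)
Lemma det_commutant_ge0 (n : nat) (K H : 'M[R]_n) :
  K *m K = - 1%:M -> H *m K = K *m H -> 0 <= \det H.
Proof.
move=> KK HK.
pose toC := real_complex R.
pose cj := @conjc R.
have cT m p (M : 'M[R]_(m, p)) : map_mx cj (map_mx toC M) = map_mx toC M.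
  by apply/matrixP => i j; rewrite !mxE /toC /cj /= oppr0.
have [r [A [Y [nE fullA HA]]]] : exists r (A : 'M[R[i]]_(r, n)) (Y : 'M[R[i]]_r),
  [/\ n = (r + r)%N, row_full (col_mx A (map_mx cj A)) &
      A *m map_mx toC H = Y *m A].
  pose j : R[i] := 'i%C.
  have jj : j * j = -1 by rewrite -expr2 sqr_i.
  pose Kc := map_mx toC K; pose E := Kc + j%:M; pose E' := Kc - j%:M.
  have E'E : E' = map_mx cj E.
    rewrite /E map_mxD map_scalar_mx cT /E'; congr (_ + _).
    by rewrite -raddfN /=; congr (_%:M); rewrite /j /cj /=; simpc.
  have KcKc : Kc *m Kc = - 1%:M by rewrite -map_mxM KK map_mxN map_mx1.
  have EE' : E *m E' = 0.
    rewrite mulmxBr !mulmxDl KcKc -scalar_mxM jj mul_mx_scalar mul_scalar_mx.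
    by rewrite raddfN /= [X in X - _]addrC subrr.
  have HE : E *m map_mx toC H = map_mx toC H *m E.
    rewrite mulmxDl mulmxDr -!map_mxM HK.
    by rewrite mul_mx_scalar mul_scalar_mx.
  have rE : \rank E' = \rank E by rewrite E'E mxrank_map.
  have E'E2 : (1%:M : 'M[R[i]]_n) = (2 * j)^-1 *: E - (2 * j)^-1 *: E'.
    rewrite -scalerBr /E /E' opprB addrC addrA subrK -raddfD /=.
    rewrite (_ : j + j = 2 * j) ?mulr_natl // scale_scalar_mx mulVf // -mulr_natl.
    rewrite mulf_neq0 ?pnatr_eq0 //; apply/eqP => j0; move/eqP: jj.
    by rewrite j0 mul0r eq_sym oppr_eq0 oner_eq0.
  have sub1 (m : nat) (B : 'M[R[i]]_(m, n)) : (E <= B)%MS -> (E' <= B)%MS -> row_full B.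
    move=> EB E'B; rewrite -sub1mx E'E2 -scaleNr.
    by apply: addmx_sub; exact: scalemx_sub.
  exists (\rank E), (row_base E).
  have /submxP[X XE] : (row_base E <= E)%MS by rewrite eq_row_base.
  have EA : (E <= row_base E)%MS by rewrite eq_row_base.
  have /submxP[Y YE] : (row_base E *m map_mx toC H <= row_base E)%MS.
    by rewrite XE -mulmxA HE mulmxA -XE eq_row_base submxMl.
  exists Y; split=> //.
    have := mulmx0_rank_max EE'; rewrite rE => le1.
    have /eqP full := @sub1 _ (E + E')%MS (addsmxSl _ _) (addsmxSr _ _).
    have := mxrank_adds_leqif E E'; rewrite full rE => -[le2 _].
    by apply/eqP; rewrite eqn_leq le2.
  apply: sub1; rewrite -addsmxE; first by rewrite (submx_trans EA) // addsmxSl.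
  by rewrite E'E (submx_trans _ (addsmxSr _ _)) // map_submx.
subst n.
pose M : 'M[R[i]]_(r + r) := col_mx A (map_mx cj A).
have MH : M *m map_mx toC H = block_mx Y 0 0 (map_mx cj Y) *m M.
  rewrite mul_col_mx HA mul_block_col !mul0mx addr0 add0r; congr col_mx.
  by rewrite -[X in _ *m X]cT -!map_mxM HA.
have M0 : \det M != 0.
  by rewrite -unitfE -[_ \is a _]/(M \in unitmx) -row_full_unit.
have /(congr1 determinant) := MH; rewrite !det_mulmx mulrC => /(mulIf M0).
rewrite det_ublock !det_map_mx => E.
have {}E : (\det H)%:C%C = \det Y * (\det Y)^*%C := E.
by rewrite -lecR E; exact: (mul_conjC_ge0 (\det Y)).
Qed.

End Commutant.

(** * Half-turns and orientations of their axes *)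

Lemma mxtrace_idempotent (F : fieldType) (n : nat) (A : 'M[F]_n) :
  A *m A = A -> \tr A = (\rank A)%:R.
Proof.
move=> AA; have cr : row_base A *m col_base A = 1%:M.
  apply: (row_free_inj (row_base_free A)); rewrite mul1mx -mulmxA mulmx_base.
  by apply: (row_full_inj (col_base_full A)); rewrite mulmxA mulmx_base AA.
by rewrite -{1}(mulmx_base A) mxtrace_mulC cr mxtrace1.
Qed.

Section HalfTurn.
Variables (R : realType) (m : nat).
Implicit Types (D : 'M[R]_m) (e : 'rV[R]_m) (l : 'cV[R]_m).

Lemma mxtrace_involution D : D *m D = 1%:M ->
  \tr D = 2 * (\rank (1%:M + D)%R)%:R - m%:R.
Proof.
move=> DD; pose A := 2^-1 *: (1%:M + D).
have AA : A *m A = A.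
  have E : (1%:M + D) *m (1%:M + D) = 2 *: (1%:M + D).
    by rewrite mulmxDl mul1mx mulmxDr mulmx1 DD [D + _]addrC -mulr2n scaler_nat.
  by rewrite -scalemxAl -scalemxAr E !scalerA -mulrA mulVf // mulr1.
have : \tr A = (\rank (1%:M + D)%R)%:R.
  have h0 : 2^-1 != 0 :> R by rewrite invr_eq0 pnatr_eq0.
  by rewrite mxtrace_idempotent // /A (eqmx_scale _ h0).
by rewrite mxtraceZ mxtraceD mxtrace1 => <-; field.
Qed.

Lemma mxrank_involution D : D *m D = 1%:M ->
  (\rank (1%:M + D)%R + \rank (1%:M - D)%R)%N = m.
Proof.
move=> DD; have DD' : - D *m - D = 1%:M by rewrite mulNmx mulmxN opprK.
have := mxtrace_involution DD; have := mxtrace_involution DD'.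
rewrite raddfN /= => E1 E2; apply/eqP.
by rewrite -(eqr_nat R) natrD; apply/eqP; move: E1 E2; lra.
Qed.

(** In dimension three these are the half-turns about an axis, whence the name. *)
Definition half_turn D := D *m D = 1%:M /\ \rank (1%:M + D)%R = 1%N.

Lemma half_turnP D : D *m D = 1%:M -> half_turn D <-> \tr D = 2 - m%:R.
Proof.
move=> DD; rewrite /half_turn mxtrace_involution //; split=> [[_ ->]|E].
  by rewrite mulr1.
by split=> //; apply/eqP; rewrite -(eqr_nat R); apply/eqP; move: E; lra.
Qed.

(** The projection along [e] onto the kernel of the linear form [l], when
   [l e = 1]. *)
Definition off_axis e l : 'M[R]_m := 1%:M - l *m e.

Lemma half_turn_off_axis D e l : half_turn D -> e *m D = e -> e *m l = 1%:M ->
  (1%:M + D) *m off_axis e l = 0.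
Proof.
move=> [DD r1] eD el; have e0 : e != 0.
  by apply/eqP => e0; move: el; rewrite e0 mul0mx => /matrixP/(_ 0 0)/eqP;
    rewrite !mxE eqxx eq_sym oner_eq0.
have eS : (e <= (1%:M + D)%R)%MS.
  apply/submxP; exists (2^-1 *: e); rewrite -scalemxAl mulmxDr mulmx1 eD.
  by rewrite -mulr2n -[e *+ 2]scaler_nat scalerA mulVf ?scale1r.
have : ((1%:M + D)%R <= e)%MS by rewrite -(geq_leqif (mxrank_leqif_sup eS)) r1 rank_rV e0.
move=> /submxP[X ->]; rewrite /off_axis mulmxBr mulmx1 mulmxA -(mulmxA X) el mulmx1.
by rewrite subrr.
Qed.

Lemma half_turn_fixed D e l v : half_turn D -> e *m D = e -> e *m l = 1%:M ->
  v *m D = v -> v = (v *m l) 0 0 *: e.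
Proof.
move=> hD eD el vD; have : v *m (1%:M + D) *m off_axis e l = 0.
  by rewrite -mulmxA half_turn_off_axis // mulmx0.
rewrite mulmxDr mulmx1 vD mulmxDl => /eqP.
rewrite -mulr2n -scaler_nat scaler_eq0 pnatr_eq0 /= mulmxBr mulmx1 subr_eq0.
by rewrite mulmxA => /eqP {1}->; rewrite [v *m l]mx11_scalar mul_scalar_mx !mxE eqxx mulr1n.
Qed.

Lemma half_turn_conj D D' (A A' : 'M[R]_m) : A *m A' = 1%:M ->
  A *m D' = D *m A -> half_turn D -> half_turn D'.
Proof.
move=> AA' AD [DD r1]; have A'A := mulmx1C AA'.
have D'E : D' = A' *m D *m A by rewrite -mulmxA -AD mulmxA A'A mul1mx.
have D'D' : D' *m D' = 1%:M.
  by rewrite {1}D'E -!mulmxA AD (mulmxA D) DD mul1mx.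
apply/half_turnP => //; rewrite D'E mxtrace_mulC mulmxA AA' mul1mx.
by apply/half_turnP.
Qed.
End HalfTurn.

Section Frame.
Variables (R : realType) (m k : nat).
Implicit Types (D A : 'M[R]_m) (e : 'rV[R]_m) (l : 'cV[R]_m).
Implicit Types (J : 'M[R]_(m + k)) (K : 'M[R]_(1 + k)).

Definition frame e : 'M[R]_(1 + k, m + k) := block_mx e 0 0 1%:M.
Definition coframe l : 'M[R]_(m + k, 1 + k) := block_mx l 0 0 1%:M.

Lemma frameK e l : e *m l = 1%:M -> frame e *m coframe l = 1%:M.
Proof.
move=> el; rewrite mulmx_block !mul0mx !mulmx0 !mulmx1 !addr0 !add0r el.
by rewrite -scalar_mx_block.
Qed.

Lemma frame_stab e A : frame e *m stab k A = frame (e *m A).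
Proof. by rewrite mulmx_block !mul0mx !mulmx0 !mulmx1 !addr0 !add0r. Qed.

Definition stretch (a : R) : 'M[R]_(1 + k) := block_mx a%:M 0 0 1%:M.

Lemma stretch_frame a e : stretch a *m frame e = frame (a *: e).
Proof.
by rewrite mulmx_block !mul0mx !mulmx0 !mulmx1 !addr0 !add0r mul_scalar_mx.
Qed.

Lemma det_stretch a : \det (stretch a) = a.
Proof. by rewrite det_ublock det1 mulr1 det_scalar1. Qed.

Lemma stretchK a : a != 0 -> stretch a^-1 *m stretch a = 1%:M.
Proof.
move=> a0; rewrite mulmx_block !mul0mx !mulmx0 !mulmx1 !addr0 !add0r.
by rewrite -scalar_mxM mulVf // -scalar_mx_block.
Qed.

(** [K] is the matrix of [J] on the sum of the axis and [R^k], which are the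
   vectors that the stabilised half-turn fixes. *)
Definition axis_mx J e l : 'M[R]_(1 + k) := frame e *m J *m coframe l.

Lemma frame_axis_mx D J e l : half_turn D -> e *m D = e -> e *m l = 1%:M ->
  J *m stab k D = stab k D *m J -> frame e *m J = axis_mx J e l *m frame e.
Proof.
move=> hD eD el JD; set X := frame e *m J.
have XD : X *m stab k D = X by rewrite -mulmxA JD mulmxA frame_stab eD.
have off : coframe l *m frame e = 1%:M - block_mx (off_axis e l) 0 0 0.
  rewrite mulmx_block !mul0mx !mulmx0 !mulmx1 !addr0 !add0r /off_axis.
  by rewrite scalar_mx_block opp_block_mx add_block_mx !oppr0 !addr0 opprB addrC subrK.
pose N : 'M[R]_(m + k) := block_mx (off_axis e l) 0 0 0.
have X0 : X *m N = 0.
  have SN : (1%:M + stab k D) *m N = 0.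
    rewrite [_ + _](_ : _ = block_mx (1%:M + D) 0 0 2%:M); last first.
      by rewrite scalar_mx_block add_block_mx !addr0 -raddfD.
    rewrite mulmx_block !mul0mx !mulmx0 !addr0 half_turn_off_axis //.
    by rewrite block_mx0.
  have : X *m (1%:M + stab k D) *m N = 0 by rewrite -[LHS]mulmxA SN mulmx0.
  rewrite mulmxDr mulmx1 XD -mulr2n -[X *+ 2]scaler_nat -scalemxAl => /eqP.
  by rewrite scaler_eq0 pnatr_eq0 /= => /eqP.
by rewrite /axis_mx -mulmxA off mulmxBr mulmx1 X0 subr0.
Qed.

Lemma axis_mx_sqr J K e l : e *m l = 1%:M -> J *m J = - 1%:M ->
  frame e *m J = K *m frame e -> K *m K = - 1%:M.
Proof.
move=> el JJ FJ; have : K *m K *m frame e = - frame e.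
  by rewrite -mulmxA -FJ mulmxA -FJ -mulmxA JJ mulmxN mulmx1.
by move=> /(congr1 (mulmx^~ (coframe l))); rewrite /= mulNmx -mulmxA frameK ?mulmx1.
Qed.

(** The complex structures [K] and [std_J] induce the same orientation of
   [R^(1 + k)].  This is said by means of a conjugation of positive determinant, so
   that no complex basis needs to be chosen. *)
Definition oriented K := exists2 G : 'M[R]_(1 + k), 0 < \det G &
  G *m K = std_J R (1 + k) *m G.

(** The matrix [1 - K K'] intertwines [K] and [K']. *)
Lemma oriented_near K K' : K *m K = - 1%:M -> K' *m K' = - 1%:M ->
  0 < \det (1%:M - K *m K') -> oriented K -> oriented K'.
Proof.
move=> KK K'K' d [G dG GK]; exists (G *m (1%:M - K *m K')).
  by rewrite det_mulmx mulr_gt0.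
rewrite [RHS]mulmxA -GK -!mulmxA; congr (_ *m _).
rewrite mulmxBl mulmxBr mul1mx mulmx1 -mulmxA K'K' [K *m (K *m _)]mulmxA KK.
by rewrite mulmxN mulmx1 mulNmx mul1mx !opprK addrC.
Qed.

(** The vector [e] together with the basis of [R^k] is a positive basis for the
   orientation that [J] induces. *)
Definition positive J e := exists2 K, frame e *m J = K *m frame e & oriented K.

Lemma positiveZ J e (a : R) : 0 < a -> positive J e -> positive J (a *: e).
Proof.
move=> a0 [K FJ [G dG GK]]; have an : a != 0 by rewrite gt_eqF.
have SS := stretchK an; have SS' := mulmx1C SS.
exists (stretch a *m K *m stretch a^-1).
  by rewrite -!stretch_frame -[LHS]mulmxA FJ -!mulmxA (mulmxA (stretch a^-1)) SS mul1mx.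
exists (G *m stretch a^-1); first by rewrite det_mulmx det_stretch mulr_gt0 ?invr_gt0.
by rewrite !mulmxA -(mulmxA G) SS mulmx1 GK.
Qed.

(** If [e] and [a e] are both positive, the quotient of the two conjugations to
   [std_J], corrected by the dilation of factor [a], commutes with [K]: its
   determinant, of the sign of [a], is nonnegative. *)
Lemma positive_sign J e l (a : R) : J *m J = - 1%:M -> e *m l = 1%:M ->
  a != 0 -> positive J e -> positive J (a *: e) -> 0 < a.
Proof.
move=> JJ el a0 [K FJ [G dG GK]] [K' FJ' [G' dG' GK']].
have KK := axis_mx_sqr el JJ FJ.
have GU : G \in unitmx by rewrite unitmxE unitfE gt_eqF.
have K'S : K' *m stretch a = stretch a *m K.
  have : K' *m stretch a *m frame e = stretch a *m K *m frame e.
    by rewrite -!mulmxA stretch_frame -FJ' -FJ mulmxA stretch_frame.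
  by move=> /(congr1 (mulmx^~ (coframe l))); rewrite /= -!mulmxA frameK ?mulmx1.
pose H := invmx G *m G' *m stretch a.
have HK : H *m K = K *m H.
  apply: (can_inj (mulKmx GU)); rewrite /H !mulmxA mulmxV // mul1mx GK.
  by rewrite -[_ *m G *m invmx G]mulmxA mulmxV // mulmx1 -GK' -!mulmxA K'S.
have := det_commutant_ge0 KK HK; rewrite !det_mulmx det_inv det_stretch => H0.
rewrite lt_neqAle eq_sym a0 /=; move: H0.
by rewrite pmulr_rge0 // mulr_gt0 ?invr_gt0.
Qed.

Lemma positive_chart J J' A e : J *m stab k A = stab k A *m J' ->
  positive J e -> positive J' (e *m A).
Proof.
move=> JA [K FJ oK]; exists K => //.
by rewrite -frame_stab -mulmxA -JA mulmxA FJ -mulmxA.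
Qed.

Lemma positive_near D D' J J' e e' l :
  half_turn D -> e *m D = e -> e *m l = 1%:M ->
  half_turn D' -> e' *m D' = e' -> e' *m l = 1%:M ->
  J *m J = - 1%:M -> J' *m J' = - 1%:M ->
  J *m stab k D = stab k D *m J -> J' *m stab k D' = stab k D' *m J' ->
  0 < \det (1%:M - axis_mx J e l *m axis_mx J' e' l) ->
  positive J e -> positive J' e'.
Proof.
move=> hD eD el hD' eD' el' JJ J'J' JD J'D' d [K FJ oK].
have F := frame_axis_mx hD eD el JD; have F' := frame_axis_mx hD' eD' el' J'D'.
exists (axis_mx J' e' l) => //; apply: oriented_near d _.
- exact: axis_mx_sqr el JJ F.
- exact: axis_mx_sqr el' J'J' F'.
- suff -> : axis_mx J e l = K by [].
  by rewrite /axis_mx FJ -mulmxA frameK // mulmx1.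
Qed.

End Frame.

(** * Strict derivatives *)

Section RowNorm.
Variable R : realType.

Lemma norm_rowP (m : nat) (v : 'rV[R]_m) (a : R) :
  0 <= a -> (forall j, `|v 0 j| <= a) -> `|v| <= a.
Proof.
move=> a0 va; rewrite -[leLHS]/(mx_norm v) mx_normrE.
by apply/bigmax_leP; split=> // -[i j] _ /=; rewrite ord1.
Qed.

Lemma norm_row_entry (m : nat) (v : 'rV[R]_m) j : `|v 0 j| <= `|v|.
Proof. by rewrite -[leRHS]/(mx_norm v) mx_normrE; apply/bigmax_geP; right; exists (0, j). Qed.

(** The sum of the absolute values of the entries bounds the operator norm; the
   term [1] makes the bound positive, so that one can divide by it. *)
Definition op_bound (n m : nat) (D : 'M[R]_(n, m)) : R := 1 + \sum_i \sum_j `|D i j|.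

Lemma op_bound_gt0 (n m : nat) (D : 'M[R]_(n, m)) : 0 < op_bound D.
Proof. by rewrite ltr_pwDl // !sumr_ge0 // => i _; rewrite sumr_ge0. Qed.

Lemma norm_mulmx (n m : nat) (v : 'rV[R]_n) (D : 'M[R]_(n, m)) :
  `|v *m D| <= op_bound D * `|v|.
Proof.
apply: norm_rowP => [|j]; first by rewrite mulr_ge0 // ltW // op_bound_gt0.
rewrite mxE (le_trans (ler_norm_sum _ _ _)) //.
apply: (@le_trans _ _ ((\sum_i `|D i j|) * `|v|)).
  rewrite mulr_suml ler_sum // => i _.
  by rewrite normrM mulrC ler_wpM2l // norm_row_entry.
rewrite ler_wpM2r // ler_wpDl // ler_sum // => i _.
by rewrite (bigD1 j) //= lerDl sumr_ge0.
Qed.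

End RowNorm.

Section StrictDerivative.
Variable R : realType.

(** The condition bears on all pairs of points of [A] near [x].  It thus also
   controls the fixed points of a map near [x] relatively to one another, and at a
   boundary point of a half-space it mentions no extension of [f]. *)
Definition strict_deriv (n m : nat) (A : set 'rV[R]_n) (f : 'rV[R]_n -> 'rV[R]_m)
    (x : 'rV[R]_n) (D : 'M[R]_(n, m)) : Prop :=
  forall e : R, 0 < e -> exists2 d : R, 0 < d & forall y z, A y -> A z ->
    `|y - x| < d -> `|z - x| < d -> `|f y - f z - (y - z) *m D| <= e * `|y - z|.

(** The mean value theorem on the segment from [z] to [y]. *)
Lemma C1_mean_value (n : nat) (U : set 'rV[R]_n) (f : 'rV[R]_n -> R) (y z : 'rV[R]_n) :
  (forall t : R, 0 <= t <= 1 -> U (z + t *: (y - z))) ->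
  (forall x, U x -> differentiable f x) ->
  exists2 t : R, 0 <= t <= 1 & f y - f z = 'D_(y - z) f (z + t *: (y - z)).
Proof.
move=> seg df.
pose g (t : R) := f (z + t *: (y - z)).
have gE t : (fun s : R => s^-1 *: ((g \o shift t) (s *: 1) - g t)) =
    (fun s : R => s^-1 *: ((f \o shift (z + t *: (y - z))) (s *: (y - z)) -
                           f (z + t *: (y - z)))).
  apply/funext => s; rewrite /g /= [s *: 1]mulr1 scalerDl.
  by rewrite addrCA [z + _]addrC addrA.
have dg (t : R) : 0 <= t <= 1 -> is_derive t (1 : R) g ('D_(y - z) f (z + t *: (y - z))).
  move=> t01; apply: DeriveDef; last by rewrite /derive gE.
  rewrite /derivable gE; apply: diff_derivable.
  exact/df/seg.
have cg : {within `[0, 1], continuous g}.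
  apply: derivable_within_continuous => t; rewrite in_itv /= => t01.
  by have [] := dg t t01.
have [|t t01 E] :=
  @MVT_segment R g (fun t => 'D_(y - z) f (z + t *: (y - z))) 0 1 ler01 _ cg.
  by move=> t; rewrite in_itv /= => /andP[/ltW t0 /ltW t1]; apply: dg; rewrite t0.
exists t; first by move: t01; rewrite in_itv.
by move: E; rewrite /g scale1r scale0r addr0 subr0 mulr1 [z + _]addrC subrK.
Qed.

Lemma derive_row_sum (n : nat) (f : 'rV[R]_n -> R) (x h : 'rV[R]_n) :
  differentiable f x -> 'D_h f x = \sum_i h 0 i * 'D_(delta_mx 0 i) f x.
Proof.
move=> df; rewrite deriveE // {1}[h]row_sum_delta linear_sum.
by apply: eq_bigr => i _; rewrite linearZ /= deriveE.
Qed.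

Lemma jacobianE (n m : nat) (g : 'rV[R]_n -> 'rV[R]_m) (x : 'rV[R]_n) i j :
  differentiable g x -> jacobian g x i j = 'D_(delta_mx 0 i) (fun y => g y 0 j) x.
Proof.
move=> dg; have /matrixP/(_ 0 j) := derive_mx (@diff_derivable _ _ _ g x (delta_mx 0 i) dg).
by rewrite deriveEjacobian // -rowE !mxE.
Qed.

Lemma smooth_on_differentiable (n m : nat) (U : set 'rV[R]_n)
    (g : 'rV[R]_n -> 'rV[R]_m) x : smooth_on U g -> U x -> differentiable g x.
Proof.
by move=> sg Ux; apply: differentiable_row => j; have [+ _] := sg 0 j 1%N; apply.
Qed.

Lemma near_eq_continuous (T U : topologicalType) (f g : T -> U) (x : T) :
  (\forall y \near x, f y = g y) -> {for x, continuous f} -> {for x, continuous g}.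
Proof.
move=> fg cf; have fgx := nbhs_singleton fg.
by apply: cvg_trans (near_eq_cvg fg) _; rewrite -fgx.
Qed.

Lemma smooth_on_jacobian_continuous (n m : nat) (U : set 'rV[R]_n)
    (g : 'rV[R]_n -> 'rV[R]_m) x i j : open U -> smooth_on U g -> U x ->
  {for x, continuous (fun y => jacobian g y i j)}.
Proof.
move=> oU sg Ux; have [_ /(_ (delta_mx 0 i)) cD] := sg 0 j 1%N.
apply: near_eq_continuous (cD x Ux); apply: (near_open oU Ux) => y Uy.
by apply/esym/jacobianE/(smooth_on_differentiable sg).
Qed.

(** Mean value theorem, coordinate by coordinate, and continuity of the partial
   derivatives. *)
Lemma smooth_on_strict_deriv (n m : nat) (U : set 'rV[R]_n)
    (g : 'rV[R]_n -> 'rV[R]_m) x :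
  open U -> U x -> smooth_on U g -> strict_deriv setT g x (jacobian g x).
Proof.
move=> oU Ux sg e e0; pose c : R := e / n.+1%:R.
have c0 : 0 < c by rewrite divr_gt0 // ltr0Sn.
have swap (a b : R) : `|a - b| <= c -> `|b - a| <= c by rewrite distrC.
have : \forall w \near x, U w /\
    forall i j, `|jacobian g w i j - jacobian g x i j| <= c.
  apply: filterI; first exact: open_nbhs_nbhs.
  apply: (@filter_forall _ _ (fun i w => forall j,
    `|jacobian g w i j - jacobian g x i j| <= c) _ (nbhs_filter x)) => i.
  apply: (@filter_forall _ _ (fun j w => `|jacobian g w i j - jacobian g x i j| <= c)
    _ (nbhs_filter x)) => j.
  have /cvgrPdist_le/(_ c c0) := @smooth_on_jacobian_continuous _ _ _ g x i j oU sg Ux.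
  by apply: filterS => w; exact: swap.
move=> /nbhs_normP[d /= d0 xd]; exists d => // y z _ _ yx zx.
have seg (t : R) : 0 <= t <= 1 -> `|z + t *: (y - z) - x| < d.
  move=> /andP[t0 t1].
  have -> : z + t *: (y - z) - x = t *: (y - x) + (1 - t) *: (z - x).
    rewrite !scalerBr !scalerBl !scale1r; apply/rowP => j; rewrite !mxE; ring.
  rewrite (le_lt_trans (ler_normD _ _)) // !normrZ !ger0_norm ?subr_ge0 //.
  have [->|tn0] := eqVneq t 0; first by rewrite mul0r add0r subr0 mul1r.
  have : t * `|y - x| < t * d by rewrite ltr_pM2l // lt_neqAle eq_sym tn0.
  have : (1 - t) * `|z - x| <= (1 - t) * d by rewrite ler_wpM2l ?subr_ge0 // ltW.
  by move=> h1 h2; rewrite (lt_le_trans (ltr_leD h2 h1)) // -mulrDl addrC subrK mul1r.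
have segU t : 0 <= t <= 1 -> U (z + t *: (y - z)).
  by move=> /seg h; have [] := xd (z + t *: (y - z)) _; rewrite //= distrC.
apply: norm_rowP => [|j]; first by rewrite mulr_ge0 // ltW.
have dgj w : U w -> differentiable (fun y => g y 0 j) w.
  by have [+ _] := sg 0 j 1%N; apply.
have [t t01 E] := C1_mean_value segU dgj.
rewrite !mxE -[X in `|X + _|]/(g y 0 j - g z 0 j) E derive_row_sum; last exact/dgj/segU.
rewrite -sumrB (le_trans (ler_norm_sum _ _ _)) //.
apply: (@le_trans _ _ (\sum_(i < n) c * `|y - z|)).
  apply: ler_sum => i _; rewrite -jacobianE; last exact/(smooth_on_differentiable sg)/segU.
  rewrite -mulrBr normrM mulrC ler_pM ?norm_row_entry //.
  have xw : `|x - (z + t *: (y - z))| < d by rewrite distrC; exact: seg.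
  by have [_ h] := xd _ xw; exact: h.
rewrite sumr_const card_ord -mulr_natl mulrA ler_wpM2r // /c mulrCA ger_pMr //.
by rewrite ler_pdivrMr ?ltr0Sn // mul1r ler_nat.
Qed.

Lemma strict_deriv_sub (n m : nat) (A B : set 'rV[R]_n) (f g : 'rV[R]_n -> 'rV[R]_m)
    x D : (\forall y \near x, A y -> B y /\ f y = g y) ->
  strict_deriv B g x D -> strict_deriv A f x D.
Proof.
move=> /nbhs_normP[r /= r0 AB] sg e e0; have [d d0 h] := sg e e0.
exists (Num.min r d) => [|y z Ay Az]; first by rewrite lt_min r0.
rewrite !lt_min => /andP[yr yd] /andP[zr zd].
have [By ->] : B y /\ f y = g y by apply: AB => //=; rewrite distrC.
have [Bz ->] : B z /\ f z = g z by apply: AB => //=; rewrite distrC.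
exact: h.
Qed.

Lemma has_jacobian_strict_deriv (n m : nat) (A : set 'rV[R]_n)
    (f : 'rV[R]_n -> 'rV[R]_m) x D :
  has_jacobian A f x D -> strict_deriv A f x D.
Proof.
move=> [g [U [oU Ux sg fg]] ->].
apply: strict_deriv_sub (smooth_on_strict_deriv oU Ux sg).
by apply: (near_open oU Ux) => y Uy Ay; rewrite fg.
Qed.

End StrictDerivative.

Section StrictDerivativeTheory.
Variable R : realType.

Lemma strict_deriv_lipschitz (n m : nat) (A : set 'rV[R]_n)
    (f : 'rV[R]_n -> 'rV[R]_m) x D : strict_deriv A f x D ->
  exists2 d : R, 0 < d & forall y z, A y -> A z -> `|y - x| < d -> `|z - x| < d ->
    `|f y - f z| <= (op_bound D + 1) * `|y - z|.
Proof.
move=> /(_ 1 ltr01)[d d0 h]; exists d => // y z Ay Az yd zd.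
rewrite -[f y - f z](subrK ((y - z) *m D)) (le_trans (ler_normD _ _)) //.
by rewrite mulrDl addrC lerD ?norm_mulmx // h.
Qed.

Lemma strict_deriv_comp (n m p : nat) (A : set 'rV[R]_n) (B : set 'rV[R]_m)
    (f : 'rV[R]_n -> 'rV[R]_m) (g : 'rV[R]_m -> 'rV[R]_p) x D E :
  A x -> (\forall y \near x, A y -> B (f y)) ->
  strict_deriv A f x D -> strict_deriv B g (f x) E ->
  strict_deriv A (g \o f) x (D *m E).
Proof.
move=> Ax /nbhs_normP[r /= r0 AB] sf sg e e0.
have [d1 d10 lf] := strict_deriv_lipschitz sf.
set C := op_bound D + 1 in lf; have C0 : 0 < C by rewrite addr_gt0 // op_bound_gt0.
have E0 := op_bound_gt0 E.
have [d2 d20 hg] := sg (e / 2 / C) ltac:(by rewrite !divr_gt0).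
have [d3 d30 hf] := sf (e / 2 / op_bound E) ltac:(by rewrite !divr_gt0).
exists (Num.min (Num.min r d1) (Num.min d3 (d2 / C))).
  by rewrite !lt_min r0 d10 d30 divr_gt0.
move=> y z Ay Az; rewrite !lt_min => /andP[/andP[yr y1] /andP[y3 yC]].
move=> /andP[/andP[zr z1] /andP[z3 zC]].
have near2 w : A w -> `|w - x| < d1 -> `|w - x| < d2 / C -> `|f w - f x| < d2.
  move=> Aw w1 wC; apply: le_lt_trans (lf w x Aw Ax w1 _) _; first by rewrite subrr normr0.
  by rewrite mulrC -ltr_pdivlMr.
have By : B (f y) by apply: AB => //=; rewrite distrC.
have Bz : B (f z) by apply: AB => //=; rewrite distrC.
rewrite /= mulmxA -[g (f y) - _](subrK ((f y - f z) *m E)) -addrA -mulmxBl.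
rewrite (le_trans (ler_normD _ _)) // [e]splitr mulrDl lerD //.
  rewrite (le_trans (hg _ _ By Bz (near2 _ Ay y1 yC) (near2 _ Az z1 zC))) //.
  rewrite -mulrA ler_wpM2l ?divr_ge0 ?(ltW e0) // mulrC ler_pdivrMr //.
  by rewrite mulrC lf.
rewrite (le_trans (norm_mulmx _ _)) // mulrC -ler_pdivlMr //.
by rewrite (le_trans (hf _ _ Ay Az y3 z3)) // mulrAC.
Qed.

(** A domain with enough interior near each of its points for a derivative to be
   unique; boundary points of a half-space are the case that matters. *)
Definition orthant_stable (n : nat) (A : set 'rV[R]_n) : Prop :=
  forall y i (s : R), A y -> 0 <= s -> A (y + s *: delta_mx 0 i).

Lemma orthant_stable_setT (n : nat) : orthant_stable [set: 'rV[R]_n].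
Proof. by []. Qed.

Lemma orthant_stable_halfspace (n : nat) : orthant_stable (halfspace R n).
Proof.
move=> y i s /= y0 s0; by rewrite /halfspace /= !mxE addr_ge0 // mulr_ge0 // ler0n.
Qed.

Lemma strict_deriv_along (n m : nat) (A : set 'rV[R]_n) (f : 'rV[R]_n -> 'rV[R]_m) x D v :
  (forall s : R, 0 <= s -> A (x + s *: v)) -> strict_deriv A f x D ->
  forall e : R, 0 < e -> exists2 d : R, 0 < d & forall s, 0 < s < d ->
    `|f (x + s *: v) - f x - s *: (v *m D)| <= e * s.
Proof.
move=> Av sf e e0; pose c := `|v| + 1; have c0 : 0 < c by rewrite ltr_wpDl.
have [d d0 h] := sf (e / c) ltac:(by rewrite divr_gt0).
exists (d / c) => [|s /andP[s0 sd]]; first by rewrite divr_gt0.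
have Ax : A x by have := Av 0 (lexx _); rewrite scale0r addr0.
have sv : x + s *: v - x = s *: v by rewrite addrC addKr.
have := h (x + s *: v) x (Av s (ltW s0)) Ax.
rewrite sv subrr normr0 normrZ gtr0_norm // -scalemxAl => h'.
apply: le_trans (h' _ d0) _.
  apply: (@le_lt_trans _ _ (s * c)); first by rewrite ler_wpM2l ?(ltW s0) // lerDl.
  by rewrite -ltr_pdivlMr.
rewrite mulrCA [leRHS]mulrC ler_wpM2l ?(ltW s0) // mulrAC ler_pdivrMr // ler_wpM2l ?(ltW e0) //.
by rewrite lerDl.
Qed.

Lemma strict_deriv_unique (n m : nat) (A : set 'rV[R]_n) (f : 'rV[R]_n -> 'rV[R]_m) x D D' :
  orthant_stable A -> A x -> strict_deriv A f x D -> strict_deriv A f x D' -> D = D'.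
Proof.
move=> oA Ax sD sD'; apply/row_matrixP => i; rewrite !rowE; set v := delta_mx 0 i.
have Av (s : R) : 0 <= s -> A (x + s *: v) by exact: oA.
apply/eqP; rewrite -subr_eq0 -normr_le0; apply/ler_addgt0Pr => e e0; rewrite add0r.
have e20 : 0 < e / 2 by rewrite divr_gt0.
have [d d0 h] := strict_deriv_along Av sD e20.
have [d' d'0 h'] := strict_deriv_along Av sD' e20.
pose s := Num.min d d' / 2; have m0 : 0 < Num.min d d' by rewrite lt_min d0.
have s0 : 0 < s by rewrite divr_gt0.
have : s < Num.min d d' by rewrite /s ltr_pdivrMr // ltr_pMr // ltrDl.
rewrite lt_min => /andP[sd sd'].
have {}h := h s ltac:(by rewrite s0); have {}h' := h' s ltac:(by rewrite s0).
rewrite -(ler_pM2l s0) -{1}(gtr0_norm s0) -normrZ scalerBr.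
set a := f _ - _ in h h'; rewrite -[s *: (v *m D)](subrK a) -addrA.
rewrite (le_trans (ler_normD _ _)) // [`|_ - a|]distrC (le_trans (lerD h h')) //.
by rewrite -mulrDl -splitr mulrC.
Qed.

Lemma strict_deriv_id (n : nat) (A : set 'rV[R]_n) x : strict_deriv A id x 1%:M.
Proof.
by move=> e e0; exists 1 => // y z _ _ _ _; rewrite mulmx1 subrr normr0 mulr_ge0 // ltW.
Qed.

End StrictDerivativeTheory.

(** * The fixed curve of an involution near a point *)

Lemma lipschitz_within_continuous (R : realType) (X Y : normedModType R) (K : set X)
    (f : X -> Y) (L : R) :
  (forall y z, K y -> K z -> `|f y - f z| <= L * `|y - z|) -> {within K, continuous f}.
Proof.
move=> fL; apply/subspace_continuousP => x Kx; apply/cvgrPdist_le => e e0.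
have L0 : 0 < `|L| + 1 by rewrite ltr_wpDl.
have : \forall y \near x, `|x - y| < e / (`|L| + 1).
  by apply: (@cvgr_dist_lt _ _ _ (nbhs x) _ id) => //; rewrite divr_gt0.
apply: filterS => y xy Ky; rewrite (le_trans (fL x y Kx Ky)) //.
rewrite (@le_trans _ _ ((`|L| + 1) * `|x - y|)) //.
  by rewrite ler_wpM2r // (le_trans (ler_norm L)) // lerDl.
by rewrite mulrC -ler_pdivlMr // ltW.
Qed.

Section LocalModel.
Variables (R : realType) (n : nat) (A : set 'rV[R]_n) (tau : 'rV[R]_n -> 'rV[R]_n).
Variables (x : 'rV[R]_n) (D : 'M[R]_n) (e : 'rV[R]_n) (l : 'cV[R]_n).
Hypotheses (tauD : strict_deriv A tau x D) (hD : half_turn D).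
Hypotheses (eD : e *m D = e) (el : e *m l = 1%:M).

(** For two fixed points with difference [v], the vector [v - v D] is small with
   respect to [v]; it is twice the component of [v] in the [-1] eigenspace. *)
Lemma fixed_tangent (eps : R) : 0 < eps -> exists2 d : R, 0 < d & forall y z, A y -> A z ->
  `|y - x| < d -> `|z - x| < d -> tau y = y -> tau z = z ->
  `|(y - z) - ((y - z) *m l) 0 0 *: e| <= eps * `|y - z|.
Proof.
move=> eps0; pose c := op_bound (off_axis e l); have c0 : 0 < c := op_bound_gt0 _.
have [d d0 h] := tauD (divr_gt0 eps0 c0); exists d => // y z Ay Az yd zd ty tz.
have := h y z Ay Az yd zd; rewrite ty tz; set v := y - z => hv.
have -> : v - (v *m l) 0 0 *: e = 2^-1 *: ((v - v *m D) *m off_axis e l).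
  have -> : (v - v *m D) *m off_axis e l = 2 *: (v *m off_axis e l).
    have /eqP : v *m off_axis e l + v *m D *m off_axis e l = 0.
      by rewrite -mulmxDl -[X in X + _]mulmx1 -mulmxDr -mulmxA half_turn_off_axis // mulmx0.
    by rewrite addrC addr_eq0 => /eqP E; rewrite mulmxBl E opprK scaler_nat mulr2n.
  rewrite scalerA mulVf // scale1r /off_axis mulmxBr mulmx1 mulmxA; congr (_ - _).
  by rewrite {2}[v *m l]mx11_scalar mul_scalar_mx.
rewrite normrZ ger0_norm ?invr_ge0 // (@le_trans _ _ (`|(v - v *m D) *m off_axis e l|)) //.
  by rewrite ler_piMl // invf_le1 // ler1n.
rewrite (le_trans (norm_mulmx _ _)) // mulrC -ler_pdivlMr // mulrAC; exact: hv.
Qed.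

Hypotheses (Ax : A x) (tx : tau x = x) (Dl : D *m l = l).
Hypothesis invol : \forall y \near x, A y -> A (tau y) /\ tau (tau y) = y.
(* At a boundary point of the half-space [T] will be the set of nonnegative reals. *)
Variable T : set R.
Hypothesis room : exists2 r : R, 0 < r & forall t q, T t -> `|t| <= r ->
  q *m D = - q -> `|q| <= r -> A (x + t *: e + q).

(** The point [x + t e + q], with [q] in the [-1] eigenspace of [D], is fixed by
   [tau] as soon as the component [w] of its displacement in this eigenspace
   vanishes.  Replacing [q] by [q + w / 2] at least halves [w], so [w] vanishes
   where its norm is minimal. *)
Lemma fixed_curve_exists (delta : R) : 0 < delta -> exists2 r : R, 0 < r &
  forall t, T t -> `|t| <= r ->
  exists y, [/\ A y, `|y - x| < delta, tau y = y & ((y - x) *m l) 0 0 = t].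
Proof.
move=> delta0; have [DD _] := hD.
pose pi : 'M[R]_n := 2^-1 *: (1%:M - D).
have piD : pi *m D = - pi.
  by rewrite -scalemxAl mulmxBl mul1mx DD -opprB scalerN.
have pil : pi *m l = 0 by rewrite -scalemxAl mulmxBl mul1mx Dl subrr scaler0.
have pipi (v : 'rV[R]_n) : v *m D = - v -> v *m pi = v.
  move=> vD; rewrite -scalemxAr mulmxBr mulmx1 vD opprK -mulr2n -[v *+ 2]scaler_nat.
  by rewrite scalerA mulVf // scale1r.
have epi : e *m pi = 0 by rewrite -scalemxAr mulmxBr mulmx1 eD subrr scaler0.
pose C := op_bound pi; have C1 : 1 <= C.
  by rewrite lerDl sumr_ge0 // => i _; rewrite sumr_ge0.
have C0 : 0 < C := op_bound_gt0 pi.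
pose B := op_bound D + 1; have B1 : 1 <= B by rewrite lerDr ltW // op_bound_gt0.
(* On the ball of radius [rho] one has [|P q - x| <= (1 + C) rho], so with this
   [eps] the error in [tau (P q)] contributes at most [rho / 2] to the new [q]. *)
pose eps : R := (C * (1 + C))^-1.
have eps0 : 0 < eps by rewrite invr_gt0 mulr_gt0 // addr_gt0.
have Ceps : C * eps * (1 + C) = 1.
  by rewrite mulrAC mulfV // gt_eqF // mulr_gt0 // addr_gt0.
have Ceps1 : C * eps <= 1.
  by rewrite -Ceps ler_peMr ?mulr_ge0 ?(ltW C0) ?(ltW eps0) // lerDl ltW.
have eps1 : eps <= 1.
  by apply: le_trans Ceps1; rewrite ler_peMl // ltW.
have [d d0 hd] := tauD eps0.
have [r1 /= r10 hr1] := (nbhs_normP _ _).1 invol.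
have [r2 r20 hr2] := room.
pose m0 := Num.min (Num.min d delta) (Num.min r1 r2).
have m00 : 0 < m0 by rewrite !lt_min d0 delta0 r10.
pose rho := m0 / 2 / (B * (1 + C)).
have B0 : 0 < B := lt_le_trans ltr01 B1.
have BC0 : 0 < B * (1 + C) by apply: mulr_gt0 => //; exact: addr_gt0.
have rho0 : 0 < rho by rewrite !divr_gt0.
have rhoE : B * ((1 + C) * rho) = m0 / 2.
  by rewrite mulrA /rho mulrC divfK // gt_eqF.
have rho_m : (1 + C) * rho <= m0 / 2.
  by rewrite -rhoE ler_peMl // mulr_ge0 ?(ltW rho0) // addr_ge0 // ltW.
have m2 : m0 / 2 < m0 by rewrite ltr_pdivrMr // ltr_pMr // ltr1n.
have e10 : 0 < `|e| + 1 by rewrite ltr_wpDl.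
exists (Num.min (rho / (`|e| + 1)) r2) => [|t Tt]; first by rewrite lt_min r20 divr_gt0.
rewrite le_min => /andP[te tr2].
have {}te : `|t *: e| <= rho.
  rewrite normrZ; apply: (@le_trans _ _ (`|t| * (`|e| + 1))); last by rewrite -ler_pdivlMr.
  by rewrite ler_wpM2l // lerDl.
pose K : set 'rV[R]_n := [set q | forall j, `[- rho, rho]%classic (q 0 j)].
have KE q : K q <-> `|q| <= rho.
  split=> [Kq|q_le j]; last first.
    by rewrite /= in_itv /= -ler_norml (le_trans (norm_row_entry _ _)).
  by apply: norm_rowP => [|j]; [exact: ltW|rewrite ler_norml; have := Kq j; rewrite /= in_itv].
have cK : compact K.
  exact: (@rV_compact R n (fun=> `[- rho, rho]%classic) (fun=> @segment_compact R _ _)).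
pose P q := x + t *: e + q *m pi.
have PA q : K q -> A (P q).
  move=> /KE Kq; apply: hr2 => //; first by rewrite -mulmxA piD mulmxN.
  rewrite (le_trans (norm_mulmx _ _)) // (@le_trans _ _ (C * rho)) //.
    by rewrite ler_wpM2l // ltW.
  apply: (@le_trans _ _ ((1 + C) * rho)); first by rewrite ler_wpM2r ?(ltW rho0) // lerDr.
  by rewrite (le_trans rho_m) // (le_trans (ltW m2)) // /m0 !ge_min lexx !orbT.
have PxE q : P q - x = t *: e + q *m pi by rewrite /P -[x + _ + _]addrA [LHS]addrC addKr.
have Px q : K q -> `|P q - x| <= (1 + C) * rho.
  move=> /KE Kq; rewrite PxE (le_trans (ler_normD _ _)) // mulrDl mul1r lerD //.
  by rewrite (le_trans (norm_mulmx _ _)) // ler_wpM2l // ltW.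
have Pm q : K q -> `|P q - x| < m0.
  by move=> Kq; rewrite (le_lt_trans (Px q Kq)) // (le_lt_trans rho_m).
have Pd q : K q -> `|P q - x| < d.
  by move=> /Pm; rewrite !lt_min => /andP[/andP[]].
have xd : `|x - x| < d by rewrite subrr normr0.
pose w q := (tau (P q) - P q) *m pi.
have wD q : w q *m D = - w q by rewrite -mulmxA piD mulmxN.
have Px2 q : K q -> `|tau (P q) - x - (P q - x) *m D| <= eps * `|P q - x|.
  by move=> Kq; rewrite -{1}tx; apply: hd (PA q Kq) Ax (Pd q Kq) xd.
have qpi (q : 'rV[R]_n) : q *m pi *m pi = q *m pi by apply: pipi; rewrite -mulmxA piD mulmxN.
have step q : K q -> K (q *m pi + 2^-1 *: w q).
  move=> Kq; apply/KE.
  have -> : q *m pi + 2^-1 *: w q = 2^-1 *: ((tau (P q) - x - (P q - x) *m D) *m pi).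
    have -> : w q = (tau (P q) - x) *m pi - q *m pi.
      have -> : q *m pi = (P q - x) *m pi.
        by rewrite PxE mulmxDl -scalemxAl epi scaler0 add0r qpi.
      by rewrite -mulmxBl opprB addrA subrK.
    rewrite [X in _ = _ *: X]mulmxBl; have -> : (P q - x) *m D *m pi = - (q *m pi).
      rewrite PxE mulmxDl -scalemxAl eD -mulmxA piD mulmxN mulmxBl -scalemxAl epi.
      by rewrite scaler0 qpi sub0r.
    by apply/rowP => j; rewrite !mxE; field.
  rewrite normrZ ger0_norm ?invr_ge0 //.
  apply: (@le_trans _ _ (2^-1 * (C * (eps * ((1 + C) * rho))))).
    rewrite ler_wpM2l ?invr_ge0 // (le_trans (norm_mulmx _ _)) // ler_wpM2l ?(ltW C0) //.
    by rewrite (le_trans (Px2 q Kq)) // ler_wpM2l ?(ltW eps0) // Px.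
  have -> : C * (eps * ((1 + C) * rho)) = rho by rewrite !mulrA Ceps mul1r.
  by rewrite ler_piMl ?(ltW rho0) // invf_le1 // ler1n.
have halve q : K q -> `|w (q *m pi + 2^-1 *: w q)| <= 2^-1 * `|w q|.
  move=> Kq; set q' := q *m pi + _; have Kq' : K q' := step q Kq.
  have q'pi : q' *m pi = q' by apply: pipi; rewrite mulmxDl -mulmxA piD mulmxN -scalemxAl
    wD scalerN opprD.
  have PP : P q' - P q = 2^-1 *: w q by rewrite /P q'pi opprD addrACA subrr add0r /q' addrC addKr.
  have wE : w q' = (tau (P q') - tau (P q) - (P q' - P q) *m D) *m pi.
    rewrite PP -scalemxAl wD.
    have wpi : w q *m pi = w q by apply: pipi.
    have -> : w q' = (tau (P q') - (P q + 2^-1 *: w q)) *m pi by rewrite -PP addrCA subrr addr0.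
    apply/eqP; rewrite -subr_eq0 -mulmxBl.
    rewrite [X in X *m pi](_ : _ = (tau (P q) - P q) - w q).
      by rewrite mulmxBl wpi subrr.
    by apply/rowP => j; rewrite !mxE; field.
  rewrite wE (le_trans (norm_mulmx _ _)) //.
  have := hd (P q') (P q) (PA _ Kq') (PA _ Kq) (Pd _ Kq') (Pd _ Kq).
  rewrite {2}PP normrZ ger0_norm ?invr_ge0 // => h.
  apply: (@le_trans _ _ (C * (eps * (2^-1 * `|w q|)))); first by rewrite ler_wpM2l ?(ltW C0).
  by rewrite mulrA ler_piMl // mulr_ge0 // invr_ge0.
have Blip y z : A y -> A z -> `|y - x| < d -> `|z - x| < d ->
    `|tau y - tau z| <= B * `|y - z|.
  move=> Ay Az yd zd; rewrite -[tau y - tau z](subrK ((y - z) *m D)).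
  rewrite (le_trans (ler_normD _ _)) // /B mulrDl addrC lerD ?norm_mulmx //.
  by rewrite (le_trans (hd _ _ Ay Az yd zd)) // ler_wpM2r.
have cw : {within K, continuous (fun q => `|w q|)}.
  apply: (@lipschitz_within_continuous _ _ _ _ _ (C * ((B + 1) * C))) => q q' Kq Kq'.
  rewrite (le_trans (ler_dist_dist _ _)) // /w -mulmxBl (le_trans (norm_mulmx _ _)) //.
  rewrite -!mulrA ler_wpM2l ?(ltW C0) //.
  have PP : `|P q - P q'| <= C * `|q - q'|.
    by rewrite /P opprD addrACA subrr add0r -mulmxBl norm_mulmx.
  apply: (@le_trans _ _ ((B + 1) * `|P q - P q'|)).
    rewrite [X in `|X|](_ : _ = tau (P q) - tau (P q') - (P q - P q')); last first.
      by apply/rowP => j; rewrite !mxE; ring.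
    rewrite (le_trans (ler_normB _ _)) // mulrDl mul1r lerD //.
    exact: Blip (PA _ Kq) (PA _ Kq') (Pd _ Kq) (Pd _ Kq').
  by rewrite ler_wpM2l // addr_ge0 // ltW.
have K0 : K !=set0 by exists 0; apply/KE; rewrite normr0 ltW.
have [q /set_mem Kq qmin] := EVT_min_rV K0 cK cw.
have wq : w q = 0.
  apply/eqP; rewrite -normr_le0.
  have := le_trans (qmin _ (mem_set (step q Kq))) (halve q Kq); lra.
exists (P q); split; [exact: PA| | |].
- by move: (Pm q Kq); rewrite !lt_min => /andP[/andP[]].
- apply/eqP; rewrite -subr_eq0 -normr_le0; set h := tau (P q) - P q.
  have hDh : h *m D = h.
    have /eqP : w q = 0 by []. rewrite /w -scalemxAr scaler_eq0 invr_eq0 pnatr_eq0 /=.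
    by rewrite mulmxBr mulmx1 subr_eq0 => /eqP.
  have [ATP TTP] : A (tau (P q)) /\ tau (tau (P q)) = P q.
    apply: hr1 (PA _ Kq); rewrite /= distrC.
    by move: (Pm q Kq); rewrite !lt_min => /andP[_ /andP[]].
  have TPd : `|tau (P q) - x| < d.
    rewrite -{1}tx (le_lt_trans (Blip _ _ (PA _ Kq) Ax (Pd _ Kq) xd)) //.
    rewrite (@le_lt_trans _ _ (m0 / 2)) //.
      by rewrite -rhoE ler_wpM2l ?(ltW B0) // Px.
    by rewrite (lt_le_trans m2) // /m0 !ge_min lexx.
  have := hd _ _ ATP (PA _ Kq) TPd (Pd _ Kq).
  have Nh : P q - tau (P q) = - h by rewrite opprB.
  rewrite TTP -/h hDh Nh -opprD normrN -mulr2n normrMn => h2.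
  have := le_trans h2 (ler_wpM2r (normr_ge0 h) eps1).
  by rewrite mul1r mulr2n gerDl.
- by rewrite PxE mulmxDl -mulmxA pil mulmx0 addr0 -scalemxAl el !mxE mulr1.
Qed.

End LocalModel.

Section HalfspaceModel.
Variables (R : realType) (n : nat) (tau : 'rV[R]_n.+1 -> 'rV[R]_n.+1).
Local Notation H := (halfspace R n).
Variables (x : 'rV[R]_n.+1) (D : 'M[R]_n.+1).
Hypotheses (tauD : strict_deriv H tau x D) (tx : tau x = x).
Hypothesis invol : \forall y \near x, H y -> H (tau y) /\ tau (tau y) = y.

(** An involution of the half-space near a boundary point reverses the vectors of
   the [-1] eigenspace, so none of them can point inwards. *)
Lemma reversed_tangent (q : 'rV[R]_n.+1) : x 0 0 = 0 -> q *m D = - q -> q 0 0 = 0.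
Proof.
move=> x0; wlog : q / 0 < q 0 0 => [W qD|q0 qD].
  apply/eqP/negP => /negP /lt_total/orP[] q0; last first.
    by have := W q q0 qD => E; move: q0; rewrite E ltxx.
  have := W (- q); rewrite mulNmx qD !mxE oppr_gt0 => /(_ q0 erefl)/eqP.
  by rewrite oppr_eq0 => /eqP E; move: q0; rewrite E ltxx.
exfalso; have Hq (s : R) : 0 <= s -> H (x + s *: q).
  by move=> s0; rewrite /halfspace /= !mxE x0 add0r mulr_ge0 // ltW.
have [d d0 h] := strict_deriv_along Hq tauD (divr_gt0 q0 (ltr0n R 2)).
have [r /= r0 hr] := (nbhs_normP _ _).1 invol.
have c0 : 0 < `|q| + 1 by rewrite ltr_wpDl.
pose s := Num.min d (r / (`|q| + 1)) / 2.
have m0 : 0 < Num.min d (r / (`|q| + 1)) by rewrite lt_min d0 divr_gt0.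
have s0 : 0 < s by rewrite divr_gt0.
have : s < Num.min d (r / (`|q| + 1)) by rewrite /s ltr_pdivrMr // ltr_pMr // ltr1n.
rewrite lt_min => /andP[sd sr].
have [|Ht _] := hr (x + s *: q) _ (Hq s (ltW s0)).
  rewrite /= opprD addrA subrr add0r normrN normrZ gtr0_norm //.
  apply: le_lt_trans (_ : s * (`|q| + 1) < r); last by rewrite -ltr_pdivlMr.
  by rewrite ler_wpM2l ?(ltW s0) // lerDl.
have := h s ltac:(by rewrite s0); rewrite tx qD scalerN opprK => hs.
have := le_trans (norm_row_entry _ 0) hs.
move: Ht; rewrite /halfspace /= !mxE x0 subr0 => Ht.
have sq : 0 < s * q 0 0 by rewrite mulr_gt0.
by rewrite ger0_norm ?addr_ge0 // ?(ltW sq) //; nra.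
Qed.

Lemma room_interior (e : 'rV[R]_n.+1) : 0 < x 0 0 ->
  exists2 r : R, 0 < r & forall t (q : 'rV[R]_n.+1), setT t -> `|t| <= r -> q *m D = - q -> `|q| <= r ->
    H (x + t *: e + q).
Proof.
move=> x0; have c0 : 0 < `|e| + 2 by rewrite ltr_wpDl.
exists (x 0 0 / (`|e| + 2)) => [|t q _ tr _ qr]; first by rewrite divr_gt0.
rewrite /halfspace /= !mxE.
have := norm_row_entry q 0; have := norm_row_entry e 0 => e0 q0.
have te : `|t * e 0 0| <= `|t| * `|e| by rewrite normrM ler_wpM2l.
have tr' : `|t| * `|e| + `|q| <= x 0 0.
  apply: (@le_trans _ _ (x 0 0 / (`|e| + 2) * (`|e| + 1))).
    by rewrite mulrDr mulr1 lerD // ler_wpM2r.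
  by rewrite mulrAC ler_pdivrMr // ler_wpM2l ?(ltW x0) // lerD2l ler1n.
have h1 := ler_norm (- (t * e 0 0)); have h2 := ler_norm (- q 0 0).
by rewrite !normrN in h1 h2; lra.
Qed.

Lemma room_boundary (e : 'rV[R]_n.+1) : x 0 0 = 0 -> 0 < e 0 0 ->
  exists2 r : R, 0 < r & forall t (q : 'rV[R]_n.+1), [set t | 0 <= t] t -> `|t| <= r -> q *m D = - q ->
    `|q| <= r -> H (x + t *: e + q).
Proof.
move=> x0 e0; exists 1 => // t q t0 _ qD _.
by rewrite /halfspace /= !mxE x0 (reversed_tangent x0 qD) add0r addr0 mulr_ge0 // ltW.
Qed.

End HalfspaceModel.

(** * Compact oriented curves *)

(** The finite subcover property for a neighbourhood of each point, in a space
   that need not be pointed; the filter is that of the sequences of points of [F]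
   that contain a given one. *)
Lemma compact_nbhs_cover (X : topologicalType) (F : set X) (N : X -> set X) :
  compact F -> (forall x, F x -> nbhs x (N x)) ->
  exists2 s : seq X, (forall x, x \in s -> F x) &
    forall y, F y -> exists2 x, x \in s & N x y.
Proof.
move=> /compact_near_coveringP cF FN.
pose G : set_system (seq X) := [set P : set (seq X) | exists2 s : seq X,
  (forall x, x \in s -> F x) &
  forall s' : seq X, (forall x, x \in s' -> F x) -> {subset s <= s'} -> P s'].
have FG : Filter G.
  split.
  - by exists [::].
  - move=> P Q [s sF sP] [s' s'F s'Q]; exists (s ++ s').
      by move=> x; rewrite mem_cat => /orP[/sF|/s'F].
    by move=> t tF st; split; [apply: sP|apply: s'Q] => // x xs; apply: st;
      rewrite mem_cat xs ?orbT.
  - by move=> P Q PQ [s sF sP]; exists s => // t tF st; exact/PQ/sP.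
have := cF _ G (fun (s : seq X) y => (forall x, x \in s -> F x) -> exists2 x, x \in s & N x y) FG.
case=> [x Fx|s sF sP].
  exists (N x, [set s : seq X | x \in s]) => /=.
    split; first exact: FN.
    by exists [:: x] => [y|s _ ss /=]; [rewrite inE => /eqP ->|apply: ss; rewrite inE].
  by move=> [y s] /= [Ny xs] _; exists x.
by exists s => // y Fy; exact: (sP s sF (fun x => id) y Fy).
Qed.

Section OrientedCurve.
Variables (R : realType) (X : topologicalType) (F : set X).

(** A coordinate [coord], increasing along the orientation, and a parametrised arc
   on which it takes the values of the segment from [lo] to [hi]. *)
Record arc := Arc {
  region : set X;
  coord : X -> R;
  point_at : R -> X;
  lo : R;
  hi : R }.

Definition is_arc (a : arc) : Prop :=
  [/\ open (region a),
      forall x, region a x -> {for x, continuous (coord a)},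
      forall t, lo a <= t <= hi a ->
        [/\ F (point_at a t), region a (point_at a t) & coord a (point_at a t) = t],
      {within `[lo a, hi a], continuous (point_at a)} &
      forall x, F x -> region a x -> lo a <= coord a x <= hi a ->
        point_at a (coord a x) = x].

Variable arcs : set arc.
Hypotheses (hausX : hausdorff_space X) (compactF : compact F).
Hypothesis arcsP : forall a, arcs a -> is_arc a.
Hypothesis cover : forall x, F x -> exists2 a, arcs a &
  \forall y \near x, F y -> region a y /\ lo a <= coord a y < hi a.
Hypothesis coherent : forall a b x, arcs a -> arcs b -> F x -> region a x -> region b x ->
  \forall y \near x, F y -> coord a y < coord a x -> coord b y < coord b x.

(** The comparison of [v] and [w] takes place in one arc, so that two successors
   can be compared through the connectedness of the arcs that lead to them. *)
Definition successor (V : seq X) (v w : X) : Prop := exists2 a, arcs a &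
  [/\ [/\ F v, F w, region a v & region a w],
      [/\ lo a <= coord a v, coord a v < coord a w & coord a w <= hi a] &
      forall v', v' \in V -> region a v' -> ~ (coord a v < coord a v' < coord a w)].

Definition open_arc (a : arc) (v w : X) : set X :=
  [set x | [/\ F x, region a x & coord a v < coord a x < coord a w]].

Lemma open_arcE a v w : arcs a -> lo a <= coord a v -> coord a w <= hi a ->
  open_arc a v w = point_at a @` `]coord a v, coord a w[%classic.
Proof.
move=> /arcsP[_ _ ap _ pa] lv wh; apply/seteqP; split=> x.
  move=> [Fx ax /andP[vx xw]]; exists (coord a x); first by rewrite /= in_itv /= vx.
  by apply: pa => //; rewrite (le_trans lv (ltW vx)) (le_trans (ltW xw) wh).
move=> [t]; rewrite /= in_itv /= => /andP[vt tw] <-.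
have [|Fp ap' tE] := ap t; last by split=> //; rewrite tE vt.
by rewrite (le_trans lv (ltW vt)) (le_trans (ltW tw) wh).
Qed.

Lemma open_arc_connected a v w : arcs a -> lo a <= coord a v -> coord a w <= hi a ->
  connected (open_arc a v w).
Proof.
move=> aA lv wh; rewrite open_arcE //; have [_ _ _ cp _] := arcsP aA.
refine (connected_continuous_connected _ _).
  exact/connected_intervalP/interval_is_interval.
apply: continuous_subspaceW cp => t; rewrite /= !in_itv /= => /andP[vt tw].
by rewrite (le_trans lv (ltW vt)) (le_trans (ltW tw) wh).
Qed.

Lemma open_arc_open a v w : arcs a ->
  exists2 O, open O & open_arc a v w = F `&` O.
Proof.
move=> /arcsP[oa ca _ _ _].
exists (region a `&` coord a @^-1` `]coord a v, coord a w[%classic).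
  rewrite openE => x [ax vxw]; apply: filterI; first exact: open_nbhs_nbhs.
  by apply: (ca x ax); apply: open_nbhs_nbhs.
by apply/seteqP; split=> x /=; rewrite in_itv /= => -[Fx]; [|case].
Qed.

Lemma closed_arc a (v w : X) : arcs a -> lo a <= coord a v -> coord a w <= hi a ->
  closed (point_at a @` `[coord a v, coord a w]%classic).
Proof.
move=> aA lv wh; have [_ _ _ cp _] := arcsP aA.
apply: compact_closed => //; refine (continuous_compact _ (@segment_compact R _ _)).
apply: continuous_subspaceW cp => t; rewrite /= !in_itv /= => /andP[vt tw].
by rewrite (le_trans lv vt) (le_trans tw wh).
Qed.

Lemma arc_near a (c : R) (N : set X) : arcs a -> lo a <= c <= hi a ->
  nbhs (point_at a c) N ->
  exists2 d : R, 0 < d & forall t, lo a <= t <= hi a -> `|c - t| < d -> N (point_at a t).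
Proof.
move=> aA cI Nc; have [_ _ _ /subspace_continuousP cp _] := arcsP aA.
have cI' : `[lo a, hi a]%classic c by rewrite /= in_itv.
have /nbhs_normP[d /= d0 h] := cp c cI' N Nc; exists d => // t tI ct.
by apply: h => //=; rewrite in_itv.
Qed.

Lemma arc_near_before a v w (N : set X) : arcs a -> F v -> F w -> region a v -> region a w ->
  lo a <= coord a v -> coord a v < coord a w -> coord a w <= hi a ->
  nbhs w N -> exists2 z, open_arc a v w z & N z.
Proof.
move=> aA Fv Fw av aw lv vw wh Nw; have [_ _ ap _ pa] := arcsP aA.
have wI : lo a <= coord a w <= hi a by rewrite wh (le_trans lv) // ltW.
have [d d0 h] := @arc_near a (coord a w) N aA wI ltac:(by rewrite pa).
pose m := Num.min d (coord a w - coord a v); have m0 : 0 < m by rewrite lt_min d0 subr_gt0.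
have m2 : m / 2 < m by rewrite ltr_pdivrMr // ltr_pMr // ltr1n.
have m20 : 0 < m / 2 by rewrite divr_gt0.
have md : m <= d by rewrite ge_min lexx.
have mv : m <= coord a w - coord a v by rewrite ge_min lexx orbT.
have tI : lo a <= coord a w - m / 2 <= hi a by apply/andP; split; lra.
exists (point_at a (coord a w - m / 2)).
  by have [Fz az zE] := ap _ tI; split=> //; rewrite zE; apply/andP; split; lra.
by apply: h => //; rewrite opprB addrC subrK gtr0_norm //; lra.
Qed.

Lemma arc_near_after a v w (N : set X) : arcs a -> F v -> F w -> region a v -> region a w ->
  lo a <= coord a v -> coord a v < coord a w -> coord a w <= hi a ->
  nbhs v N -> exists2 z, open_arc a v w z & N z.
Proof.
move=> aA Fv Fw av aw lv vw wh Nv; have [_ _ ap _ pa] := arcsP aA.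
have vI : lo a <= coord a v <= hi a by rewrite lv (le_trans _ wh) // ltW.
have [d d0 h] := @arc_near a (coord a v) N aA vI ltac:(by rewrite pa).
pose m := Num.min d (coord a w - coord a v); have m0 : 0 < m by rewrite lt_min d0 subr_gt0.
have m2 : m / 2 < m by rewrite ltr_pdivrMr // ltr_pMr // ltr1n.
have m20 : 0 < m / 2 by rewrite divr_gt0.
have md : m <= d by rewrite ge_min lexx.
have mv : m <= coord a w - coord a v by rewrite ge_min lexx orbT.
have tI : lo a <= coord a v + m / 2 <= hi a by apply/andP; split; lra.
exists (point_at a (coord a v + m / 2)).
  by have [Fz az zE] := ap _ tI; split=> //; rewrite zE; apply/andP; split; lra.
by apply: h => //; rewrite opprD addrA subrr add0r normrN gtr0_norm //; lra.
Qed.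

(** Just before [w] the two arcs agree, by coherence, and neither leaves the other
   before reaching a point of [V]. *)
Lemma open_arc_sub (V : seq X) a b v v' w : arcs a -> arcs b ->
  F v -> F v' -> F w -> region a v -> region a w -> region b v' -> region b w ->
  lo a <= coord a v -> coord a v < coord a w -> coord a w <= hi a ->
  lo b <= coord b v' -> coord b v' < coord b w -> coord b w <= hi b ->
  v' \in V ->
  (forall u, u \in V -> region a u -> ~ (coord a v < coord a u < coord a w)) ->
  open_arc a v w `<=` open_arc b v' w.
Proof.
move=> aA bA Fv Fv' Fw av aw bv' bw lv vw wh lv' vw' wh' v'V nV.
have [_ ca _ _ _] := arcsP aA; have [ob cb bp _ pb] := arcsP bA.
have [G oG GE] := open_arc_open v' w bA.
pose A := open_arc a v w; pose C := point_at b @` `[coord b v', coord b w]%classic.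
have conn : connected A by exact: open_arc_connected.
have : A `&` G = A.
  apply: conn; [|by exists G|exists C; first exact: closed_arc].
    have : nbhs w [set z | [/\ region b z, coord b v' < coord b z &
        F z -> coord a z < coord a w -> coord b z < coord b w]].
      have n1 : nbhs w (region b) by exact: open_nbhs_nbhs.
      have n2 : nbhs w [set z | coord b v' < coord b z].
        apply: (cb w bw (fun y => coord b v' < y)).
        by apply: open_nbhs_nbhs; split => //; exact: open_gt.
      have n3 := coherent aA bA Fw aw bw.
      by apply: filterS (filterI n1 (filterI n2 n3)) => z [? []].
    move=> /(arc_near_before aA Fv Fw av aw lv vw wh)[z Az [bz vz zw]].
    exists z; split=> //; have [Fz _ /andP[_ zwa]] := Az.
    have : open_arc b v' w z by split=> //; rewrite vz zw.
    by rewrite GE => -[].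
  apply/seteqP; split=> z [Az].
    have [Fz az _] := Az; move=> Gz; split=> //.
    have [_ bz /andP[vz zw]] : open_arc b v' w z by rewrite GE.
    exists (coord b z); first by rewrite /= in_itv /= !ltW.
    by apply: pb => //; rewrite (le_trans lv' (ltW vz)) (le_trans (ltW zw) wh').
  move=> [t]; rewrite /= in_itv /= => /andP[vt tw] tz; split=> //.
  have [|Fz bz zt] := bp t; first by rewrite (le_trans lv' vt) (le_trans tw wh').
  rewrite tz in Fz bz zt; have [_ az zI] := Az.
  suff : open_arc b v' w z by rewrite GE => -[].
  split=> //; rewrite zt !lt_neqAle vt tw !andbT; apply/andP; split; apply/eqP => E.
    have zv : z = v'.
      by rewrite -tz -E pb // lv' (le_trans (ltW vw') wh').
    by apply: (nV v') => //; rewrite -zv.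
  have zw : z = w by rewrite -tz E pb // wh' (le_trans lv' (ltW vw')).
  by move: zI; rewrite zw ltxx andbF.
move=> AG z Az; have : (A `&` G) z by rewrite AG.
by move=> [_ Gz]; rewrite GE; split=> //; case: Az.
Qed.

(** The open arcs that lead from [v] and from [v'] to [w] contain each other, so
   that [v] lies in the closed arc from [v'] to [w]; it is not inside, since it
   belongs to [V]. *)
Lemma successor_inj (V : seq X) v v' w : v \in V -> v' \in V ->
  successor V v w -> successor V v' w -> v = v'.
Proof.
move=> vV v'V [a aA [[Fv Fw av aw] [lv vw wh] nV]].
move=> [b bA [[Fv' _ bv' bw] [lv' vw' wh'] nV']].
have [_ _ bp _ pb] := arcsP bA.
have sub := open_arc_sub aA bA Fv Fv' Fw av aw bv' bw lv vw wh lv' vw' wh' v'V nV.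
have [t + tv] : (point_at b @` `[coord b v', coord b w]%classic) v.
  apply: contrapT => nC.
  have oC : nbhs v (~` (point_at b @` `[coord b v', coord b w]%classic)).
    by apply: open_nbhs_nbhs; split=> //; rewrite openC; exact: closed_arc.
  have [z /sub[Fz bz /andP[vz zw]]] := arc_near_after aA Fv Fw av aw lv vw wh oC.
  apply; exists (coord b z); first by rewrite /= in_itv /= !ltW.
  by apply: pb => //; rewrite (le_trans lv' (ltW vz)) (le_trans (ltW zw) wh').
rewrite /= in_itv /= => /andP[vt tw].
have [|_ bv vE] := bp t; first by rewrite (le_trans lv' vt) (le_trans tw wh').
rewrite tv in bv vE; have pv' := pb v' Fv' bv'.
have [E|vn] := eqVneq t (coord b v').
  by rewrite -tv E pv' // lv' (le_trans (ltW vw') wh').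
have [E|wn] := eqVneq t (coord b w).
  have vwE : v = w by rewrite -tv E pb // wh' (le_trans lv' (ltW vw')).
  by move: vw; rewrite vwE ltxx.
by have := nV' v vV bv; rewrite vE !lt_neqAle eq_sym vn wn vt tw.
Qed.

Lemma seq_argmin (T : eqType) (f : T -> R) (s : seq T) x : x \in s ->
  exists2 w, w \in s & forall y, y \in s -> f w <= f y.
Proof.
elim: s x => // x [|y s] IH z _; first by exists x => [|y]; rewrite inE // => /eqP ->.
have [w ws wmin] := IH y (mem_head _ _).
have [xw|wx] := leP (f x) (f w).
  exists x => [|u]; first exact: mem_head.
  by rewrite inE => /predU1P[->//|/wmin]; exact: le_trans.
exists w => [|u]; first by rewrite inE ws orbT.
by rewrite inE => /predU1P[->|/wmin //]; exact: ltW.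
Qed.

Lemma successor_exists (V : seq X) a v : arcs a -> (forall x, x \in V -> F x) ->
  v \in V -> region a v -> lo a <= coord a v < hi a -> point_at a (hi a) \in V ->
  exists2 w, w \in V & successor V v w.
Proof.
move=> aA VF vV av /andP[lv vh] hV; have [_ _ ap _ _] := arcsP aA.
pose cand := [seq w <- V | `[< region a w /\ coord a v < coord a w <= hi a >]].
have [|Fh ah hE] := ap (hi a); first by rewrite lexx (le_trans lv (ltW vh)).
have hc : point_at a (hi a) \in cand.
  by rewrite mem_filter hV andbT; apply/asboolP; rewrite hE lexx vh.
have [w + wmin] := seq_argmin (coord a) hc.
rewrite mem_filter => /andP[/asboolP[aw /andP[vw wh]] wV].
exists w => //; exists a => //; split; first by split=> //; exact: VF.
  by [].
move=> u uV au /andP[vu uw]; have := wmin u; rewrite leNgt uw => /(_ _)/negP; apply=> //.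
by rewrite mem_filter uV andbT; apply/asboolP; rewrite vu (le_trans (ltW uw) wh).
Qed.

(** If [x] were a source, put in [V] the point [x] and the ends of finitely many
   arcs that cover [F]: each element of [V] has a successor in [V], distinct
   elements have distinct successors, and [x] is not a successor. *)
Theorem no_source a x : arcs a -> F x -> region a x ->
  ~ (\forall y \near x, F y -> coord a x <= coord a y).
Proof.
move=> aA Fx ax source.
have [A AP] : {A : X -> arc & forall y, F y -> arcs (A y) /\
    \forall z \near y, F z -> region (A y) z /\ lo (A y) <= coord (A y) z < hi (A y)}.
  apply: (@choice _ _ (fun y b => F y -> arcs b /\
    \forall z \near y, F z -> region b z /\ lo b <= coord b z < hi b)) => y.
  have [Fy|nFy] := pselect (F y); last by exists a.
  by have [b bA h] := cover Fy; exists b.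
have [s sF scover] := compact_nbhs_cover compactF (fun y Fy => (AP y Fy).2).
pose V := x :: [seq point_at (A y) (hi (A y)) | y <- s].
have hiF y : F y -> F (point_at (A y) (hi (A y))).
  move=> Fy; have [Ay /nbhs_singleton/(_ Fy)[_ /andP[ly yh]]] := AP y Fy.
  have [_ _ ap _ _] := arcsP Ay.
  by have [|] := ap (hi (A y)); first by rewrite lexx (le_trans ly (ltW yh)).
have VF v : v \in V -> F v.
  by rewrite inE => /predU1P[->//|/mapP[y /sF Fy ->]]; exact: hiF.
have [nx nxP] : {nx : X -> X & forall v, v \in V -> nx v \in V /\ successor V v (nx v)}.
  apply: (@choice _ _ (fun v w => v \in V -> w \in V /\ successor V v w)) => v.
  have [vV|vV] := boolP (v \in V); last by exists v.
  have [y ys /(_ (VF v vV))[Av vI]] := scover v (VF v vV).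
  have [w wV nw] := successor_exists (AP y (sF y ys)).1 VF vV Av vI
    ltac:(by rewrite inE (map_f (fun y => point_at (A y) (hi (A y))) ys) orbT).
  by exists w.
have : x \in [seq nx v | v <- undup V].
  have u : uniq [seq nx v | v <- undup V].
    rewrite map_inj_in_uniq ?undup_uniq // => v v'; rewrite !mem_undup => vV v'V E.
    have [_ h] := nxP v vV; have [_ h'] := nxP v' v'V; rewrite E in h.
    exact: successor_inj vV v'V h h'.
  have sub : {subset [seq nx v | v <- undup V] <= undup V}.
    by move=> _ /mapP[v vV ->]; move: vV; rewrite !mem_undup => /nxP[].
  have [|_ ->] := uniq_min_size u sub; first by rewrite size_map.
  by rewrite mem_undup mem_head.
move=> /mapP[v]; rewrite mem_undup => /nxP[_ +] xE; rewrite -xE.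
move=> [b bA [[Fv _ bv bx] [lv vx xh] _]].
have near_x := @filterI _ _ (nbhs_filter x) _ _ source (coherent bA aA Fx bx ax).
have [z [Fz _ /andP[_ zx]] [h1 h2]] := arc_near_before bA Fv Fx bv bx lv vx xh near_x.
by have := h2 Fz zx; rewrite ltNge h1.
Qed.

End OrientedCurve.

(** * Matrices depending continuously on a parameter *)

Section ContinuousMatrix.
Variables (R : realType) (T : topologicalType) (x : T).

Definition mx_continuous (m n : nat) (f : T -> 'M[R]_(m, n)) : Prop :=
  forall i j, {for x, continuous (fun y => f y i j)}.

Lemma mx_continuous_ext (m n : nat) (f g : T -> 'M[R]_(m, n)) :
  f =1 g -> mx_continuous f -> mx_continuous g.
Proof. by move=> /funext ->. Qed.

Lemma mx_continuous_cst (m n : nat) (M : 'M[R]_(m, n)) : mx_continuous (fun=> M).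
Proof. by move=> i j; exact: cst_continuous. Qed.

Lemma mx_continuousD (m n : nat) (f g : T -> 'M[R]_(m, n)) :
  mx_continuous f -> mx_continuous g -> mx_continuous (fun y => f y + g y).
Proof.
move=> cf cg i j; rewrite (_ : (fun _ => _) = (fun y => f y i j + g y i j)).
  by apply: continuousD; [exact: cf|exact: cg].
by apply/funext => y; rewrite mxE.
Qed.

Lemma mx_continuousZ (m n : nat) (a : T -> R) (f : T -> 'M[R]_(m, n)) :
  {for x, continuous a} -> mx_continuous f -> mx_continuous (fun y => a y *: f y).
Proof.
move=> ca cf i j; rewrite (_ : (fun _ => _) = (fun y => a y * f y i j)).
  by apply: continuousM; [exact: ca|exact: cf].
by apply/funext => y; rewrite mxE.
Qed.

Lemma mx_continuousB (m n : nat) (f g : T -> 'M[R]_(m, n)) :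
  mx_continuous f -> mx_continuous g -> mx_continuous (fun y => f y - g y).
Proof.
move=> cf cg; apply: (@mx_continuous_ext _ _ (fun y => f y + (-1) *: g y)).
  by move=> y; rewrite scaleN1r.
by apply: mx_continuousD => //; apply: mx_continuousZ => //; exact: cst_continuous.
Qed.

Lemma mx_continuousM (m n p : nat) (f : T -> 'M[R]_(m, n)) (g : T -> 'M[R]_(n, p)) :
  mx_continuous f -> mx_continuous g -> mx_continuous (fun y => f y *m g y).
Proof.
move=> cf cg i j; rewrite (_ : (fun _ => _) = (fun y => \sum_k f y i k * g y k j)).
  rewrite /prop_for /continuous_at; apply: (cvg_big add_continuous) => k _.
  by apply: continuousM; [exact: cf|exact: cg].
by apply/funext => y; rewrite mxE.
Qed.

Lemma mx_continuous_block (m n p q : nat) (f : T -> 'M[R]_(m, n)) (g : T -> 'M[R]_(m, p))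
    (h : T -> 'M[R]_(q, n)) (k : T -> 'M[R]_(q, p)) :
  mx_continuous f -> mx_continuous g -> mx_continuous h -> mx_continuous k ->
  mx_continuous (fun y => block_mx (f y) (g y) (h y) (k y)).
Proof.
move=> cf cg ch ck i j.
case: (splitP i) => i' Ei; case: (splitP j) => j' Ej.
- have -> : i = lshift _ i' by exact/val_inj. have -> : j = lshift _ j' by exact/val_inj.
  by rewrite (_ : (fun _ => _) = (fun y => f y i' j')) //; apply/funext => y; rewrite block_mxEul.
- have -> : i = lshift _ i' by exact/val_inj. have -> : j = rshift _ j' by exact/val_inj.
  by rewrite (_ : (fun _ => _) = (fun y => g y i' j')) //; apply/funext => y; rewrite block_mxEur.
- have -> : i = rshift _ i' by exact/val_inj. have -> : j = lshift _ j' by exact/val_inj.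
  by rewrite (_ : (fun _ => _) = (fun y => h y i' j')) //; apply/funext => y; rewrite block_mxEdl.
- have -> : i = rshift _ i' by exact/val_inj. have -> : j = rshift _ j' by exact/val_inj.
  by rewrite (_ : (fun _ => _) = (fun y => k y i' j')) //; apply/funext => y; rewrite block_mxEdr.
Qed.

Lemma mx_continuous_det (n : nat) (f : T -> 'M[R]_n) :
  mx_continuous f -> {for x, continuous (fun y => \det (f y))}.
Proof.
move=> cf; rewrite /prop_for /continuous_at; apply: (cvg_big add_continuous) => s _.
by apply: cvgM; [exact: cvg_cst|apply: (cvg_big mul_continuous) => i _; exact: cf].
Qed.

Lemma mx_continuous_trace (n : nat) (f : T -> 'M[R]_n) :
  mx_continuous f -> {for x, continuous (fun y => \tr (f y))}.
Proof.
move=> cf; rewrite /prop_for /continuous_at; apply: (cvg_big add_continuous) => i _.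
exact: cf.
Qed.

Lemma continuous_near_gt0 (f : T -> R) : {for x, continuous f} -> 0 < f x ->
  \forall y \near x, 0 < f y.
Proof.
move=> cf f0; apply: (cf (fun t => 0 < t)).
by apply: open_nbhs_nbhs; split => //; exact: open_gt.
Qed.

End ContinuousMatrix.

Section NearbyAxis.
Variables (R : realType) (T : topologicalType) (x : T) (m k : nat).
Variables (D : T -> 'M[R]_m) (J : T -> 'M[R]_(m + k)).
Hypotheses (cD : mx_continuous x D) (cJ : mx_continuous x J).

(** The dimension of the fixed space of an involution is read off its trace, so it
   is locally constant. *)
Lemma half_turn_near : D x *m D x = 1%:M ->
  \forall y \near x, D y *m D y = 1%:M -> half_turn (D y) <-> half_turn (D x).
Proof.
move=> DDx; have /cvgrPdist_lt/(_ 1 ltr01) := mx_continuous_trace cD.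
apply: filterS => y tr1 DDy; have := tr1.
rewrite !mxtrace_involution // opprB addrA subrK -mulrBr normrM ger0_norm // => h.
suff rE : \rank (1%:M + D x)%R = \rank (1%:M + D y)%R by rewrite /half_turn rE; split=> -[].
move: (\rank (1%:M + D x)%R) (\rank (1%:M + D y)%R) h => a b h.
have h1 : a%:R < b.+1%:R :> R by rewrite -natr1; have := ler_norm (a%:R - b%:R : R); lra.
have h2 : b%:R < a.+1%:R :> R.
  by rewrite -natr1; have := ler_norm (- (a%:R - b%:R) : R); rewrite normrN; lra.
by move: h1 h2; rewrite !ltr_nat !ltnS => h1 h2; apply/eqP; rewrite eqn_leq h1.
Qed.

(** The projection of [e] on the axis of [D y], rescaled, depends continuously on
   [y], hence so does the complex structure that [J y] induces. *)
Lemma positive_axis_near (e : 'rV[R]_m) (l : 'cV[R]_m) :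
  half_turn (D x) -> e *m D x = e -> e *m l = 1%:M ->
  J x *m J x = - 1%:M -> J x *m stab k (D x) = stab k (D x) *m J x ->
  \forall y \near x, half_turn (D y) -> J y *m J y = - 1%:M ->
    J y *m stab k (D y) = stab k (D y) *m J y ->
    exists e', [/\ e' *m D y = e', e' *m l = 1%:M &
      positive (J x) e <-> positive (J y) e'].
Proof.
move=> hD eD el JJ JD.
pose s (y : T) : R := ((e *m (1%:M + D y)) *m l) 0 0.
pose e' y := (s y)^-1 *: (e *m (1%:M + D y)).
pose K y := axis_mx (J y) (e' y) l.
have c1 : mx_continuous x (fun y => e *m (1%:M + D y)).
  by apply: mx_continuousM; [exact: mx_continuous_cst|apply: mx_continuousD => //;
    exact: mx_continuous_cst].
have cs : {for x, continuous s}.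
  by have /(_ 0 0) := mx_continuousM c1 (@mx_continuous_cst R T x _ _ l).
have sx : s x = 2.
  by rewrite /s mulmxDr mulmx1 eD mulmxDl el !mxE.
have s0 : 0 < s x by rewrite sx.
have ce : mx_continuous x e'.
  apply: mx_continuousZ => //; apply: continuousV => //; exact: lt0r_neq0.
have e'x : e' x = e.
  by rewrite /e' sx mulmxDr mulmx1 eD -mulr2n -[e *+ 2]scaler_nat scalerA mulVf ?scale1r.
have cK : mx_continuous x K.
  apply: mx_continuousM; last exact: mx_continuous_cst.
  apply: mx_continuousM => //; apply: mx_continuous_block => //; exact: mx_continuous_cst.
have Kx : K x = axis_mx (J x) e l by rewrite /K e'x.
have KK : K x *m K x = - 1%:M.
  by rewrite Kx; apply: axis_mx_sqr el JJ (frame_axis_mx hD eD el JD).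
have det2 : 0 < \det (1%:M - K x *m K x).
  by rewrite KK opprK -raddfD /= det_scalar exprn_gt0.
have n1 : \forall y \near x, 0 < \det (1%:M - K x *m K y).
  apply: (@continuous_near_gt0 R T x (fun y => \det (1%:M - K x *m K y)) _ det2); apply: mx_continuous_det; apply: mx_continuousB.
    exact: mx_continuous_cst.
  by apply: mx_continuousM => //; exact: mx_continuous_cst.
have n2 : \forall y \near x, 0 < \det (1%:M - K y *m K x).
  apply: (@continuous_near_gt0 R T x (fun y => \det (1%:M - K y *m K x)) _ det2); apply: mx_continuous_det; apply: mx_continuousB.
    exact: mx_continuous_cst.
  by apply: mx_continuousM => //; exact: mx_continuous_cst.
have n3 := continuous_near_gt0 cs s0.
apply: filterS (filterI n1 (filterI n2 n3)) => y [d1 [d2 sy]] hDy JJy JDy.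
have e'D : e' y *m D y = e' y.
  rewrite /e' -scalemxAl -mulmxA mulmxDl mul1mx.
  by have [-> _] := hDy; rewrite [D y + _]addrC.
have e'l : e' y *m l = 1%:M.
  by rewrite /e' -scalemxAl [_ *m l]mx11_scalar scale_scalar_mx mulVf // gt_eqF.
exists (e' y); split=> //; split.
  by apply: (positive_near hD eD el hDy e'D e'l JJ JJy JD JDy); rewrite -Kx.
by apply: (positive_near hDy e'D e'l hD eD el JJy JJ JDy JD); rewrite -Kx.
Qed.

Lemma axis_near_matrix (e : 'rV[R]_m) (l : 'cV[R]_m) :
  D x *m D x = 1%:M -> J x *m J x = - 1%:M -> J x *m stab k (D x) = stab k (D x) *m J x ->
  \forall y \near x, D y *m D y = 1%:M -> J y *m J y = - 1%:M ->
    J y *m stab k (D y) = stab k (D y) *m J y ->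
    (half_turn (D y) <-> half_turn (D x)) /\
    (half_turn (D x) -> e *m D x = e -> e *m l = 1%:M ->
      exists e', [/\ e' *m D y = e', e' *m l = 1%:M &
        positive (J x) e <-> positive (J y) e']).
Proof.
move=> DD JJ JD; have n1 := half_turn_near DD.
have [[hD [eD el]]|N] := pselect (half_turn (D x) /\ e *m D x = e /\ e *m l = 1%:M).
  have n2 := positive_axis_near hD eD el JJ JD.
  apply: filterS (filterI n1 n2) => y [h1 h2] DDy JJy JDy; split; first exact: h1.
  by move=> _ _ _; apply: h2 => //; apply/(h1 DDy).
apply: filterS n1 => y h1 DDy JJy JDy; split; first exact: h1.
by move=> hD eD el; case: N.
Qed.

End NearbyAxis.

(** * Differentials of maps between manifolds in charts *)

Section Charts.
Variables (R : realType) (n : nat) (H : set 'rV[R]_n) (X : manifold H).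
Implicit Types (c : chart R n X) (x : X).

Lemma chart_dom_nbhs c x : atlas c -> dom c x -> nbhs x (dom c).
Proof. by move=> /atlas_chart[[oc _] _ _ _ _] cx; exact: open_nbhs_nbhs. Qed.

Lemma chartK c x : atlas c -> dom c x -> bwd c (fwd c x) = x.
Proof. by move=> /atlas_chart[_ h _ _ _] /h[]. Qed.

Lemma chart_model c x : atlas c -> dom c x -> H (fwd c x).
Proof.
by move=> /atlas_chart[[_ [G _ GE]] h _ _ _] /h[+ _]; rewrite GE => -[].
Qed.

Lemma chart_fwd_continuous c x : atlas c -> dom c x -> {for x, continuous (fwd c)}.
Proof.
move=> /atlas_chart[[oc _] _ _ cf _] cx.
by move: cf; rewrite continuous_open_subspace //; apply; rewrite inE.
Qed.

Lemma chart_near c x (P : 'rV[R]_n -> Prop) : atlas c -> dom c x ->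
  (\forall y \near fwd c x, P y) -> \forall z \near x, dom c z /\ P (fwd c z).
Proof.
move=> cA cx Px; apply: filterI; first exact: chart_dom_nbhs.
exact: chart_fwd_continuous cA cx P Px.
Qed.

(** Continuity of the inverse of a chart, relatively to the model [H]. *)
Lemma chart_bwd_near c x (N : set X) : atlas c -> dom c x -> nbhs x N ->
  \forall y \near fwd c x, H y -> [/\ dom c (bwd c y), fwd c (bwd c y) = y & N (bwd c y)].
Proof.
move=> aA cx Nx; have [[_ [G oG GE]] h h' _ cb] := atlas_chart aA.
have [cy yx] := h x cx.
have n1 : nbhs (fwd c x) G by apply: open_nbhs_nbhs; split=> //; move: cy; rewrite GE => -[].
have Nx' : nbhs (bwd c (fwd c x)) N by rewrite yx.
have n2 := (subspace_continuousP _ _).1 cb _ cy N Nx'.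
apply: filterS (filterI n1 n2) => y [Gy Ny] Hy.
have cdy : cod c y by rewrite GE.
by have [? ?] := h' y cdy; split=> //; exact: Ny.
Qed.

End Charts.

Section TangentMap.
Variables (R : realType) (n m : nat) (H : set 'rV[R]_n) (K : set 'rV[R]_m).
Variables (X : manifold H) (Y : manifold K).
Hypothesis oH : orthant_stable H.

Lemma smooth_at_jacobian (f : 'rV[R]_n -> 'rV[R]_m) (y : 'rV[R]_n) :
  smooth_at H f y -> exists D, has_jacobian H f y D.
Proof. by move=> [g gE]; exists (jacobian g y), g. Qed.

Lemma smooth_map_tangent (f : X -> Y) c d x : smooth_map f ->
  atlas c -> atlas d -> dom c x -> dom d (f x) -> exists D, tangent_map f c d x D.
Proof.
by move=> [_ sf] cA dA cx dx; have [D fD] := smooth_at_jacobian (sf c d x cA dA cx dx);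
  exists D.
Qed.

Lemma tangent_map_strict (f : X -> Y) c d x D : tangent_map f c d x D ->
  strict_deriv H (fwd d \o f \o bwd c) (fwd c x) D.
Proof. by move=> [_ _ _ _ /has_jacobian_strict_deriv]. Qed.

Lemma tangent_map_unique (f : X -> Y) c d x D D' :
  tangent_map f c d x D -> tangent_map f c d x D' -> D = D'.
Proof.
move=> fD /tangent_map_strict sD'; have [cA _ cx _ _] := fD.
exact: strict_deriv_unique oH (chart_model cA cx) (tangent_map_strict fD) sD'.
Qed.

End TangentMap.

Section TangentComposition.
Variables (R : realType) (n m p : nat).
Variables (H : set 'rV[R]_n) (K : set 'rV[R]_m) (L : set 'rV[R]_p).
Variables (X : manifold H) (Y : manifold K) (Z : manifold L).
Hypothesis oH : orthant_stable H.

Lemma tangent_map_comp_strict (f : X -> Y) (g : Y -> Z) c d e x D E :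
  {for x, continuous f} -> tangent_map f c d x D -> tangent_map g d e (f x) E ->
  strict_deriv H (fwd e \o (g \o f) \o bwd c) (fwd c x) (D *m E).
Proof.
move=> cf fD gE; have [cA dA cx dx _] := fD.
have nd := chart_bwd_near cA cx (cf _ (chart_dom_nbhs dA dx)).
apply: (@strict_deriv_sub _ _ _ H H _ ((fwd e \o g \o bwd d) \o (fwd d \o f \o bwd c))).
  by apply: filterS nd => y ynd Hy; have [_ _ dy] := ynd Hy; rewrite /= chartK.
apply: (strict_deriv_comp (chart_model cA cx) (B := K)).
- by apply: filterS nd => y ynd /ynd[_ _ dy]; exact: chart_model.
- exact: tangent_map_strict.
- by rewrite /= chartK //; exact: tangent_map_strict.
Qed.

Lemma tangent_map_comp (f : X -> Y) (g : Y -> Z) (h : X -> Z) c d e x D E G :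
  {for x, continuous f} -> h = g \o f ->
  tangent_map f c d x D -> tangent_map g d e (f x) E -> tangent_map h c e x G ->
  G = D *m E.
Proof.
move=> cf -> fD gE gfG; have [cA _ cx _ _] := fD.
apply: strict_deriv_unique oH (chart_model cA cx) (tangent_map_strict gfG) _.
exact: tangent_map_comp_strict fD gE.
Qed.

Lemma tangent_map_id c x D : tangent_map (idfun : X -> X) c c x D -> D = 1%:M.
Proof.
move=> iD; have [cA _ cx _ _] := iD.
apply: strict_deriv_unique oH (chart_model cA cx) (tangent_map_strict iD) _.
apply: (@strict_deriv_sub _ _ _ H H _ id) (strict_deriv_id H _).
apply: filterS (chart_bwd_near cA cx (chart_dom_nbhs cA cx)) => y h Hy.
by have [_ yE _] := h Hy.
Qed.

Lemma transition_tangent c d x : atlas c -> atlas d -> dom c x -> dom d x ->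
  exists A, tangent_map (idfun : X -> X) c d x A.
Proof.
by move=> cA dA cx dx; have [D fD] := smooth_at_jacobian (atlas_smooth cA dA cx dx);
  exists D.
Qed.

End TangentComposition.

Lemma transition_inv (R : realType) (n : nat) (H : set 'rV[R]_n) (X : manifold H) c d
    (x : X) A A' : orthant_stable H ->
  tangent_map (idfun : X -> X) c d x A -> tangent_map (idfun : X -> X) d c x A' ->
  A *m A' = 1%:M.
Proof.
move=> oH tA tA'; have [cA _ cx _ _] := tA.
have [G iG] := transition_tangent cA cA cx cx.
rewrite -(tangent_map_id oH iG); apply/esym.
exact: (tangent_map_comp oH (f := idfun) (g := idfun) _ _ tA tA' iG).
Qed.

Lemma involution_tangent (R : realType) (n : nat) (H : set 'rV[R]_n) (X : C2_manifold H) c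
    (x : X) D : orthant_stable H -> act x = x ->
  tangent_map (@act _ _ _ X) c c x D -> D *m D = 1%:M.
Proof.
move=> oH fx tD; have [cA _ cx _ _] := tD.
have [G iG] := transition_tangent cA cA cx cx.
rewrite -(tangent_map_id oH iG); apply/esym.
have tD' : tangent_map (@act _ _ _ X) c c (act x) D by rewrite fx.
have [ca _] := act_smooth X.
apply: (tangent_map_comp oH (ca x) _ tD tD' iG).
by apply/funext => y; rewrite /= act_involutive.
Qed.

Lemma fixed_transition (R : realType) (n : nat) (H : set 'rV[R]_n) (X : C2_manifold H) c d
    (x : X) D D' A : orthant_stable H -> act x = x ->
  tangent_map (@act _ _ _ X) c c x D -> tangent_map (@act _ _ _ X) d d x D' ->
  tangent_map (idfun : X -> X) c d x A -> A *m D' = D *m A.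
Proof.
move=> oH fx tD tD' tA; have [cA dA cx dx _] := tA.
have dfx : dom d (act x) by rewrite fx.
have [G tG] := smooth_map_tangent (act_smooth X) cA dA cx dfx.
have [ca _] := act_smooth X.
have tA' : tangent_map (idfun : X -> X) c d (act x) A by rewrite fx.
rewrite -(tangent_map_comp oH (ca x) _ tD tA' tG) //.
exact/esym/(tangent_map_comp oH (f := idfun) (g := @act _ _ _ X) _ _ tA tD' tG).
Qed.

(** * The oriented curve of isolated fixed directions *)

Lemma coaxis_exists (R : realType) (m : nat) (D : 'M[R]_m) (e : 'rV[R]_m) :
  D *m D = 1%:M -> e *m D = e -> e != 0 ->
  exists l : 'cV[R]_m, e *m l = 1%:M /\ D *m l = l.
Proof.
move=> DD eD e0; pose l0 := pinvmx e.
have el0 : e *m l0 = 1%:M.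
  apply: (row_free_inj (A := e)); first by rewrite /row_free rank_rV e0.
  by rewrite mul1mx mulmxKpV.
exists (2^-1 *: ((1%:M + D) *m l0)); split.
  rewrite -scalemxAr mulmxA mulmxDr mulmx1 eD mulmxDl el0 -mulr2n.
  by rewrite -[1%:M *+ 2]scaler_nat scalerA mulVf ?scale1r.
rewrite -scalemxAr mulmxA mulmxDr mulmx1 DD; congr (_ *: (_ *m _)); exact: addrC.
Qed.

Section FixedCurve.
Variables (R : realType) (n k : nat) (W : C2_manifold (halfspace R n)).
Variable J : chart R n.+1 W -> W -> 'M[R]_(n.+1 + k).
Local Notation H := (halfspace R n).
Local Notation tau := (@act _ _ _ W).
Hypotheses (cJ : complex_structure (@stab R k n.+1 n.+1) J)
  (eJ : compatible (@stab R k n.+1 n.+1) J tau).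
Let oH := @orthant_stable_halfspace R n.

(** [D] is the differential of the involution at the fixed point [x], a half-turn
   whose axis is positively oriented by [e]. *)
Definition axis (c : chart R n.+1 W) (x : W) (D : 'M[R]_n.+1) (e : 'rV[R]_n.+1) : Prop :=
  [/\ tangent_map tau c c x D, half_turn D, e *m D = e, e != 0 & positive (J c x) e].

Definition fixed_curve_set : set W :=
  [set x | act x = x /\ exists c D e, axis c x D e].

Lemma structure_sqr c x : atlas c -> dom c x -> J c x *m J c x = - 1%:M.
Proof. by case: cJ => h _ _; exact: h. Qed.

Lemma structure_fixed c x D : act x = x -> tangent_map tau c c x D ->
  J c x *m stab k D = stab k D *m J c x.
Proof. by move=> fx tD; rewrite (eJ tD) fx. Qed.

Lemma axis_chart c d x D e : act x = x -> axis c x D e -> atlas d -> dom d x ->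
  exists A D', [/\ tangent_map (idfun : W -> W) c d x A, axis d x D' (e *m A) &
    exists A', A *m A' = 1%:M].
Proof.
move=> fx [tD hD eD e0 pe] dA dx; have [cA _ cx _ _] := tD.
have [A tA] := transition_tangent cA dA cx dx.
have [A' tA'] := transition_tangent dA cA dx cx.
have AA' := transition_inv oH tA tA'.
have dfx : dom d (act x) by rewrite fx.
have [D' tD'] := smooth_map_tangent (act_smooth W) dA dA dx dfx.
have AD := fixed_transition oH fx tD tD' tA.
exists A, D'; split=> //; last by exists A'.
split=> //.
- exact: half_turn_conj AA' AD hD.
- by rewrite -mulmxA AD mulmxA eD.
- by apply: contraNneq e0 => eA; rewrite -(mulmx1 e) -AA' mulmxA eA mul0mx.
- by case: cJ => _ _ /(_ _ _ _ _ tA) JA; exact: positive_chart JA pe.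
Qed.

Lemma fixed_curve_axis c x : fixed_curve_set x -> atlas c -> dom c x ->
  exists D e, axis c x D e.
Proof.
by move=> [fx [d [D [e ax]]]] cA cx; have [A [D' [_ h _]]] := axis_chart fx ax cA cx;
  exists D', (e *m A).
Qed.

Lemma fixed_tangent_map c x : act x = x -> atlas c -> dom c x ->
  exists D, tangent_map tau c c x D.
Proof.
move=> fx cA cx; have cfx : dom c (act x) by rewrite fx.
exact: (smooth_map_tangent (act_smooth W) cA cA cx cfx).
Qed.

(** In a chart at [x] the differential of the involution and [J] extend to
   continuous functions, to which [axis_near_matrix] applies. *)
Lemma axis_near c x D (e : 'rV[R]_n.+1) (l : 'cV[R]_n.+1) : act x = x ->
  tangent_map tau c c x D ->
  \forall z \near x, act z = z -> forall D', tangent_map tau c c z D' ->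
    (half_turn D' <-> half_turn D) /\
    (half_turn D -> e *m D = e -> e *m l = 1%:M ->
      exists e', [/\ e' *m D' = e', e' *m l = 1%:M &
        positive (J c x) e <-> positive (J c z) e']).
Proof.
move=> fx tD; have [cA _ cx _ [g [U [oU Ux sg gE]] DE]] := tD.
have [_ sJ _] := cJ; have [h [V [oV Vx sh hE]]] := sJ c x cA cx.
pose y := fwd c x; have Hy : H y by exact: chart_model.
have Jy : J c x = h y by rewrite -hE //= chartK.
have cD : mx_continuous y (jacobian g).
  by move=> i j; exact: smooth_on_jacobian_continuous oU sg Ux.
have ch : mx_continuous y h by move=> i j; exact: (sh i j 0%N).
have tz z : act z = z -> dom c z -> U (fwd c z) ->
    tangent_map tau c c z (jacobian g (fwd c z)).
  move=> fz cz Uz; split; rewrite ?fz //.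
  exact: (ex_intro2 _ _ g (ex_intro _ U (And4 oU Uz sg gE)) erefl).
have DD : jacobian g y *m jacobian g y = 1%:M.
  by rewrite -DE; exact: involution_tangent oH fx tD.
have JJ : h y *m h y = - 1%:M by rewrite -Jy; exact: structure_sqr.
have JD : h y *m stab k (jacobian g y) = stab k (jacobian g y) *m h y.
  by rewrite -Jy -DE; exact: structure_fixed.
have n1 := axis_near_matrix cD ch e l DD JJ JD.
have n2 : \forall w \near y, U w /\ V w.
  by apply: (@filterI _ _ (nbhs_filter y)); exact: open_nbhs_nbhs.
have /(chart_near cA cx) := @filterI _ _ (nbhs_filter y) _ _ n2 n1.
apply: filterS => z [cz [[Uz Vz] h1]] fz D' tD'.
have tDz := tz z fz cz Uz; have D'E : D' = jacobian g (fwd c z) := tangent_map_unique oH tD' tDz.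
have Jz : J c z = h (fwd c z) by rewrite -hE //= ?chartK //; exact: chart_model.
have := h1; rewrite -D'E -Jz -DE -Jy; apply.
- exact: involution_tangent oH fz tD'.
- exact: structure_sqr.
- exact: structure_fixed fz tD'.
Qed.

Lemma closed_fixed : closed [set x : W | act x = x].
Proof.
move=> x clx; apply/esym/(@manifold_hausdorff _ _ _ W) => A B Ax Bx.
have [ca _] := act_smooth W.
have [z [fz [Az Bz]]] := clx _ (filterI Ax (ca x _ Bx)).
by exists z; split=> //; rewrite -fz.
Qed.

(** A limit [x] of points of the curve has an axis too, spanned by some [e], and
   one of [e] and [- e] is positive according to the direction of the positive
   vectors at nearby points of the curve. *)
Lemma fixed_curve_closed : closed fixed_curve_set.
Proof.
move=> x clx; have fx : act x = x.
  by apply: closed_fixed => B /clx[z [[fz _] Bz]]; exists z.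
split=> //; have [c cA cx] := atlas_cover x.
have [D tD] := fixed_tangent_map fx cA cx; have DD := involution_tangent oH fx tD.
have n0 := chart_dom_nbhs cA cx.
have hD : half_turn D.
  have [z [Fz [zn cz]]] := clx _ (filterI (axis_near 0 0 fx tD) n0).
  have [D' [e' [tD' hD' _ _ _]]] := fixed_curve_axis Fz cA cz.
  by have [[h _] _] := zn Fz.1 D' tD'; exact: h.
have [e e0 eD] : exists2 e : 'rV[R]_n.+1, e != 0 & e *m D = e.
  have [_ r1] := hD; have : (1%:M + D)%R != 0 by rewrite -mxrank_eq0 r1.
  move=> /rowV0Pn[v /submxP[u uE] v0]; exists v => //.
  by rewrite uE -mulmxA mulmxDl mul1mx DD addrC.
have [l [el Dl]] := coaxis_exists DD eD e0.
have n1 := axis_near e l fx tD; have n2 := axis_near (- e) (- l) fx tD.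
have [z [Fz [cz [h1 h2]]]] := clx _ (filterI n0 (filterI n1 n2)).
have [fz _] := Fz.
have [D' [e' [tD' hD' e'D' e'0 pe']]] := fixed_curve_axis Fz cA cz.
have [_ /(_ hD eD el)[e1 [e1D e1l pe1]]] := h1 fz D' tD'.
have [_ h3] := h2 fz D' tD'.
have [||e2 [e2D e2l pe2]] := h3 hD; first by rewrite mulNmx eD.
  by rewrite mulNmx mulmxN opprK.
have e'E := half_turn_fixed hD' e1D e1l e'D'.
set a := (e' *m l) 0 0 in e'E.
have a0 : a != 0 by apply: contraNneq e'0 => a0; rewrite e'E a0 scale0r.
have e2E : e2 = - e1.
  rewrite (half_turn_fixed hD' e1D e1l e2D) -scaleN1r; congr (_ *: _).
  move: e2l; rewrite mulmxN => /eqP; rewrite eqr_oppLR => /eqP ->.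
  by rewrite !mxE.
have [a_lt|a_gt] := ltP a 0.
  exists c, D, (- e); split=> //; rewrite ?mulNmx ?eD ?oppr_eq0 //.
  apply/pe2; rewrite e2E (_ : - e1 = (- a)^-1 *: e'); last first.
    by rewrite e'E scalerA invrN mulNr mulVf // scaleN1r.
  by apply: positiveZ => //; rewrite invr_gt0 oppr_gt0.
exists c, D, e; split=> //.
apply/pe1; rewrite (_ : e1 = a^-1 *: e'); last by rewrite e'E scalerA mulVf // scale1r.
by apply: positiveZ => //; rewrite invr_gt0 lt_neqAle eq_sym a0.
Qed.

Lemma fixed_curve_compact : compact fixed_curve_set.
Proof.
exact: subclosed_compact fixed_curve_closed (@manifold_compact _ _ _ W) _.
Qed.

End FixedCurve.

Section Coherence.
Variables (R : realType) (m p : nat).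

Lemma norm_coordinate (v : 'rV[R]_m) (l : 'cV[R]_m) : `|(v *m l) 0 0| <= op_bound l * `|v|.
Proof. exact: le_trans (norm_row_entry _ 0) (norm_mulmx _ _). Qed.

(** A vector close to the line of [e] is comparable with its coordinate. *)
Lemma norm_near_axis (h e : 'rV[R]_m) (a : R) :
  `|h - a *: e| <= 2^-1 * `|h| -> `|h| <= 2 * `|e| * `|a|.
Proof.
move=> ha; have := ler_normD (h - a *: e) (a *: e); rewrite subrK normrZ; nra.
Qed.

End Coherence.

(** A displacement [h] almost along [e] and in the direction opposite to [e] has, in
   another chart, a negative coordinate [l'] as soon as [l'] is positive on the
   image of [e] under the differential [A] of the change of charts. *)
Lemma coordinate_lt0 (R : realType) (m p : nat) (h e : 'rV[R]_m) (h' : 'rV[R]_p)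
    (A : 'M[R]_(m, p)) (l : 'cV[R]_m) (l' : 'cV[R]_p) (eps : R) :
  0 <= eps <= 2^-1 ->
  eps * (2 * `|e| * (op_bound l' + op_bound (A *m l'))) < (e *m A *m l') 0 0 ->
  `|h - (h *m l) 0 0 *: e| <= eps * `|h| -> `|h' - h *m A| <= eps * `|h| ->
  (h *m l) 0 0 < 0 -> (h' *m l') 0 0 < 0.
Proof.
move=> /andP[eps0 eps2] small he h'A; set a := (h *m l) 0 0 in he * => a0.
have hN : `|h| <= 2 * `|e| * `|a|.
  by apply: norm_near_axis; rewrite (le_trans he) // ler_wpM2r.
set lam := (e *m A *m l') 0 0 in small *.
set x := ((h' - h *m A) *m l') 0 0; set y := ((h - a *: e) *m (A *m l')) 0 0.
have -> : (h' *m l') 0 0 = x + y + a * lam.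
  have -> : h' *m l' = (h' - h *m A) *m l' + (h - a *: e) *m (A *m l') + a *: (e *m A *m l').
    by rewrite !mulmxBl !mulmxA -!scalemxAl addrA subrK subrK.
  by rewrite mxE [X in X + _]mxE [X in _ + X]mxE.
have h1 : x <= op_bound l' * (eps * `|h|).
  rewrite (le_trans (ler_norm _)) // (le_trans (norm_coordinate _ _)) //.
  by rewrite ler_wpM2l // ltW // op_bound_gt0.
have h2 : y <= op_bound (A *m l') * (eps * `|h|).
  rewrite (le_trans (ler_norm _)) // (le_trans (norm_coordinate _ _)) //.
  by rewrite ler_wpM2l // ltW // op_bound_gt0.
apply: (@le_lt_trans _ _ (eps * (op_bound l' + op_bound (A *m l')) * `|h| + a * lam)).
  by rewrite lerD2r (le_trans (lerD h1 h2)) // -mulrDl mulrA [_ * eps]mulrC.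
apply: (@le_lt_trans _ _ (eps * (op_bound l' + op_bound (A *m l')) * (2 * `|e| * `|a|) + a * lam)).
  by rewrite lerD2r ler_wpM2l // mulr_ge0 // addr_ge0 // ltW // op_bound_gt0.
rewrite (ltr0_norm a0).
have -> : eps * (op_bound l' + op_bound (A *m l')) * (2 * `|e| * - a) + a * lam =
   - a * (eps * (2 * `|e| * (op_bound l' + op_bound (A *m l'))) - lam) by ring.
by rewrite nmulr_llt0 ?subr_lt0 // oppr_gt0.
Qed.

Section FixedArcs.
Variables (R : realType) (n k : nat) (W : C2_manifold (halfspace R n)).
Variable J : chart R n.+1 W -> W -> 'M[R]_(n.+1 + k).
Local Notation H := (halfspace R n).
Local Notation tau := (@act _ _ _ W).
Local Notation F := (fixed_curve_set J).
Hypotheses (cJ : complex_structure (@stab R k n.+1 n.+1) J)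
  (eJ : compatible (@stab R k n.+1 n.+1) J tau).
Let oH := @orthant_stable_halfspace R n.

(** Near [w] the coordinate of [a] is a linear form in a chart, increasing in the
   direction of the oriented axis. *)
Definition adapted (a : arc R W) (w : W) : Prop :=
  exists c D e (l : 'cV[R]_n.+1), [/\ axis J c w D e, e *m l = 1%:M &
    \forall z \near w, coord a z - coord a w = ((fwd c z - fwd c w) *m l) 0 0].

Definition fixed_arcs : set (arc R W) :=
  [set a | is_arc F a /\ forall w, F w -> region a w -> adapted a w].

Lemma fixed_tangent_near c x D (e : 'rV[R]_n.+1) l (eps : R) : act x = x ->
  tangent_map tau c c x D ->
  half_turn D -> e *m D = e -> e *m l = 1%:M -> 0 < eps ->
  \forall z \near x, act z = z ->
    `|(fwd c z - fwd c x) - ((fwd c z - fwd c x) *m l) 0 0 *: e| <= eps * `|fwd c z - fwd c x|.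
Proof.
move=> fx tD hD eD el eps0; have [cA _ cx _ _] := tD.
have [d d0 h] := fixed_tangent (tangent_map_strict tD) hD eD el eps0.
have nd : \forall y \near fwd c x, `|fwd c x - y| < d.
  by apply/nbhs_normP; exists d.
have := chart_near cA cx nd; apply: filterS => z [cz zd] fz; apply: h.
- exact: chart_model.
- exact: chart_model.
- by rewrite distrC.
- by rewrite subrr normr0.
- by rewrite /= chartK // fz.
- by rewrite /= chartK // fx.
Qed.

(** Changing charts takes positive vectors of the axis at [w] to positive ones, so
   both coordinates increase in the same direction. *)
Lemma fixed_arcs_coherent a b w : fixed_arcs a -> fixed_arcs b -> F w ->
  region a w -> region b w ->
  \forall z \near w, F z -> coord a z < coord a w -> coord b z < coord b w.
Proof.
move=> [_ Aa] [_ Ab] Fw aw bw; have [fw _] := Fw.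
have [c [D [e [l [ax el ca]]]]] := Aa w Fw aw.
have [c' [D' [e' [l' [ax' el' cb]]]]] := Ab w Fw bw.
have [tD hD eD e0 pe] := ax; have [tD' hD' eD' e0' pe'] := ax'.
have [cA _ cw _ _] := tD; have [cA' _ cw' _ _] := tD'.
have [A [D'' [tA [tD'' _ eAD eA0 peA] _]]] := axis_chart cJ fw ax cA' cw'.
have D''E := tangent_map_unique oH tD'' tD'; rewrite D''E in eAD.
have eAE := half_turn_fixed hD' eD' el' eAD; set lam := (_ *m l') 0 0 in eAE.
have lam0 : lam != 0 by apply: contraNneq eA0 => lam0; rewrite eAE lam0 scale0r.
have lam_gt0 : 0 < lam.
  have JJ := structure_sqr cJ cA' cw'.
  by apply: (positive_sign JJ el' lam0 pe'); rewrite -eAE.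
pose Q := 2 * `|e| * (op_bound l' + op_bound (A *m l')) + 1.
have Q0 : 0 < Q.
  by rewrite ltr_wpDl // mulr_ge0 ?mulr_ge0 // addr_ge0 // ltW // op_bound_gt0.
pose eps := Num.min 2^-1 (lam / Q / 2).
have eps0 : 0 < eps by rewrite lt_min invr_gt0 ltr0n !divr_gt0.
have eps_le : 0 <= eps <= 2^-1 by rewrite (ltW eps0) ge_min lexx.
have eps_small : eps * (2 * `|e| * (op_bound l' + op_bound (A *m l'))) < lam.
  apply: (@lt_le_trans _ _ (eps * Q)); first by rewrite ltr_pM2l // ltrDl.
  rewrite -ler_pdivlMr // (@le_trans _ _ (lam / Q / 2)) ?ge_min ?lexx ?orbT //.
  by rewrite ler_pdivrMr // ler_peMr ?ler1n // ltW // divr_gt0.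
have n1 := fixed_tangent_near fw tD hD eD el eps0.
have [d d0 hd] := tangent_map_strict tA eps0.
have nd : \forall y \near fwd c w, `|fwd c w - y| < d by apply/nbhs_normP; exists d.
have n2 := chart_near cA cw nd.
apply: filterS (filterI n1 (filterI n2 (filterI ca cb))) => z [h1 [[cz zd] [za zb]]] Fz.
rewrite -subr_lt0 za -[coord b z < _]subr_lt0 zb.
apply: (coordinate_lt0 (A := A) eps_le eps_small); first by apply: h1; case: Fz.
have := hd (fwd c z) (fwd c w); rewrite /= !chartK //; apply.
- exact: chart_model.
- exact: chart_model.
- by rewrite distrC.
- by rewrite subrr normr0.
Qed.

End FixedArcs.

Section ArcExistence.
Variables (R : realType) (n k : nat) (W : C2_manifold (halfspace R n)).
Variable J : chart R n.+1 W -> W -> 'M[R]_(n.+1 + k).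
Local Notation H := (halfspace R n).
Local Notation tau := (@act _ _ _ W).
Local Notation F := (fixed_curve_set J).
Hypotheses (cJ : complex_structure (@stab R k n.+1 n.+1) J)
  (eJ : compatible (@stab R k n.+1 n.+1) J tau).
Let oH := @orthant_stable_halfspace R n.

Lemma coordinateB (a b y : 'rV[R]_n.+1) (l : 'cV[R]_n.+1) :
  ((a - y) *m l) 0 0 - ((b - y) *m l) 0 0 = ((a - b) *m l) 0 0.
Proof.
have -> : a - b = (a - y) - (b - y) by rewrite opprB addrA subrK.
by rewrite (mulmxBl (a - y)) [RHS]mxE [X in _ = _ + X]mxE.
Qed.

(** Points of the half-space near a boundary point lie on the inner side, and the
   curve is tangent there to the inward vector [e]. *)
Lemma inward_coordinate c x D (e : 'rV[R]_n.+1) l : act x = x -> axis J c x D e ->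
  e *m l = 1%:M -> fwd c x 0 0 = 0 -> 0 < e 0 0 ->
  \forall z \near x, F z -> 0 <= ((fwd c z - fwd c x) *m l) 0 0.
Proof.
move=> fx [tD hD eD _ _] el x0 e0; have [cA _ cx _ _] := tD.
pose Q := 2 * `|e| + 1; have Q0 : 0 < Q by rewrite ltr_wpDl // mulr_ge0.
pose eps := Num.min 2^-1 (e 0 0 / Q / 2).
have eps0 : 0 < eps by rewrite lt_min invr_gt0 ltr0n !divr_gt0.
have eps_small : eps * (2 * `|e|) < e 0 0.
  apply: (@lt_le_trans _ _ (eps * Q)); first by rewrite ltr_pM2l // ltrDl.
  rewrite -ler_pdivlMr // (@le_trans _ _ (e 0 0 / Q / 2)) ?ge_min ?lexx ?orbT //.
  by rewrite ler_pdivrMr // ler_peMr ?ler1n // ltW // divr_gt0.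
have n1 := fixed_tangent_near fx tD hD eD el eps0.
apply: filterS (filterI (chart_dom_nbhs cA cx) n1) => z [cz h1] [fz _].
have {h1} := h1 fz; set h := fwd c z - fwd c x; set a := (h *m l) 0 0 => ha.
rewrite leNgt; apply/negP => a0.
have hN : `|h| <= 2 * `|e| * `|a|.
  by apply: norm_near_axis; rewrite (le_trans ha) // ler_wpM2r // ge_min lexx.
have h0 : 0 <= h 0 0 by rewrite /h !mxE x0 subr0; exact: (chart_model cA cz).
have := le_trans (ler_norm _) (le_trans (norm_row_entry (h - a *: e) 0) ha).
have -> : (h - a *: e) 0 0 = h 0 0 - a * e 0 0 by rewrite !mxE.
have := ler_wpM2l (ltW eps0) hN; rewrite (ltr0_norm a0).
have : 0 < - a * (e 0 0 - eps * (2 * `|e|)) by rewrite mulr_gt0 ?oppr_gt0 ?subr_gt0.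
lra.
Qed.

Lemma involution_in_chart c x : act x = x -> atlas c -> dom c x ->
  \forall y \near fwd c x, H y -> H ((fwd c \o tau \o bwd c) y) /\
    (fwd c \o tau \o bwd c) ((fwd c \o tau \o bwd c) y) = y.
Proof.
move=> fx cA cx; have [ctau _] := act_smooth W.
have ndom : \forall z \near x, dom c (tau z).
  by apply: (ctau x); rewrite fx; exact: chart_dom_nbhs.
apply: filterS (chart_bwd_near cA cx ndom) => y hy Hy; have [cy fy cty] := hy Hy.
by split; [exact: chart_model|rewrite /= chartK // act_involutive].
Qed.

Lemma axis_near_bwd c x D (e : 'rV[R]_n.+1) l : act x = x -> axis J c x D e ->
  e *m l = 1%:M ->
  \forall z \near x, act z = z -> exists D' e', axis J c z D' e' /\ e' *m l = 1%:M.
Proof.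
move=> fx [tD hD eD _ pe] el; have [cA _ cx _ _] := tD.
apply: filterS (filterI (chart_dom_nbhs cA cx) (axis_near cJ eJ e l fx tD)) => z [cz h] fz.
have [D' tD'] := fixed_tangent_map fz cA cz.
have [hD' /(_ hD eD el)[e' [e'D e'l pe']]] := h fz D' tD'.
exists D', e'; split=> //; split=> //.
- exact/hD'.
- by apply/eqP => e'0; move: e'l; rewrite e'0 mul0mx => /matrixP/(_ 0 0)/eqP;
    rewrite !mxE eqxx eq_sym oner_eq0.
- exact/pe'.
Qed.

(** The fixed points near [x] are parametrised by their coordinate [l] along the
   axis: [fixed_curve_exists] provides them and [fixed_tangent] makes them unique
   and dependent on the coordinate in a Lipschitz way.  The boolean [interior] tells
   whether the arc extends on both sides of [x]. *)
Lemma fixed_arc_at (interior : bool) c x D (e : 'rV[R]_n.+1) :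
  act x = x -> axis J c x D e ->
  (exists2 r : R, 0 < r & forall t (q : 'rV[R]_n.+1), [set t | interior || (0 <= t)] t ->
    `|t| <= r -> q *m D = - q -> `|q| <= r -> H (fwd c x + t *: e + q)) ->
  (~~ interior -> fwd c x 0 0 = 0 /\ 0 < e 0 0) ->
  exists a, [/\ fixed_arcs J a, region a x,
    \forall z \near x, F z -> region a z /\ lo a <= coord a z < hi a &
    ~~ interior -> \forall z \near x, F z -> coord a x <= coord a z].
Proof.
move=> fx ax room bd; have [tD hD eD e0 pe] := ax; have [cA _ cx _ _] := tD.
have DD := involution_tangent oH fx tD.
have [l [el Dl]] := coaxis_exists DD eD e0.
pose t' := fwd c \o tau \o bwd c; pose y0 := fwd c x.
have [ctau _] := act_smooth W.
have Hy0 : H y0 := chart_model cA cx.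
have ty0 : t' y0 = y0 by rewrite /t' /= chartK // fx.
pose good z := dom c (tau z) /\
  (act z = z -> exists D' e', axis J c z D' e' /\ e' *m l = 1%:M).
have ngood : \forall z \near x, good z.
  apply: filterI; last exact: axis_near_bwd fx ax el.
  by apply: (ctau x); rewrite fx; exact: chart_dom_nbhs.
have nb := chart_bwd_near cA cx ngood.
have invol := involution_in_chart fx cA cx.
have [d1 /= d10 hd1] := (nbhs_normP _ _).1 nb.
have half0 : 0 < 2^-1 :> R by rewrite invr_gt0 ltr0n.
have [d2 d20 hd2] := fixed_tangent (tangent_map_strict tD) hD eD el half0.
pose d := Num.min d1 d2; have d0 : 0 < d by rewrite lt_min d10.
have near1 y : `|y - y0| < d -> H y ->
    [/\ dom c (bwd c y), fwd c (bwd c y) = y & good (bwd c y)].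
  by rewrite lt_min => /andP[yd _]; apply: hd1; rewrite /= distrC.
have near2 y z : H y -> H z -> `|y - y0| < d -> `|z - y0| < d -> t' y = y -> t' z = z ->
    `|y - z| <= 2 * `|e| * `|((y - z) *m l) 0 0|.
  move=> Hy Hz; rewrite !lt_min => /andP[_ yd] /andP[_ zd] ty tz.
  by apply: norm_near_axis; exact: hd2.
have [r r0 hr] := fixed_curve_exists (tangent_map_strict tD) hD eD el Hy0 ty0 Dl invol room d0.
pose lo0 := if interior then - r else 0.
have loP t : lo0 <= t <= r -> [set t | interior || (0 <= t)] t /\ `|t| <= r.
  rewrite /lo0 /=; case: interior {room bd lo0 hr} => /andP[t0 tr]; split=> //.
    by rewrite ler_norml t0.
  by rewrite ger0_norm.
have [Y hY] : {Y : R -> 'rV[R]_n.+1 & forall t, lo0 <= t <= r ->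
    [/\ H (Y t), `|Y t - y0| < d, t' (Y t) = Y t & ((Y t - y0) *m l) 0 0 = t]}.
  apply: (@choice _ _ (fun t y => lo0 <= t <= r ->
    [/\ H y, `|y - y0| < d, t' y = y & ((y - y0) *m l) 0 0 = t])) => t.
  have [/loP[Tt tr]|N] := boolP (lo0 <= t <= r); last by exists 0.
  by have [y yP] := hr t Tt tr; exists y.
have fixed_bwd y : H y -> `|y - y0| < d -> t' y = y -> act (bwd c y) = bwd c y.
  move=> Hy yd; have [cy fy [cty _]] := near1 y yd Hy.
  by move=> ty; rewrite -[LHS](chartK cA cty) -[fwd c _]/(t' y) ty.
have good_F y : H y -> `|y - y0| < d -> t' y = y -> F (bwd c y).
  move=> Hy yd ty; have [cy fy [_ ex]] := near1 y yd Hy.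
  have fb := fixed_bwd y Hy yd ty; split=> //.
  by have [D' [e' [ax' _]]] := ex fb; exists c, D', e'.
have fixed_fwd z : act z = z -> dom c z -> t' (fwd c z) = fwd c z.
  by move=> fz cz; rewrite /t' /= chartK // fz.
pose reg : set W := dom c `&` [set z | `|fwd c z - y0| < d].
pose co (z : W) : R := ((fwd c z - y0) *m l) 0 0.
have reg_nbhs z : reg z -> nbhs z reg.
  move=> [cz zd]; have : \forall y \near fwd c z, `|y - y0| < d.
    apply/nbhs_normP; exists (d - `|fwd c z - y0|); first by rewrite /= subr_gt0.
    move=> y /=; rewrite ltrBrDr distrC => yz; apply: le_lt_trans yz.
    by rewrite (le_trans (ler_distD (fwd c z) _ _)).
  by move=> /(chart_near cA cz).
have co_continuous z : dom c z -> {for z, continuous co}.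
  move=> cz; apply: (@continuous_comp _ _ _ (fwd c) (fun y => ((y - y0) *m l) 0 0)).
    exact: chart_fwd_continuous.
  have : mx_continuous (fwd c z) (fun y => (y - y0) *m l).
    apply: mx_continuousM; last exact: mx_continuous_cst.
    apply: mx_continuousB; last exact: mx_continuous_cst.
    by move=> i j; exact: coord_continuous.
  by move=> /(_ 0 0).
have Y_continuous : {within `[lo0, r], continuous Y}.
  apply: (@lipschitz_within_continuous _ _ _ _ _ (2 * `|e|)) => s t.
  rewrite /= !in_itv /= => sI tI.
  have [Hs sd ts sE] := hY s sI; have [Ht td tt tE] := hY t tI.
  have := near2 _ _ Hs Ht sd td ts tt.
  by rewrite -(coordinateB _ _ y0) sE tE.
pose a := Arc reg co (bwd c \o Y) lo0 r.
have Ex : co x = 0 by rewrite /co subrr mul0mx mxE.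
have regx : reg x by split=> //; rewrite /= subrr normr0.
exists a; split=> //.
- split.
    split=> /=.
    + by rewrite openE => z /reg_nbhs.
    + by move=> z [cz _]; exact: co_continuous.
    + move=> t tI; have [Ht td tt tE] := hY t tI.
      have [cy fy _] := near1 _ td Ht; split; first exact: good_F.
        by split=> //=; rewrite fy.
      by rewrite /co /= fy.
    + apply/subspace_continuousP => t tI N Nt.
      have tI' : lo0 <= t <= r by move: tI; rewrite /= in_itv.
      have [Ht td tt tE] := hY t tI'; have [cy fy _] := near1 _ td Ht.
      have := chart_bwd_near cA cy Nt; rewrite fy => nN.
      have nY : \forall s \near t, `[lo0, r]%classic s -> H (Y s) ->
          [/\ dom c (bwd c (Y s)), fwd c (bwd c (Y s)) = Y s & N (bwd c (Y s))].
        exact: (subspace_continuousP _ _).1 Y_continuous t tI _ nN.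
      change (\forall s \near t, `[lo0, r]%classic s -> N (bwd c (Y s))).
      apply: filterS nY => s h sI; have sI' : lo0 <= s <= r by move: sI; rewrite /= in_itv.
      by have [Hs _ _ _] := hY s sI'; have [_ _] := h sI Hs.
    + move=> z Fz [cz zd] zI /=; have [Hs sd ts sE] := hY _ zI.
      have [fz _] := Fz; have Hz := chart_model cA cz.
      rewrite -[RHS](chartK cA cz); congr (bwd c _); apply/eqP.
      rewrite -subr_eq0 -normr_le0.
      have := near2 _ _ Hs Hz sd zd ts (fixed_fwd z fz cz).
      by rewrite -(coordinateB _ _ y0) sE /co subrr normr0 mulr0.
  move=> w Fw [cw wd]; have [fw _] := Fw; have Hw := chart_model cA cw.
  have [_ _ [_]] := near1 _ wd Hw; rewrite chartK // => /(_ fw)[D' [e' [ax' e'l]]].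
  exists c, D', e', l; split=> //; apply: (@nearW _ _ _ (nbhs_filter w)) => z /=.
  exact: coordinateB.
- have n1 : \forall z \near x, `|co z| < r.
    apply: (co_continuous x cx (fun t => `|t| < r)); rewrite Ex; apply/nbhs_normP.
    by exists r => // t /=; rewrite sub0r normrN.
  have n2 : \forall z \near x, F z -> lo0 <= co z.
    rewrite /lo0; case: interior bd {room lo0 hr loP hY Y_continuous a} => bd.
      by apply: filterS n1 => z; rewrite ltr_norml => /andP[/ltW].
    by have [x0 e_gt0] := bd isT; exact: inward_coordinate fx ax el x0 e_gt0.
  apply: filterS (filterI (reg_nbhs x regx) (filterI n1 n2)) => z [rz [zr zlo]] Fz.
  by split=> //=; rewrite zlo // (le_lt_trans (ler_norm _)).
- move=> /bd[x0 e_gt0] /=; rewrite Ex; exact: inward_coordinate fx ax el x0 e_gt0.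
Qed.

End ArcExistence.

Section Sources.
Variables (R : realType) (n k : nat) (W : C2_manifold (halfspace R n)).
Variable J : chart R n.+1 W -> W -> 'M[R]_(n.+1 + k).
Local Notation H := (halfspace R n).
Local Notation tau := (@act _ _ _ W).
Local Notation F := (fixed_curve_set J).
Hypotheses (cJ : complex_structure (@stab R k n.+1 n.+1) J)
  (eJ : compatible (@stab R k n.+1 n.+1) J tau).
Hypothesis inward : forall c x D e, act x = x -> axis J c x D e -> fwd c x 0 0 = 0 ->
  0 < e 0 0.

Lemma boundary_arc c x : F x -> atlas c -> dom c x -> fwd c x 0 0 = 0 ->
  exists a, [/\ fixed_arcs J a, region a x,
    \forall z \near x, F z -> region a z /\ lo a <= coord a z < hi a &
    \forall z \near x, F z -> coord a x <= coord a z].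
Proof.
move=> Fx cA cx x0; have [fx _] := Fx; have [D [e ax]] := fixed_curve_axis cJ Fx cA cx.
have e0 := inward fx ax x0; have [tD _ _ _ _] := ax.
have tx : (fwd c \o tau \o bwd c) (fwd c x) = fwd c x by rewrite /= chartK // fx.
have room := room_boundary (tangent_map_strict tD) tx
  (involution_in_chart fx cA cx) x0 e0.
have [a [? ? ? h]] := @fixed_arc_at _ _ _ _ _ cJ eJ false c x D e fx ax room (fun _ => conj x0 e0).
by exists a; split=> //; exact: h.
Qed.

Lemma fixed_arcs_cover x : F x -> exists2 a, fixed_arcs J a &
  \forall z \near x, F z -> region a z /\ lo a <= coord a z < hi a.
Proof.
move=> Fx; have [[c [cA cx x0]]|nbx] := pselect (boundary x).
  by have [a [? _ ? _]] := boundary_arc Fx cA cx x0; exists a.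
have [fx _] := Fx; have [c cA cx] := atlas_cover x.
have [D [e ax]] := fixed_curve_axis cJ Fx cA cx.
have x0 : 0 < fwd c x 0 0.
  rewrite lt_neqAle (chart_model cA cx) andbT; apply/eqP => x0.
  by apply: nbx; exists c.
have [r r0 room] := room_interior D e x0.
by have [a [? _ ? _]] := @fixed_arc_at _ _ _ _ _ cJ eJ true c x D e fx ax
  (ex_intro2 _ _ r r0 (fun t q _ => room t q Logic.I)) (fun h => False_ind _ (notF h));
  exists a.
Qed.

(** A boundary point of the curve would be a source. *)
Theorem no_boundary_source x : F x -> ~ boundary x.
Proof.
move=> Fx [c [cA cx x0]]; have [a [aA ax _ source]] := boundary_arc Fx cA cx x0.
have hW := @manifold_hausdorff _ _ _ W.
have cF := fixed_curve_compact cJ eJ.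
apply: (no_source hW cF (arcs := fixed_arcs J) _ fixed_arcs_cover _ aA Fx ax source).
  by move=> b [].
exact: fixed_arcs_coherent.
Qed.

End Sources.

(** * Cobordisms *)

Section Boundary.
Variables (R : realType) (n k : nat).

Lemma restricts_to_frame (W : C2_manifold (halfspace R n))
    (J : chart R n.+1 W -> W -> 'M[R]_(n.+1 + k)) (M : complex_C2_manifold R n)
    (f : M -> W) (eps : R) c d x D :
  restricts_to J f eps -> tangent_map f c d x D -> exists nu : 'rV[R]_n.+1,
    0 < eps * nu 0 0 /\ frame k nu *m J d (f x) = std_J R (1 + k) *m frame k nu.
Proof.
move=> rf /rf[nu [nu0 E]]; exists nu; split=> //.
by move: E; rewrite mul_col_mx mul_block_col !mul0mx add0r => /eq_col_mx[].
Qed.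

(** The normal is [- J] times the first vector of [R^k], which the involution
   fixes. *)
Lemma normal_fixed (nu : 'rV[R]_n.+1) (J : 'M[R]_(n.+1 + k)) (D : 'M[R]_n.+1) :
  J *m J = - 1%:M -> J *m stab k D = stab k D *m J ->
  frame k nu *m J = std_J R (1 + k) *m frame k nu -> nu *m D = nu.
Proof.
move=> JJ JD FJ; pose X := frame k nu *m stab k D - frame k nu.
have XJ : X *m J = std_J R (1 + k) *m X.
  by rewrite mulmxBl mulmxBr -[frame k nu *m stab k D *m J]mulmxA -JD mulmxA FJ mulmxA.
have XE : X = block_mx (nu *m D - nu) 0 0 0.
  by rewrite /X frame_stab /frame opp_block_mx add_block_mx !subrr.
have : row (lshift k 0) X *m J = 0.
  rewrite -row_mul XJ; apply/rowP => j; rewrite !mxE big1 // => i _.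
  (* The first row of [std_J *m X] is the second row of [X], which vanishes; for
     [k = 0] there is no second row. *)
  rewrite mxE /=; case: (splitP i) => i' Ei.
    by rewrite ord1 in Ei; rewrite Ei /= mul0r.
  have -> : i = rshift 1 i' by exact/val_inj.
  rewrite XE; case: (splitP j) => j' Ej.
    have -> : j = lshift k j' by exact/val_inj.
    by rewrite block_mxEdl mxE mulr0.
  have -> : j = rshift n.+1 j' by exact/val_inj.
  by rewrite block_mxEdr mxE mulr0.
move=> /(congr1 (mulmx^~ J)); rewrite /= -mulmxA JJ mulmxN mulmx1 mul0mx => /eqP.
rewrite oppr_eq0 => /eqP/rowP r0; apply/eqP; rewrite -subr_eq0; apply/eqP/rowP => j.
by have := r0 (lshift k j); rewrite XE mxE block_mxEul => ->; rewrite !mxE.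
Qed.

End Boundary.

Section IsolatedFixedPoint.
Variables (R : realType) (n : nat) (W : C2_manifold (halfspace R n)).
Let oT := @orthant_stable_setT R n.

(** On the tangent space of a pointwise fixed part of the boundary the involution
   is the identity, so the fixed space has dimension at least [n]. *)
Lemma trivial_boundary_not_half_turn (M : complex_C2_manifold R n) (f : M -> W) c x D :
  (1 < n)%N -> (forall y : M, act y = y) -> equivariant_immersion f ->
  tangent_map (@act _ _ _ W) c c (f x) D -> ~ half_turn D.
Proof.
move=> n1 triv [[sf free] ef] tD [_ r1]; have [cA _ cx _ _] := tD.
have [d dA dx] := atlas_cover x.
have [E tE] := smooth_map_tangent sf dA cA dx cx.
have fE : f = @act _ _ _ W \o f by apply/funext => y; rewrite /= -ef triv.
have [cf _] := sf.
have ED := tangent_map_comp oT (cf x) fE tE tD tE.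
have : (\rank (E *m (1%:M + D)) <= 1)%N by rewrite -r1 mxrankM_maxr.
rewrite mulmxDr mulmx1 -ED -mulr2n -[E *+ 2]scaler_nat.
have two0 : 2%:R != 0 :> R by rewrite pnatr_eq0.
rewrite (eqmx_scale E two0).
by have /eqP -> := free _ _ _ _ tE; rewrite leqNgt n1.
Qed.

(** The [-1] eigenspace contains the image of the tangent space of [N], which has
   dimension [n], and the normal is fixed. *)
Lemma isolated_boundary_half_turn (N : complex_C2_manifold R n) (g : N -> W) (p : N)
    b c D (nu : 'rV[R]_n.+1) :
  act p = p -> tangent_map (@act _ _ _ N) b b p (- 1%:M) -> equivariant_immersion g ->
  tangent_map (@act _ _ _ W) c c (g p) D -> nu *m D = nu -> nu != 0 -> half_turn D.
Proof.
move=> fp tN [[sg free] eg] tD nuD nu0; have [cA _ cx _ _] := tD.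
have [bA _ bx _ _] := tN.
have fgp : act (g p) = g p by rewrite -eg fp.
have DD := involution_tangent (@orthant_stable_halfspace R n) fgp tD.
have [E tE] := smooth_map_tangent sg bA cA bx cx.
have [cg _] := sg; have [ca _] := act_smooth N.
have tE' : tangent_map g b c (act p) E by rewrite fp.
have ga : g \o @act _ _ _ N = @act _ _ _ W \o g by apply/funext => y; rewrite /= eg.
have s1 := tangent_map_comp_strict (ca p) tN tE'.
have s2 := tangent_map_comp_strict (cg p) tE tD; rewrite -ga in s2.
have ED : E *m D = - E.
  by rewrite -[RHS]mul1mx mulmxN -mulNmx; exact: strict_deriv_unique oT I s2 s1.
have r2 : (n <= \rank (1%:M - D)%R)%N.
  have /eqP rE := free _ _ _ _ tE; apply: (@leq_trans (\rank E)); first by rewrite rE.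
  have two0 : 2%:R != 0 :> R by rewrite pnatr_eq0.
  rewrite -(eqmx_scale E two0) scaler_nat mulr2n -{2}[E]opprK -ED -{1}[E]mulmx1 -mulmxBr.
  exact: mxrankM_maxr.
have r1 : (0 < \rank (1%:M + D)%R)%N.
  rewrite lt0n mxrank_eq0; apply: contraNneq nu0 => S0.
  have : nu *m (1%:M + D) = 0 by rewrite S0 mulmx0.
  rewrite mulmxDr mulmx1 nuD -mulr2n -[nu *+ 2]scaler_nat => /eqP.
  by rewrite scaler_eq0 pnatr_eq0.
split=> //; apply/eqP; rewrite eqn_leq r1 andbT.
move: (\rank _) (\rank _) (mxrank_involution DD) r2 => i j ij r2.
by rewrite -(leq_add2r n) add1n -ij leq_add2l.
Qed.

End IsolatedFixedPoint.

(** The curve of the points with a positive axis would have the boundary point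
   [g p], although at each of its boundary points the positive axis is the inward
   normal of [N]. *)
Theorem isolated_fixed_point_not_cobordant (R : realType) (n : nat)
    (M N : complex_C2_manifold R n) (p : N) b :
  (1 < n)%N -> (forall y : M, act y = y) ->
  act p = p -> tangent_map (@act _ _ _ N) b b p (- 1%:M) -> ~ cobordant M N.
Proof.
move=> n1 triv fp tN [W [k [J [f [g [[cJ eJ] [imf img] [injf injg] [_ bd] [_ rg]]]]]]].
have normal q c D : act q = q -> tangent_map (@act _ _ _ W) c c (g q) D ->
    exists nu : 'rV[R]_n.+1, [/\ 0 < nu 0 0, nu *m D = nu, nu != 0 & positive (J c (g q)) nu].
  move=> fq tD; have [cA _ cx _ _] := tD.
  have fgq : act (g q) = g q by rewrite -img.2 fq.
  have [d dA dx] := atlas_cover q.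
  have [E tE] := smooth_map_tangent img.1.1 dA cA dx cx.
  have [nu []] := restricts_to_frame rg tE; rewrite mul1r => nu0 FJ; exists nu; split=> //.
  - exact: normal_fixed (structure_sqr cJ cA cx) (structure_fixed eJ fgq tD) FJ.
  - by apply: contraTneq nu0 => ->; rewrite mxE ltxx.
  - exists (std_J R (1 + k)) => //.
    by exists 1%:M; rewrite ?det1 // mul1mx mulmx1.
have inward c x D e : act x = x -> axis J c x D e -> fwd c x 0 0 = 0 -> 0 < e 0 0.
  move=> fx [tD hD eD e0 pe] x0; have [cA _ cx _ _] := tD.
  have : boundary x by exists c.
  rewrite -bd => -[[y _ yx]|[q _ qx]]; subst x.
    by case: (trivial_boundary_not_half_turn n1 triv imf tD hD).
  have fq : act q = q by apply: injg; rewrite img.2.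
  have [nu [nu0 nuD nun pnu]] := normal q c D fq tD.
  have DD := involution_tangent (@orthant_stable_halfspace R n) fx tD.
  have [l [el _]] := coaxis_exists DD eD e0.
  have nuE := half_turn_fixed hD eD el nuD; set a := (nu *m l) 0 0 in nuE.
  have a0 : a != 0 by apply: contraNneq nun => a0; rewrite nuE a0 scale0r.
  have a_gt0 : 0 < a.
    by apply: (positive_sign (structure_sqr cJ cA cx) el a0 pe); rewrite -nuE.
  by move: nu0; rewrite nuE mxE pmulr_rgt0.
have : boundary (g p) by rewrite -bd; right; exists p.
apply: (no_boundary_source cJ eJ inward).
have fgp : act (g p) = g p by rewrite -img.2 fp.
split=> //; have [c cA cx] := atlas_cover (g p).
have [D tD] := fixed_tangent_map fgp cA cx.
have [nu [_ nuD nu0 pnu]] := normal p c D fp tD.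
exists c, D, nu; split=> //.
exact: isolated_boundary_half_turn fp tN img tD nuD nu0.
Qed.

(** * The projective line of the sum of the trivial and the sign representation *)

Section SignLine.
Variable R : realType.
Local Notation rho := (dsum_rep (trivial_rep R) (sign_rep R)).
Local Notation N := (projective_line rho).

Lemma sign_rep_mul (q : 'rV[R]_2) :
  (affine_vector ord0 q : 'rV[R[i]]_2) *m rho = affine_vector ord0 (- q).
Proof.
have e0 : ord0 = lshift 1 ord0 :> 'I_(1 + 1) by exact/val_inj.
have e1 : ord_max = rshift 1 ord0 :> 'I_(1 + 1) by exact/val_inj.
have r1 : rev_ord ord0 = ord_max :> 'I_2 by exact/val_inj.
have rhoE (i j : 'I_2) (i' j' : 'I_(1 + 1)) : i = i' -> j = j' ->
  rho i j = block_mx (1%:M : 'M[R[i]]_1) 0 0 (- 1%:M : 'M[R[i]]_1) i' j'.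
  by move=> -> ->.
apply/rowP => j; rewrite act_coordE r1 [RHS]mxE; have [->|->] := ord2P j.
  rewrite (rhoE _ _ _ _ e0 e0) (rhoE _ _ _ _ e1 e0) block_mxEul block_mxEdl !mxE /=.
  by rewrite mulr0 addr0.
rewrite (rhoE _ _ _ _ e0 e1) (rhoE _ _ _ _ e1 e1) block_mxEur block_mxEdr !mxE /=.
by rewrite add0r mulrN1 /toC !mxE; apply/eqP; rewrite eq_complex /= !eqxx.
Qed.

Definition sign_point : N := bwd (affine_chart R ord0) 0.

Lemma sign_point_fixed : act sign_point = sign_point.
Proof.
rewrite /sign_point /act /= proj_act_line_of; apply/line_ofP; exists 1.
  exact: oner_neq0.
by rewrite scale1r /= sign_rep_mul oppr0.
Qed.

Lemma sign_point_tangent :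
  tangent_map (@act _ _ _ N) (affine_chart R ord0) (affine_chart R ord0) sign_point (- 1%:M).
Proof.
pose c : chart R 2 N := affine_chart R ord0.
have cA : atlas c by exists ord0.
have [cx cE] := affine_chartVK ord0 (0 : 'rV[R]_2).
have cfx : dom c (act sign_point) by rewrite sign_point_fixed.
have [D tD] := smooth_map_tangent (act_smooth N) cA cA cx cfx.
suff -> : - 1%:M = D by [].
apply: (strict_deriv_unique (@orthant_stable_setT R 2) _ _ (tangent_map_strict tD)) => //.
apply: (@strict_deriv_sub _ _ _ setT setT _ -%R) => [|e e0].
  apply: (near_open (@openT _) Logic.I) => q _ _; split=> //.
  apply: etrans (act_ratioE rho ord0 ord0 q) _; rewrite /act_ratio sign_rep_mul.
  by rewrite -/(Defs.ratio ord0 (affine_vector ord0 (- q))) ratio_affine_vector toCK.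
exists 1 => // y z _ _ _ _; rewrite mulmxN mulmx1.
rewrite [X in `|X|](_ : _ = 0) ?normr0 ?mulr_ge0 ?(ltW e0) //.
by apply/rowP => j; rewrite !mxE; ring.
Qed.

End SignLine.

Theorem corollary9p4 (R : realType) :
  ~ cobordant
      (projective_line (dsum_rep (trivial_rep R) (trivial_rep R)))
      (projective_line (dsum_rep (trivial_rep R) (sign_rep R))).
Proof.
apply: (isolated_fixed_point_not_cobordant (p := sign_point R)) (sign_point_fixed R)
  (sign_point_tangent R) => // y.
by rewrite /act /= -[dsum_rep _ _]/(trivial_rep2 R) proj_act1.
Qed.
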